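(* Let $m,n\in\mathbb{N}$. (1) The topological ideal zeta function of $L_{m,n}$ is given by $$\zeta^{\triangleleft}_{L_{m,n},\mathrm{top}}(s)=\frac{n!}{\left(\prod_{j=0}^{d(m,n)-1}(s-j)\right)\left(\prod_{i=0}^{n-1}\left(b_i^{\triangleleft}(m,n)s-a_i^{\triangleleft}(m,n)\right)\right)}\in\mathbb{Q}(s).$$ It has degree $-h(m,n)$ in $s$, a simple pole at $s=0$ with residue $\frac{(-1)^{h(m,n)-1}}{(h(m,n)-1)!}$, and satisfies $$\left.s^{-h(m,n)}\zeta^{\triangleleft}_{L_{m,n},\mathrm{top}}(s^{-1})\right|_{s=0}=\frac{n!}{\prod_{i=0}^{n-1}b_i^{\triangleleft}(m,n)}=:\mu^{\triangleleft}_{m,n}\in\mathbb{Q}_{>0},$$ a nonzero rational number satisfying $\mu^{\triangleleft}_{m,n}\,h(m,n)!\in\mathbb{N}$. (2) The reduced ideal zeta function of $L_{m,n}$ is given by $$\zeta^{\triangleleft}_{L_{m,n},\mathrm{red}}(Y)=\frac{\sum_{w\in S_n}\prod_{j\in\operatorname{Des}(w)}Y^{b^{\triangleleft}_{n-j}(m,n)}}{(1-Y)^{d(m,n)}\prod_{i=0}^{n-1}\left(1-Y^{b_i^{\triangleleft}(m,n)}\right)}.$$ It has degree $-d(m,n)-h(m,n)$ in $Y$, a pole of order $h(m,n)$ at $Y=1$, and satisfies $$\left.\zeta^{\triangleleft}_{L_{m,n},\mathrm{red}}(Y)(1-Y)^{h(m,n)}\right|_{Y=1}=\mu^{\triangl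eleft}_{m,n}\in\mathbb{Q}_{>0}.$$
   Context: $\mathbb{N}=\{1,2,\dots\}$, $\mathbb{N}_0=\mathbb{N}\cup\{0\}$. The degree of a rational function is the degree of its numerator minus the degree of its denominator. For $w$ in the symmetric group $S_n$, $\operatorname{Des}(w)=\{i\in\{1,\dots,n-1\}\mid w(i+1)<w(i)\}$. The Lie ring $L_{m,n}$: put $\mathbf{E}=\{\mathbf{e}\in\mathbb{N}_0^n \mid e_1+\dots+e_n=m-1\}$ and $\mathbf{F}=\{\mathbf{f}\in\mathbb{N}_0^n\mid f_1+\dots+f_n=m\}$. $L_{m,n}$ is the class-2-nilpotent Lie ring which is free as a $\mathbb{Z}$-module on the elements $x_{\mathbf{e}}$ ($\mathbf{e}\in\mathbf{E}$), $y_{\mathbf{f}}$ ($\mathbf{f}\in\mathbf{F}$), $z_1,\dots,z_n$, with $[x_{\mathbf{e}},y_{\mathbf{f}}]=-[y_{\mathbf f},x_{\mathbf e}]=z_i$ if $\mathbf{f}-\mathbf{e}$ is the $i$-th standard basis vector of $\mathbb{Z}^n$, $[x_{\mathbf{e}},y_{\mathbf{f}}]=0$ if $\mathbf{f}-\mathbf{e}$ is not a standard basis vector, and all other brackets of basis elements equal to $0$. Numbers: $e(m,n)=\binom{n+m-2}{n-1}$, $f(m,n)=\binom{n+m-1}{n-1}$, $d(m,n)=e(m,n)+f(m,n)$, $h(m,n)=d(m,n)+n$, and for $i\in\{0,\dots,n-1\}$: $a_i^{\triangleleft}(m,n)=(n-i)(i+d(m,n))$, $b_i^{\triangleleft}(m,n)=n-i+e(m,n)+\sum_{j=i+1}^{n}e(m,j)$.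 Zeta functions: for a compact discrete valuation ring $\mathfrak{o}$ with residue field cardinality $q$, let $L_{m,n}(\mathfrak{o})=L_{m,n}\otimes_{\mathbb{Z}}\mathfrak{o}$ and $\zeta^{\triangleleft}_{L_{m,n}(\mathfrak{o})}(s)=\sum_I|L_{m,n}(\mathfrak{o}):I|^{-s}$, with $I$ ranging over the $\mathfrak{o}$-ideals of finite index. For given $m,n$ there is a unique rational function $W(X,Y)\in\mathbb{Q}(X,Y)$ such that $\zeta^{\triangleleft}_{L_{m,n}(\mathfrak{o})}(s)=W(q,q^{-s})$ for all such $\mathfrak{o}$. The topological ideal zeta function $\zeta^{\triangleleft}_{L_{m,n},\mathrm{top}}(s)\in\mathbb{Q}(s)$ is defined by $$W(q,q^{-s})=\zeta^{\triangleleft}_{L_{m,n},\mathrm{top}}(s)\,(q-1)^{-h(m,n)}+O\left((q-1)^{-h(m,n)+1}\right),$$ where $W(q,q^{-s})$ is expanded as a formal Laurent series in $q-1$ with coefficients in $\mathbb{Q}(s)$, using $q^{-s}=\sum_{k\ge 0}\binom{-s}{k}(q-1)^k$. The reduced ideal zeta function is $\zeta^{\triangleleft}_{L_{m,n},\mathrm{red}}(Y)=W(1,Y)\in\mathbb{Q}(Y)$. *)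

(* Defs.v *)
From HB Require Import structures.
From mathcomp Require Import all_boot all_order all_algebra all_fingroup.
From mathcomp Require Import finmap.
From mathcomp Require Import all_classical all_reals all_analysis.

Set Implicit Arguments.
Unset Strict Implicit.
Unset Printing Implicit Defensive.

Import Order.TTheory GRing.Theory Num.Theory.

Local Open Scope classical_set_scope.
Local Open Scope ring_scope.

Section Numbers.
Variables m n : nat.

Definition e_num : nat := 'C(n + m - 2, n - 1).
Definition f_num : nat := 'C(n + m - 1, n - 1).
Definition d_num : nat := (e_num + f_num)%N.
Definition h_num : nat := (d_num + n)%N.
Definition a_num (i : nat) : nat := ((n - i) * (i + d_num))%N.

End Numbers.

Definition b_num (m n i : nat) : nat :=
  (n - i + e_num m n + \sum_(i.+1 <= j < n.+1) e_num m j)%N.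

Definition mu_num (m n : nat) : rat := n`!%:R / \prod_(i < n) (b_num m n i)%:R.

(* With positions numbered from 0, j : 'I_n is the 1-based position j + 1 and
   its predecessor i is the 1-based position j, so nat_of_ord j is a descent in
   {1, ..., n-1} in the usual 1-based sense. *)
Definition Des (n : nat) (w : 'S_n) : {set 'I_n} :=
  [set j : 'I_n | [exists i : 'I_n, (i.+1 == j :> nat) && (w j < w i)%N]]%SET.

(* Vectors in N_0^n with coordinate sum k, so each coordinate is at most k. *)
Definition weak_comp (n k : nat) : Type :=
  {v : {ffun 'I_n -> 'I_k.+1} | (\sum_i v i)%N == k}.
HB.instance Definition _ n k := Finite.on (weak_comp n k).

(* The x_e, the y_f and the z_i; m.-1 is meant for m > 0. *)
Definition Lbasis (m n : nat) : Type :=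
  ((weak_comp n m.-1 + weak_comp n m) + 'I_n)%type.
HB.instance Definition _ m n := Finite.on (Lbasis m n).

Section LieRing.
Variables (m n : nat) (A : comNzRingType).

(* The free A-module on the basis, that is L_{m,n} tensored with A;
   L_{m,n} itself is the case A = int. *)
Definition Lmn : Type := {ffun Lbasis m n -> A^o}.
HB.instance Definition _ := GRing.Lmodule.on Lmn.

Definition gen (b : Lbasis m n) : Lmn := [ffun b' => (b' == b)%:R].

Definition bracket_xy (e : weak_comp n m.-1) (f : weak_comp n m) : Lmn :=
  if [pick i : 'I_n |
       [forall j, val f j == (val e j + (j == i))%N :> nat]] is Some i
  then gen (inr i) else 0.

Definition bracket_gen (b b' : Lbasis m n) : Lmn :=
  match b, b' with
  | inl (inl e), inl (inr f) => bracket_xy e f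
  | inl (inr f), inl (inl e) => - bracket_xy e f
  | _, _ => 0
  end.

Definition bracket (u v : Lmn) : Lmn :=
  \sum_b \sum_b' (u b * v b') *: bracket_gen b b'.

Definition is_ideal (I : set Lmn) : Prop :=
  [/\ I 0,
      forall u v, I u -> I v -> I (u + v),
      forall (a : A) u, I u -> I (a *: u)
    & forall u v, I u -> I (bracket u v)].

End LieRing.

Definition is_dvr (o : idomainType) : Prop :=
  exists2 pi : o, pi != 0 /\ pi \isn't a GRing.unit
    & forall x : o, x != 0 ->
        exists (u : o) (k : nat), u \is a GRing.unit /\ x = u * pi ^+ k.

(* Topology on an integral domain whose neighbourhoods of 0 are generated by the
   nonzero principal ideals; in a discrete valuation ring these are exactly the
   powers of the maximal ideal. *)
Definition adic (o : idomainType) : Type := o.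

Section AdicTopology.
Variable o : idomainType.

Definition adic_open (U : set (adic o)) : Prop :=
  forall x : o, U x -> exists2 a : o, a != 0 & forall y : o, U (x + a * y).

Lemma adic_openT : adic_open setT.
Proof. by move=> x _; exists 1 => //; exact: oner_neq0. Qed.

Lemma adic_openI : setI_closed adic_open.
Proof.
move=> U V oU oV x [Ux Vx].
have [a a0 aU] := oU x Ux; have [b b0 bV] := oV x Vx.
exists (a * b); first by rewrite mulf_neq0.
by move=> y; split; [rewrite -mulrA | rewrite (mulrC a) -mulrA].
Qed.

Lemma adic_open_bigU (J : Type) (f : J -> set (adic o)) :
  (forall i, adic_open (f i)) -> adic_open (\bigcup_i f i).
Proof.
move=> of_ x [i _ fix_]; have [a a0 aU] := of_ i x fix_.
by exists a => // y; exists i.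
Qed.

HB.instance Definition _ := Choice.on (adic o).
HB.instance Definition _ :=
  isOpenTopological.Build (adic o) adic_openT adic_openI adic_open_bigU.

End AdicTopology.

Definition is_compact_dvr (o : idomainType) : Prop :=
  is_dvr o /\ compact [set: adic o].

Definition cosets (V : zmodType) (I : set V) : set (set V) :=
  [set [set x + y | y in I] | x in [set: V]].

Definition coset_index (V : zmodType) (I : set V) : nat := #|` fset_set (cosets I)|.

Definition residue_card (o : idomainType) : nat :=
  coset_index [set x : o | x \isn't a GRing.unit].

Definition ideal_zeta (R : realType) (m n : nat) (o : idomainType) (s : R)
    : \bar R :=
  (\esum_(I in [set I : set (Lmn m n o) | is_ideal I /\ finite_set (cosets I)])
     (((coset_index I)%:R : R) `^ (- s))%:E)%E.

(* For a ring morphism phi (a substitution), F can be written with a denominator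
   not killed by phi, and its image under the extension of phi is y. *)
Definition frac_at (P : idomainType) (L : fieldType) (phi : P -> L)
    (F : {fraction P}) (y : L) : Prop :=
  exists p q : P, [/\ phi q != 0, F = tofrac p / tofrac q & y = phi p / phi q].

Definition eval1 (A : comUnitRingType) (p : {poly rat}) (x : A) : A :=
  (map_poly ratr p).[x].

(* In {poly {poly rat}}, as in polyXY, X is the outer variable and Y the inner. *)
Definition eval2 (A : comUnitRingType) (p : {poly {poly rat}}) (x y : A) : A :=
  (map_poly (map_poly ratr) p).[x, y].

(* Q(X, Y), and the univariate Q(s) or Q(Y). *)
Notation ratfun2 := {fraction {poly {poly rat}}}.
Notation ratfun := {fraction {poly rat}}.

Definition ratvar : ratfun := tofrac 'X.

Definition has_degree (F : ratfun) (k : int) : Prop :=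
  exists p q : {poly rat},
    [/\ p != 0, q != 0, F = tofrac p / tofrac q
      & k = (size p).-1%:Z - (size q).-1%:Z].

(* F(s^-1) = G(s). *)
Definition inverse_subst (F G : ratfun) : Prop :=
  frac_at (fun p => eval1 p ratvar^-1) F G.

Definition value_at (F : ratfun) (x y : rat) : Prop :=
  frac_at (fun p : {poly rat} => p.[x]) F y.

(* For formal power series f, g, c in K[[u]] given by their coefficients:
   g <> 0 and f / g = u^(-h) c in K((u)). *)
Definition is_laurent (K : fieldType) (f g : nat -> K) (h : nat) (c : nat -> K)
    : Prop :=
  (exists k, g k != 0) /\
  forall k, \sum_(i < k.+1) g i * c (k - i)%N
            = if (h <= k)%N then f (k - h)%N else 0.

(* F = sum_k c_k (s - x)^(k - h). *)
Definition laurent_at (F : ratfun) (x : rat) (h : nat) (c : nat -> rat) : Prop :=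
  exists p q : {poly rat}, F = tofrac p / tofrac q /\
    is_laurent (fun k => (p \Po ('X + x%:P))`_k)
               (fun k => (q \Po ('X + x%:P))`_k) h c.

Definition pole_of_order (F : ratfun) (x : rat) (k : nat) : Prop :=
  (0 < k)%N /\ exists2 c, laurent_at F x k c & c 0%N != 0.

Definition has_residue (F : ratfun) (x r : rat) : Prop :=
  exists k c, laurent_at F x k.+1 c /\ c k = r.

(* The identity zeta(s) = W(q, q^-s) is required for all large enough real s,
   where the series converges; this determines W. *)
Definition is_uniform_zeta (R : realType) (m n : nat) (W : ratfun2) : Prop :=
  forall o : idomainType, is_compact_dvr o ->
    let q : R := (residue_card o)%:R in
    exists sigma : R, forall s : R, sigma < s ->
      exists2 w : R, frac_at (fun p => eval2 p q (q `^ (- s))) W w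
        & ideal_zeta m n o s = w%:E.

Definition gbinom (K : fieldType) (x : K) (k : nat) : K :=
  (\prod_(j < k) (x - j%:R)) / k`!%:R.

(* Coefficient of u^k in p(1 + u, (1 + u)^-s), where u = q - 1. It only depends
   on the binomial series up to order k, hence the truncation. *)
Definition expansion (p : {poly {poly rat}}) (k : nat) : ratfun :=
  (eval2 p (1 + 'X) (\poly_(j < k.+1) gbinom (- ratvar) j))`_k.

Definition is_top_zeta (m n : nat) (W : ratfun2) (Z : ratfun) : Prop :=
  exists p q : {poly {poly rat}}, W = tofrac p / tofrac q /\
    exists2 c : nat -> ratfun,
      is_laurent (expansion p) (expansion q) (h_num m n) c & c 0%N = Z.

Definition is_red_zeta (W : ratfun2) (Z : ratfun) : Prop :=
  frac_at (fun p => eval2 p 1 ratvar) W Z.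

(* Main.v *)
Require Import Defs.
From HB Require Import structures.
From mathcomp Require Import all_boot all_order all_algebra all_fingroup.
From mathcomp Require Import all_classical all_reals all_analysis.
From mathcomp Require Import ring lra zify.

Set Implicit Arguments.
Unset Strict Implicit.
Unset Printing Implicit Defensive.

Import Order.TTheory GRing.Theory Num.Theory.
From mathcomp.multinomials Require mpoly.
Import (canonicals) mpoly.

(** The function [W] is determined by its values at [(q, q ^ (- s))] for the
    power series rings over the prime fields: a polynomial in two variables that
    vanishes at [(p, p ^ (- s))] for all primes [p] and all large real [s] is
    zero. So it is enough to compute the ideal zeta function of the Lie ring
    over a ring [o] of power series with residue field of cardinality [q]; the
    result is [zeta_closed_form].

    Write the Lie ring as [L = o ^ d + Z], where [Z = o ^ n] is spanned by the
    [z_i]. A submodule [I] whose trace on [Z] is [Lam] is an ideal if and only if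
    it lies in [X(Lam)], the set of all [u] with [[u, L]] contained in [Lam].
    Since [X(Lam)] is free and contains [Z], the ideals over [Lam] correspond to
    the lattices of [o ^ d + Z] with trace [Lam], and these are counted by
    splitting off one coordinate at a time ([trace_sum]). Up to the factors
    [1 / (1 - q ^ (j - s))], [j < d], this leaves the sum over all lattices [Lam]
    of [Z] of [|Z : Lam| ^ (d - s) * |L : X(Lam)| ^ (- s)] ([ideal_zeta_sum]).

    This sum is computed by comparing [Lam] with its colon lattice
    [(Lam : pi)]. If [Lam + pi Z] has index [q ^ c] in [Z], passing from the colon
    lattice to [Lam] multiplies [|Z : Lam|] by [q ^ c], and multiplies
    [|L : X(Lam)|] by a power of [q] that depends only on [c]
    ([centraliser_index]). The latter is linear algebra over the residue field
    once [x_e] and [y_f] are seen as monomials of degrees [m - 1] and [m] and the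
    bracket as the pairing dual to the multiplication by variables. The exponents
    add up to [b_(n - c)]. The number of lattices with given invariant [c] and
    given colon lattice is a multiple of a Gaussian binomial coefficient
    ([fibre_sum]), so the partial sums over the lattices with given [c] satisfy a
    linear recursion ([Gsum_rec]), which [igusa_solve] solves by a fraction with
    denominator the product of all [1 - q ^ a_i * q ^ (- b_i s)].

    At [q = 1] the Gaussian coefficients become binomial coefficients, and the
    numerator becomes the sum over the permutations of the monomials attached to
    their descents ([igusaN_des_sum], [des_sum_perm]): this is the reduced zeta
    function. Its value at [Y = 1] is [n!]. Each factor
    [1 - q ^ a * q ^ (- b s)] of the denominator has leading term
    [(b s - a) (q - 1)], which gives the topological zeta function ([top_zeta]).
    The degrees, poles and special values are then read off the two explicit
    fractions; besides, they use that [b_0 = h] and that the [b_i] decrease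
    strictly, so that the product of the [b_i] divides [h!]. *)

Local Open Scope card_scope.
Local Open Scope classical_set_scope.
Local Open Scope ring_scope.

(** * Sums of nonnegative families *)
Section EsumTools.
Variable R : realType.
Local Open Scope ereal_scope.

Lemma esum_can (T T' : choiceType) (P : set T) (Q : set T') (e : T -> T')
    (e' : T' -> T) (a : T' -> \bar R) :
    (forall i, P i -> Q (e i)) -> (forall j, Q j -> P (e' j)) ->
    (forall i, P i -> e' (e i) = i) -> (forall j, Q j -> e (e' j) = j) ->
  \esum_(j in Q) a j = \esum_(i in P) a (e i).
Proof.
move=> eP eQ eK e'K; apply: reindex_esum; split => //.
- by move=> i j; rewrite !inE => Pi Pj eij; rewrite -(eK i)// -(eK j)// eij.
- by move=> j Qj; exists (e' j); [exact: eQ|exact: e'K].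
Qed.

(** The terms are nonnegative, so they may be grouped by the value of [f]. *)
Lemma esum_fibers (T1 T2 : choiceType) (P : set T1) (Q : set T2) (f : T2 -> T1)
    (a : T2 -> \bar R) :
    (forall j, Q j -> P (f j)) -> (forall j, 0 <= a j) ->
  \esum_(j in Q) a j =
  \esum_(i in P) \esum_(j in [set j | Q j /\ f j = i]) a j.
Proof.
move=> fQ a0; rewrite esum_esum//.
apply: (@esum_can _ _ _ _ (fun k => k.2) (fun j => (f j, j))) => /=.
- by move=> [i j] /= [_ []].
- by move=> j Qj; split => //=; exact: fQ.
- by move=> [i j] /= [_ [_ ->]].
- by [].
Qed.

Lemma esumZl (T : choiceType) (P : set T) (c : R) (a : T -> \bar R) :
    (0 <= c)%R -> (forall i, 0 <= a i) ->
  \esum_(i in P) (c%:E * a i) = c%:E * \esum_(i in P) a i.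
Proof.
have le (c' : R) (b : T -> \bar R) : (0 <= c')%R -> (forall i, 0 <= b i) ->
    \esum_(i in P) (c'%:E * b i) <= c'%:E * \esum_(i in P) b i.
  move=> c0 b0; apply: ge_ereal_sup => _ [X [finX XP] <-].
  rewrite fsbig_finite//= -ge0_sume_distrr; last by move=> *; exact: b0.
  rewrite lee_wpmul2l// -fsbig_finite//.
  by apply: esum_ge; exists X.
rewrite le_eqVlt => /predU1P[<-|c0] a0.
  by rewrite mul0e esum1// => i _; rewrite mul0e.
apply/eqP; rewrite eq_le; apply/andP; split; first by apply: le => //; exact: ltW.
have ca0 i : 0 <= c%:E * a i by apply: mule_ge0 => //; rewrite lee_fin ltW.
have ci0 : (0 <= c^-1)%R by rewrite invr_ge0 ltW.
have := le _ _ ci0 ca0.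
rewrite (@eq_esum _ _ _ _ a) => [h|i _]; last first.
  by rewrite muleA -EFinM mulVf ?gt_eqF// mul1e.
have c0' : 0 <= c%:E by rewrite lee_fin ltW.
have := lee_wpmul2l c0' h.
by rewrite muleA -EFinM mulfV ?gt_eqF// mul1e.
Qed.

End EsumTools.

(** * Index of a subgroup *)

Section Index.

Definition subgrp (V : zmodType) (I : set V) : Prop :=
  I 0 /\ forall u v, I u -> I v -> I (u - v).

(** Indices are computed through transversals, which unlike sets of cosets can be
    listed and combined explicitly. *)
Definition transversal (V : zmodType) (I T : set V) : Prop :=
  (forall x, exists2 t, T t & I (x - t)) /\
  (forall t t', T t -> T t' -> I (t - t') -> t = t').

(** Stating the index as a relation keeps finiteness of the index apart from its
    value, which [coset_index] sets to a default when it is infinite. *)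
Definition has_index (V : zmodType) (I : set V) (k : nat) : Prop :=
  cosets I #= `I_k.

Lemma has_index_coset (V : zmodType) (I : set V) k :
  has_index I k -> finite_set (cosets I) /\ coset_index I = k.
Proof.
by move=> h; split; [apply/finite_setP; exists k | exact: card_fset_set].
Qed.

Lemma coset_has_index (V : zmodType) (I : set V) :
  finite_set (cosets I) -> has_index I (coset_index I).
Proof. by move=> /finite_setP[k h]; rewrite /coset_index (card_fset_set h). Qed.

Lemma has_index_uniq (V : zmodType) (I : set V) k l :
  has_index I k -> has_index I l -> k = l.
Proof. by move=> /has_index_coset[_ <-] /has_index_coset[_ <-]. Qed.

Variables (V : zmodType) (I : set V).
Hypothesis sI : subgrp I.

Let I0 : I 0. Proof. by case: sI. Qed.

Lemma subgrpB u v : I u -> I v -> I (u - v). Proof. by case: sI => _; apply. Qed.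

Lemma subgrpN u : I u -> I (- u).
Proof. by move=> Iu; rewrite -sub0r; apply: subgrpB. Qed.

Lemma subgrpD u v : I u -> I v -> I (u + v).
Proof. by move=> Iu Iv; rewrite -(opprK v); apply: subgrpB => //; apply: subgrpN. Qed.

Lemma subgrpBC u v : I (u - v) -> I (v - u).
Proof. by move=> /subgrpN; rewrite opprB. Qed.

Lemma subgrp_trans u v w : I (u - v) -> I (v - w) -> I (u - w).
Proof. by move=> a b; have := subgrpD a b; rewrite addrA subrK. Qed.

Definition coset_of_elt (x : V) : set V := [set x + y | y in I].

Lemma coset_eltP x z : coset_of_elt x z <-> I (z - x).
Proof.
split => [[y Iy <-]|Iz]; first by rewrite addrAC subrr add0r.
by exists (z - x) => //; rewrite addrC subrK.
Qed.

Lemma coset_elt_eq x y : coset_of_elt x = coset_of_elt y <-> I (x - y).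
Proof.
split => [e|Ixy].
  by apply/coset_eltP; rewrite -e; apply/coset_eltP; rewrite subrr.
apply/seteqP; split => z /coset_eltP Iz; apply/coset_eltP.
  exact: subgrp_trans Iz Ixy.
exact: subgrp_trans Iz (subgrpBC Ixy).
Qed.

Lemma transversal_card T : transversal I T -> T #= cosets I.
Proof.
move=> [Tex Tun]; suff -> : cosets I = coset_of_elt @` T.
  rewrite card_eq_sym; apply: inj_card_eq => t t'; rewrite !inE => Tt Tt'.
  by move/coset_elt_eq; apply: Tun.
apply/seteqP; split => [_ [x _ <-]|_ [t Tt <-]]; last by exists t.
by have [t Tt It] := Tex x; exists t => //; apply/coset_elt_eq/subgrpBC.
Qed.

Lemma transversal_index T : transversal I T ->
  forall k, T #= `I_k <-> has_index I k.
Proof.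
move=> /transversal_card TI k; rewrite /has_index; split => h.
  by rewrite -(card_eql TI).
by rewrite (card_eql TI).
Qed.

Lemma transversal_ex : exists T, transversal I T.
Proof.
pose r (x : V) := xget 0 (coset_of_elt x).
have rP x : I (r x - x).
  apply/coset_eltP; apply: xgetPex; exists x.
  by apply/coset_eltP; rewrite subrr.
exists (range r); split => [x|_ _ [x _ <-] [y _ <-] h].
  by exists (r x); [exists x|exact/subgrpBC].
congr xget; apply/coset_elt_eq.
exact: subgrp_trans (subgrp_trans (subgrpBC (rP x)) h) (rP y).
Qed.

End Index.

Lemma card_eqX_II (T1 T2 : choiceType) (A : set T1) (B : set T2) k l :
  A #= `I_k -> B #= `I_l -> A `*` B #= `I_(k * l).
Proof.
move=> /card_set_bijP[f [fA finj fs]] /card_set_bijP[g [gB ginj gs]].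
apply/card_set_bijP; exists (fun t => f t.1 * l + g t.2)%N; split.
- move=> [a b] [/= /fA /= fa /gB /= gb].
  rewrite -(ltn_add2l (f a * l)) in gb; apply: (leq_trans gb).
  by rewrite -mulSnr leq_mul2r fa orbT.
- move=> [a b] [a' b']; rewrite !inE => -[/= Aa Bb] [/= Aa' Bb'] e.
  have gb := gB _ Bb; have gb' := gB _ Bb'.
  have l0 : (0 < l)%N by apply: leq_ltn_trans gb.
  have e1 : f a = f a'.
    have := congr1 (divn^~ l) e.
    by rewrite !divnMDl // !divn_small // !addn0.
  move: e; rewrite e1 => /addnI e2.
  by congr (_, _); [apply: finj|apply: ginj]; rewrite ?inE.
- move=> m /= mkl; have l0 : (0 < l)%N by case: (l) mkl; rewrite ?muln0.
  have [a Aa fa] : (f @` A) (m %/ l)%N by apply: fs; rewrite /= ltn_divLR.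
  have [b Bb gb] : (g @` B) (m %% l)%N by apply: gs; rewrite /= ltn_mod.
  by exists (a, b) => //=; rewrite fa gb -divn_eq.
Qed.

Lemma has_index_gt0 (V : zmodType) (I : set V) k : subgrp I -> has_index I k -> (0 < k)%N.
Proof.
move=> sI h; rewrite lt0n; apply/eqP => k0; move: h; rewrite /has_index k0 II0.
rewrite card_eq0 => /eqP/seteqP[h _].
by have := h (coset_of_elt I 0); apply; exists 0.
Qed.

Lemma card_range_finType (T : finType) (U : Type) (f : T -> U) :
  injective f -> range f #= `I_#|T|.
Proof.
move=> finj; rewrite card_eq_sym.
have -> : range f = [set f (enum_val i) | i in [set: 'I_#|T|]].
  apply/seteqP; split => [_ [x _ <-]|_ [i _ <-]]; last by exists (enum_val i).
  by exists (enum_rank x); rewrite ?enum_rankK.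
have -> : (`I_#|T| : set nat) = [set nat_of_ord i | i in [set: 'I_#|T|]].
  apply/seteqP; split => [i /= lti|_ [i _ <-]] //=.
  by exists (Ordinal lti).
rewrite (card_eql (inj_card_eq (in2W (@ord_inj _)))) card_eq_sym.
rewrite (card_eql (inj_card_eq (in2W _))) // => i j /finj.
exact: enum_val_inj.
Qed.

Lemma has_index_setT (V : zmodType) : has_index [set: V] 1.
Proof.
have sT : subgrp [set: V] by [].
apply/(transversal_index (T := [set 0]) sT); first split => //.
- by move=> x; exists 0.
- by move=> t t' -> ->.
have := @card_range_finType unit V (fun=> 0); rewrite card_unit.
rewrite (_ : range _ = [set 0]); first by apply=> -[] [].
by apply/seteqP; split => [_ [_ _ <-]//|_ ->]; exists tt.
Qed.

Lemma has_index_finType (V : zmodType) (I : set V) (T : finType) (f : T -> V) :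
    subgrp I -> (forall x, exists t, I (x - f t)) ->
    (forall t t', I (f t - f t') -> t = t') ->
  has_index I #|T|.
Proof.
move=> sI fex fun_; apply/(transversal_index (T := range f) sI).
  split => [x|_ _ [t _ <-] [t' _ <-] /fun_ -> //].
  by have [t It] := fex x; exists (f t) => //; exists t.
apply: card_range_finType => t t' e; apply: fun_; rewrite e subrr.
by case: sI.
Qed.

(** The index of [L] is the index of [L + th V] times the index of [L] in
    [L + th V], and the latter is the index of the preimage of [L] by the second
    isomorphism theorem. All indices below come from this splitting. *)
Section IndexSplit.
Variables (V W : zmodType) (th : {additive V -> W}) (L : set W).
Hypothesis sL : subgrp L.

Definition sum_im : set W := [set w | exists v, L (w - th v)].

Lemma subgrp_preim : subgrp (th @^-1` L).
Proof.
by split=> [|u v] /=; rewrite ?raddf0 ?raddfB; [case: sL|apply: subgrpB].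
Qed.

Lemma subgrp_sum_im : subgrp sum_im.
Proof.
split; first by exists 0; rewrite raddf0 subrr; case: sL.
move=> u v [x Lx] [y Ly]; exists (x - y).
have := subgrpB sL Lx Ly; congr L.
by rewrite raddfB !opprD !opprK addrACA.
Qed.

Lemma index_split_transversal TA TB :
    transversal (th @^-1` L) TA -> transversal sum_im TB ->
  transversal L [set t.1 + th t.2 | t in TB `*` TA] /\
  {in TB `*` TA &, injective (fun t => t.1 + th t.2)}.
Proof.
move=> [Aex Aun] [Bex Bun].
have key b a b' a' : TB b -> TA a -> TB b' -> TA a' ->
    L (b + th a - (b' + th a')) -> b = b' /\ a = a'.
  move=> Tb Ta Tb' Ta' h; have bb : b = b'.
    apply: Bun => //; exists (a' - a); rewrite raddfB; move: h; congr L.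
    by rewrite !opprD !opprK addrACA [th a - _]addrC.
  split=> //; apply: Aun => //=; rewrite raddfB; move: h; congr L.
  by rewrite bb opprD addrACA subrr add0r.
split; last first.
  move=> [b a] [b' a']; rewrite !inE => -[/= Tb Ta] [/= Tb' Ta'] e.
  by have [|-> ->] := @key b a b' a' Tb Ta Tb' Ta'; rewrite // e subrr; case: sL.
split; last first.
  move=> _ _ [[b a] [/= Tb Ta] <-] [[b' a'] [/= Tb' Ta'] <-] h.
  by have [-> ->] := key _ _ _ _ Tb Ta Tb' Ta' h.
move=> x; have [b Tb [v Lv]] := Bex x; have [a Ta Lva] := Aex v.
exists (b + th a); first by exists (b, a).
move: Lva => /=; rewrite raddfB => Lva.
have := subgrpD sL Lv Lva; congr L.
by rewrite addrA subrK opprD addrA.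
Qed.

Lemma index_split k l :
  has_index (th @^-1` L) k -> has_index sum_im l -> has_index L (l * k).
Proof.
have [TA tA] := transversal_ex subgrp_preim.
have [TB tB] := transversal_ex subgrp_sum_im.
move=> /(transversal_index subgrp_preim tA) kA.
move=> /(transversal_index subgrp_sum_im tB) lB.
have [tL inj] := index_split_transversal tA tB.
apply/(transversal_index sL tL); rewrite (card_eql (inj_card_eq inj)).
exact: card_eqX_II.
Qed.

(** The product of two transversals is a transversal of [L], hence both are finite
    as soon as [L] has finite index. *)
Lemma index_split_fin k : has_index L k ->
  exists k1 k2, has_index (th @^-1` L) k1 /\ has_index sum_im k2.
Proof.
have [TA tA] := transversal_ex subgrp_preim.
have [TB tB] := transversal_ex subgrp_sum_im.
have [tL inj] := index_split_transversal tA tB.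
move=> /(transversal_index sL tL); rewrite (card_eql (inj_card_eq inj)) => h.
have fin : finite_set (TB `*` TA) by apply/finite_setP; exists k.
have [a0 Ta0 _] := tA.1 0; have [b0 Tb0 _] := tB.1 0.
have fA : finite_set TA.
  apply: sub_finite_set (finite_image snd fin) => a Ta.
  by exists (b0, a).
have fB : finite_set TB.
  apply: sub_finite_set (finite_image fst fin) => b Tb.
  by exists (b, a0).
have /finite_setP[k1 h1] := fA; have /finite_setP[k2 h2] := fB.
exists k1, k2; split.
- exact/(transversal_index subgrp_preim tA).
- exact/(transversal_index subgrp_sum_im tB).
Qed.

End IndexSplit.

(** * Lattices over a discrete valuation ring *)

Section Submodules.
Variable o : idomainType.

Definition submod (V : lmodType o) (I : set V) : Prop :=
  I 0 /\ forall a u v, I u -> I v -> I (a *: u + v).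

Definition lattice (V : lmodType o) (I : set V) : Prop :=
  submod I /\ finite_set (cosets I).

Variables (V : lmodType o) (I : set V).
Hypothesis sI : submod I.

Lemma submod0 : I 0. Proof. by case: sI. Qed.

Lemma submodZ a u : I u -> I (a *: u).
Proof. by move=> Iu; rewrite -(addr0 (a *: u)); apply: sI.2 => //; apply: submod0. Qed.

Lemma submodD u v : I u -> I v -> I (u + v).
Proof. by move=> Iu Iv; rewrite -(scale1r u); apply: sI.2. Qed.

Lemma submodB u v : I u -> I v -> I (u - v).
Proof. by move=> Iu Iv; rewrite -scaleN1r addrC; apply: sI.2. Qed.

Lemma submod_subgrp : subgrp I.
Proof. by split; [exact: submod0|exact: submodB]. Qed.

Lemma submod_sum (J : finType) (P : pred J) (f : J -> V) :
  (forall j, P j -> I (f j)) -> I (\sum_(j | P j) f j).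
Proof.
by move=> h; elim/big_ind: _ => //; [exact: submod0|exact: submodD].
Qed.

Lemma submodDr u v : I v -> I (u + v) <-> I u.
Proof.
move=> Iv; split => [Iuv|Iu]; last exact: submodD.
by rewrite -(addrK v u); apply: submodB.
Qed.

End Submodules.

Lemma submod_preim (o : idomainType) (V W : lmodType o) (f : {linear V -> W})
  (L : set W) : submod L -> submod (f @^-1` L).
Proof.
move=> sL; split=> [|a u v] /=; rewrite ?linear0 ?linearP; first exact: submod0.
exact: sL.2.
Qed.

Lemma submod_im (o : idomainType) (V W : lmodType o) (f : {linear V -> W})
  (I : set V) : submod I -> submod (f @` I).
Proof.
move=> sI; split=> [|a _ _ [u Iu <-] [v Iv <-]].
  by exists 0; rewrite ?linear0 //; apply: submod0.
by exists (a *: u + v); rewrite ?linearP //; apply: sI.2.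
Qed.

Lemma lattice_index (o : idomainType) (V : lmodType o) (I : set V) :
  lattice I -> has_index I (coset_index I).
Proof. by case=> _; exact: coset_has_index. Qed.

Lemma index_lattice (o : idomainType) (V : lmodType o) (I : set V) k :
  submod I -> has_index I k -> lattice I.
Proof. by move=> sI /has_index_coset[]. Qed.

Lemma lattice_setT (o : idomainType) (V : lmodType o) : lattice [set: V].
Proof. by apply: index_lattice (has_index_setT V). Qed.

Lemma lattice_preim (o : idomainType) (V W : lmodType o) (f : {linear V -> W})
  (L : set W) : lattice L -> lattice (f @^-1` L).
Proof.
move=> lL; have [k1 [_ [h _]]] := index_split_fin f (submod_subgrp lL.1) (lattice_index lL).
by apply: index_lattice h; apply: submod_preim lL.1.
Qed.

Lemma lattice_index_gt0 (o : idomainType) (V : lmodType o) (I : set V) :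
  lattice I -> (0 < coset_index I)%N.
Proof. by move=> lI; apply: has_index_gt0 (submod_subgrp lI.1) (lattice_index lI). Qed.

(** The splitting [index_split] for the submodule [th J], whose preimage is [J]
    and whose sum with the image of [th] is that image. *)
Lemma index_im (o : idomainType) (V W : lmodType o) (th : {linear V -> W})
    (J : set V) k l :
    injective th -> submod J -> has_index J k -> has_index (range th) l ->
  has_index (th @` J) (l * k).
Proof.
move=> thI sJ Jk rl; apply: (index_split (th := th)).
- exact/submod_subgrp/submod_im.
- rewrite (_ : _ @^-1` _ = J) //; apply/seteqP; split=> [v [w Jw /thI <-] //|v Jv].
  by exists v.
rewrite (_ : sum_im _ _ = range th) //; apply/seteqP; split=> [w [v [v' Jv' e]]|_ [v _ <-]].
  by exists (v + v') => //; rewrite linearD e addrC subrK.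
by exists v; exists 0; rewrite ?linear0 ?subrr //; apply: submod0.
Qed.

(** A discrete valuation ring with finite residue field [F] which contains a
    copy of [F], like the power series over [F]. These rings suffice to determine
    the rational function, and the section [io] of the residue map provides
    representatives of the residue classes. *)
Record split_dvr (F : finFieldType) (o : idomainType) := SplitDVR {
  io : {rmorphism F -> o};
  res : {rmorphism o -> F};
  pi : o;
  resK : cancel io res;
  res_ker : forall x, res x = 0 -> exists y, x = pi * y;
  res_pi : res pi = 0;
  pi_neq0 : pi != 0;
  valP : forall x, x != 0 ->
    exists (u : o) (k : nat), u \is a GRing.unit /\ x = u * pi ^+ k }.

Section DVR.
Variables (F : finFieldType) (o : idomainType) (D : split_dvr F o).

Local Notation io := (io D).
Local Notation res := (res D).
Local Notation pi := (pi D).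
Local Notation resK := (resK D).
Local Notation res_ker := (@res_ker _ _ D).
Local Notation res_pi := (res_pi D).
Local Notation pi_neq0 := (pi_neq0 D).
Local Notation valP := (@valP _ _ D).
Local Notation q := #|F|.

Lemma q_gt1 : (1 < q)%N.
Proof. by rewrite (cardD1 0) (cardD1 1) !inE oner_neq0. Qed.

Definition ideal_gen (a : o) : set o^o := [set x | exists y, x = y * a].

Lemma submod_ideal_gen a : submod (ideal_gen a).
Proof.
split=> [|b _ _ [x ->] [y ->]]; first by exists 0; rewrite mul0r.
by exists (b * x + y); rewrite /GRing.scale /= mulrDl mulrA.
Qed.

Lemma index_pi : has_index (ideal_gen pi) q.
Proof.
apply: (@has_index_finType o^o _ F io (submod_subgrp (submod_ideal_gen pi))).
  move=> x; exists (res x).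
  have [|y ->] := @res_ker (x - io (res x)); first by rewrite rmorphB resK subrr.
  by exists y; rewrite mulrC.
move=> t t' [y e]; apply/eqP; rewrite -subr_eq0 -(resK (t - t')) rmorphB.
by rewrite /= e rmorphM res_pi mulr0.
Qed.

Lemma index_pi_exp k : has_index (ideal_gen (pi ^+ k)) (q ^ k).
Proof.
elim: k => [|k IHk].
  rewrite expr0 expn0 (_ : ideal_gen 1 = setT); first exact: has_index_setT.
  by apply/seteqP; split => // x _; exists x; rewrite mulr1.
rewrite expnS; apply: (index_split (th := ( *:%R pi) : {linear o^o -> o^o})).
- exact: submod_subgrp (submod_ideal_gen _).
- rewrite (_ : _ @^-1` _ = ideal_gen (pi ^+ k)) //.
  apply/seteqP; split => [x [y]|x [y ->]].
    rewrite /GRing.scale /= exprS mulrCA => /(mulfI pi_neq0) ->.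
    by exists y.
  by exists y; rewrite /GRing.scale /= exprS mulrCA.
rewrite (_ : sum_im _ _ = ideal_gen pi); first exact: index_pi.
apply/seteqP; split => [x [v [y]]|x [y ->]].
  rewrite /GRing.scale /= => /(canRL (subrK _)) ->.
  by exists (y * pi ^+ k + v); rewrite exprSr mulrA mulrDl (mulrC v).
by exists y, 0; rewrite /GRing.scale /= mul0r mulrC subrr.
Qed.

(** The nonzero submodules of the ring are the powers of the maximal ideal: the
    least exponent that occurs generates. *)
Lemma ideal_genP (K : set o^o) x : submod K -> K x -> x != 0 ->
  exists k, K = ideal_gen (pi ^+ k).
Proof.
move=> sK Kx x0.
have Kv y : K y -> y != 0 -> exists (u : o) (k : nat), y = u * pi ^+ k /\ K (pi ^+ k).
  move=> Ky /valP[u [k [uu e]]]; exists u, k; split => //.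
  have := submodZ sK u^-1 Ky.
  by rewrite /GRing.scale /= e mulrA mulVr // mul1r.
have ex : exists k, `[< K (pi ^+ k) >].
  by have [u [k [_ Kk]]] := Kv _ Kx x0; exists k; apply/asboolP.
case: (ex_minnP ex) => k /asboolP Kk kmin; exists k.
apply/seteqP; split => [y Ky|_ [y ->]]; last first.
  exact: (submodZ sK y Kk).
have [->|y0] := eqVneq y 0; first by exists 0; rewrite mul0r.
have [u [l [-> /asboolP/kmin kl]]] := Kv _ Ky y0.
by exists (u * pi ^+ (l - k)); rewrite -mulrA -exprD subnK.
Qed.

Lemma ideal_gen_inj k l : ideal_gen (pi ^+ k) = ideal_gen (pi ^+ l) -> k = l.
Proof.
move=> e; have := index_pi_exp k; rewrite e => h.
have := has_index_uniq h (index_pi_exp l).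
have q1 : (1 < q)%N := q_gt1.
by move=> /eqP; rewrite eqn_exp2l // => /eqP.
Qed.

Lemma pi_exp_neq0 k : pi ^+ k != 0. Proof. exact: expf_neq0 pi_neq0. Qed.

(** Otherwise the multiples [pi ^+ k *: w] would lie in pairwise distinct cosets,
    since [pi ^+ k - pi ^+ l] is nonzero for [k != l]. *)
Lemma lattice_line (W : lmodType o) (J : set W) (w : W) : lattice J ->
  exists2 x : o, x != 0 & J (x *: w).
Proof.
move=> lJ; apply: contrapT => nex; apply: infinite_nat.
pose f k := coset_of_elt J (pi ^+ k *: w).
have finj : {in [set: nat] &, injective f}.
  have lt k l : (k < l)%N -> f k <> f l.
    move=> kl /(coset_elt_eq (submod_subgrp lJ.1)); rewrite -scalerBl => Jw.
    apply: nex; exists (pi ^+ k - pi ^+ l) => //.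
    rewrite -(subnKC (ltnW kl)) exprD -[X in X - _]mulr1 -mulrBr mulf_neq0 ?pi_exp_neq0//.
    apply: contraNneq (oner_neq0 F) => e; rewrite -(rmorph0 res) -e rmorphB.
    rewrite rmorph1 rmorphXn /= res_pi expr0n subn_eq0 leqNgt kl /= subr0 //.
  by move=> k l _ _ e; case: (ltngtP k l) => // /lt; rewrite e.
have fin : finite_set (range f).
  by apply: sub_finite_set lJ.2 => _ [k _ <-]; exists (pi ^+ k *: w).
have /finite_setP[k h] := fin; apply/finite_setP; exists k.
by rewrite -(card_eql (inj_card_eq finj)).
Qed.
End DVR.

(** * Lattices in a module with a free direct summand of rank one *)

Section Fibration.
Variables (F : finFieldType) (o : idomainType) (D : split_dvr F o).
Local Notation pi := (pi D).
Local Notation q := #|F|.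

(** Here [W = o u + i(V)]. A lattice [J] of [W] is determined by its projection
    to the line, which is generated by some [pi ^+ k], by its preimage [I] in [V],
    and by the coset of [I] formed by the [c] such that [pi ^+ k *: u + i c] lies in
    [J]; every such triple arises. *)
Variables (V W : lmodType o).
Variables (p : {linear W -> o^o}) (r : {linear W -> V}) (u : W) (i : {linear V -> W}).
Hypothesis splitW : forall w, w = (p w : o) *: u + i (r w).
Hypothesis pu : p u = 1.
Hypothesis ru : r u = 0.
Hypothesis p_i : forall v, p (i v) = 0.
Hypothesis r_i : forall v, r (i v) = v.

Definition glue (k : nat) (I C : set V) : set W :=
  [set w | exists2 x : o, p w = x * pi ^+ k & exists2 c, C c & I (r w - x *: c)].

Lemma glueP k I c w : submod I ->
  glue k I (coset_of_elt I c) w <->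
  exists2 x : o, p w = x * pi ^+ k & I (r w - x *: c).
Proof.
move=> sI; split => [[x px [c' /(coset_eltP _ _) Ic' Iw]]|[x px Iw]].
  exists x => //; have := submodD sI Iw (submodZ sI x Ic'); congr I.
  by rewrite scalerBr addrA subrK.
exists x => //; exists c => //; apply/coset_eltP; rewrite subrr.
exact: submod0.
Qed.

Section Glue.
Variables (k : nat) (I C : set V).
Hypotheses (lI : lattice I) (CI : cosets I C).
Let sI := lI.1.

Let CE : exists c, C = coset_of_elt I c.
Proof. by case: CI => c _ <-; exists c. Qed.

Lemma submod_glue : submod (glue k I C).
Proof.
have [c ->] := CE; split=> [|a w w']; rewrite ?(glueP _ _ _ sI).
  by exists 0; rewrite ?linear0 ?mul0r // scale0r subr0; apply: submod0.
move=> [x e Ix] [x' e' Ix']; exists (a * x + x').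
  by rewrite linearP /= e e' /GRing.scale /= mulrDl mulrA.
have := submodD sI (submodZ sI a Ix) Ix'; congr I.
by rewrite linearP /= scalerBr scalerA scalerDl opprD addrACA.
Qed.

Lemma glue_preim : i @^-1` glue k I C = I.
Proof.
have [c ->] := CE; apply/seteqP; split => v /=; rewrite (glueP _ _ _ sI) p_i r_i.
  move=> [x /esym/eqP]; rewrite mulf_eq0 (negbTE (pi_exp_neq0 D k)) orbF => /eqP ->.
  by rewrite scale0r subr0.
by move=> Iv; exists 0; rewrite ?mul0r // scale0r subr0.
Qed.

Lemma glue_coset c : C c -> glue k I C (pi ^+ k *: u + i c).
Proof.
move=> Cc; exists 1; first by rewrite linearP /= pu p_i addr0 mul1r /GRing.scale /= mulr1.
exists c => //; rewrite linearP /= ru scaler0 add0r r_i scale1r subrr.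
exact: submod0.
Qed.

Lemma glue_cosetE : C = [set c | glue k I C (pi ^+ k *: u + i c)].
Proof.
apply/seteqP; split => c; first exact: glue_coset.
have [c0 ->] := CE => /=; rewrite (glueP _ _ _ sI) => -[x].
rewrite !linearP /= pu ru p_i r_i scaler0 add0r addr0 {1}/GRing.scale /= mulr1.
rewrite -{1}(mul1r (pi ^+ k)) => /(mulIf (pi_exp_neq0 D k)) <-.
by rewrite scale1r => /(coset_eltP _ _).
Qed.

Lemma glue_image : [set p w | w in glue k I C] = ideal_gen (pi ^+ k).
Proof.
have [c ->] := CE; apply/seteqP; split => [_ [w /(glueP _ _ _ sI)[x e _] <-]|_ [x ->]].
  by exists x.
have rE : r (pi ^+ k *: u + i c) = c by rewrite linearP /= ru r_i scaler0 add0r.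
have pE : p (pi ^+ k *: u + i c) = pi ^+ k.
  by rewrite linearP /= pu p_i addr0 /GRing.scale /= mulr1.
exists (x *: (pi ^+ k *: u + i c)); last by rewrite linearZ /= pE.
rewrite (glueP _ _ _ sI); exists x; first by rewrite linearZ /= pE.
rewrite linearZ /= rE subrr; exact: submod0.
Qed.

Lemma glue_index : has_index (glue k I C) (q ^ k * coset_index I).
Proof.
apply: (index_split (th := i)); first exact: submod_subgrp submod_glue.
  by rewrite glue_preim; exact: lattice_index.
have sW : submod (p @^-1` ideal_gen (pi ^+ k)).
  by apply: submod_preim; exact: submod_ideal_gen.
rewrite (_ : sum_im _ _ = p @^-1` ideal_gen (pi ^+ k)).
  have sI' := submod_subgrp (submod_ideal_gen (pi ^+ k)).
  have [T TT] := transversal_ex sI'; have [Tex Tun] := TT.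
  have inj : {in T &, injective (fun x : o^o => (x : o) *: u)}.
    move=> x y _ _ /(congr1 p); rewrite !linearZ /= pu.
    by rewrite /GRing.scale /= !mulr1.
  have /(transversal_index sI' TT) hT := index_pi_exp D k.
  apply/(transversal_index (T := [set (x : o) *: u | x in T]) (submod_subgrp sW)).
    split => [w|_ _ [x Tx <-] [y Ty <-] /=].
      have [t Tt h] := Tex (p w); exists ((t : o) *: u); first by exists t.
      by rewrite /= linearB linearZ /= pu [_ *: 1]/GRing.scale /= mulr1.
    move=> h; congr (_ *: _); apply: Tun => //; move: h; congr ideal_gen.
    by rewrite linearB; congr (_ - _); rewrite linearZ /= pu /GRing.scale /= mulr1.
  by rewrite (card_eql (inj_card_eq inj)).
apply/seteqP; split => [w [v h]|w h] /=.
  rewrite -glue_image; exists (w - i v) => //.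
  by rewrite linearB p_i subr0.
move: h; rewrite /= -glue_image => -[w' Jw' e].
exists (r w - r w'); suff -> : w - i (r w - r w') = w' by [].
rewrite [i _]linearB /= {1}(splitW w) [in RHS](splitW w') e opprB.
by rewrite [i (r w') - _]addrC addrA addrK.
Qed.

End Glue.

Lemma glue_surj (J : set W) : lattice J ->
  exists k, exists2 C, cosets (i @^-1` J) C & J = glue k (i @^-1` J) C.
Proof.
move=> lJ; have sJ := lJ.1; have sI := submod_preim i sJ.
have [x x0 Jx] := lattice_line D u lJ.
have sK : submod (p @` J) by exact: submod_im.
have [|k Kk] := ideal_genP (x := x) D sK _ x0.
  by exists (x *: u) => //; rewrite linearZ /= pu /GRing.scale /= mulr1.
have [w0 Jw0 pw0] : (p @` J) (pi ^+ k) by rewrite Kk; exists 1; rewrite mul1r.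
exists k, (coset_of_elt (i @^-1` J) (r w0)); first by exists (r w0).
have key w y : p w = y * pi ^+ k -> w = y *: w0 + i (r w - y *: r w0).
  move=> pw; rewrite [in LHS](splitW w) [in y *: w0](splitW w0) pw pw0.
  rewrite [i (_ - _)]linearB [i (y *: _)]linearZ /= scalerDr scalerA -addrA.
  by rewrite [i (r w) - _]addrC addNKr.
apply/seteqP; split => w.
  move=> Jw; rewrite (glueP _ _ _ sI).
  have [y pw] : ideal_gen (pi ^+ k) (p w) by rewrite -Kk; exists w.
  exists y => //; move: Jw; rewrite {1}(key w y pw) addrC => /submodDr; apply => //.
  exact: submodZ.
move=> /(glueP _ _ _ sI)[y pw] /= Jy.
by rewrite (key w y pw); apply: submodD => //; exact: submodZ.
Qed.

Lemma esum_fibration (R : realType) (a : set W -> \bar R) :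
    (forall J, (0 <= a J)%E) ->
  (\esum_(J in [set J | lattice J]) a J =
   \esum_(k in [set: nat]) \esum_(I in [set I | lattice I])
      \esum_(C in cosets I) a (glue k I C))%E.
Proof.
move=> a0; pose A : set (set V * set V) := [set I | lattice I] `*`` (fun I => cosets I).
rewrite (@eq_esum _ _ _ _ (fun k => \esum_(x in A) a (glue k x.1 x.2))%E); last first.
  by move=> k _; rewrite esum_esum.
rewrite esum_esum //.
apply: (@reindex_esum R _ _ _ _ (fun z : nat * (set V * set V) => glue z.1 z.2.1 z.2.2)); split.
- move=> [k [I C]] [_ [/= lI CI]]; apply: index_lattice; first exact: submod_glue.
  exact: glue_index.
- move=> [k [I C]] [k' [I' C']]; rewrite !inE => -[_ [/= lI CI]] [_ [/= lI' CI']] e.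
  have eI : I = I' by rewrite -(glue_preim k lI CI) -(glue_preim k' lI' CI') e.
  have ek : k = k'.
    by apply: (@ideal_gen_inj _ _ D); rewrite -(glue_image k lI CI) -(glue_image k' lI' CI') e.
  have eC : C = C' by rewrite (glue_cosetE k lI CI) (glue_cosetE k' lI' CI') e ek.
  by rewrite ek eI eC.
- move=> J /= lJ; have [k [C CI ->]] := glue_surj lJ.
  exists (k, (i @^-1` J, C)) => //; split => //; split => //=.
  exact: lattice_preim.
Qed.

End Fibration.

(** * Counting lattices with prescribed trace on a direct summand *)

Section EsumConst.
Variable R : realType.
Local Open Scope ereal_scope.

Lemma esum_cst (T : choiceType) (S : set T) (k : nat) (c : \bar R) :
  S #= `I_k -> 0 <= c -> \esum_(i in S) c = k%:R%:E * c.
Proof.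
move=> Sk c0; have fS : finite_set S by apply/finite_setP; exists k.
rewrite esum_fset // fsbig_finite //= -(card_fset_set Sk) big_const_seq count_predT.
elim: (size _) => [|j IH] /=; first by rewrite mul0e.
by rewrite IH -natr1 EFinD ge0_muleDl ?lee_fin ?mul1e // addeC.
Qed.

Lemma esum_geometric (x : R) : (0 <= x < 1)%R ->
  \esum_(k in [set: nat]) (x ^+ k)%:E = ((1 - x)^-1)%:E.
Proof.
move=> /andP[x0 x1]; rewrite -nneseries_esumT; last by move=> k; rewrite lee_fin exprn_ge0.
apply: cvg_lim => //.
have x1' : (`|x| < 1)%R by rewrite ger0_norm.
have := @cvg_geometric_series _ 1%R x x1'; rewrite div1r => h.
apply: cvg_EFin => //; first by apply: nearW => k; rewrite sumEFin.
rewrite [X in X @ _ --> _](_ : _ = series (geometric 1%R x)) //.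
apply/funext => k; rewrite /= sumEFin /= /series /=.
by apply: eq_bigr => l _; rewrite mul1r.
Qed.

Lemma esum_if (T : choiceType) (A : set T) (P : T -> Prop) (a : T -> \bar R) :
  \esum_(i in A) (if `[< P i >] then a i else 0) =
  \esum_(i in [set i | A i /\ P i]) a i.
Proof.
by rewrite [RHS](esum_mkcondr A P); apply: eq_esum => i _; congr (if _ then _ else _).
Qed.

End EsumConst.

Section SplitRow.
Variables (o : idomainType) (d : nat) (Z : lmodType o).

Definition row_head (w : 'rV[o]_(1 + d) * Z) : o^o := w.1 0 0.
Definition row_tail (w : 'rV[o]_(1 + d) * Z) : 'rV[o]_d * Z := (rsubmx w.1, w.2).
Definition row_cons0 (w : 'rV[o]_d * Z) : 'rV[o]_(1 + d) * Z :=
  (row_mx (0 : 'rV_1) w.1, w.2).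
Definition row_unit : 'rV[o]_(1 + d) * Z := (row_mx (1 : 'rV_1) 0, 0).

Fact row_head_linear : linear row_head.
Proof. by move=> a u v; rewrite /row_head !mxE. Qed.
HB.instance Definition _ :=
  GRing.isLinear.Build o _ _ *:%R row_head row_head_linear.

Fact row_tail_linear : linear row_tail.
Proof. by move=> a u v; congr (_, _); rewrite /= linearP. Qed.
HB.instance Definition _ :=
  GRing.isLinear.Build o _ _ *:%R row_tail row_tail_linear.

Fact row_cons0_linear : linear row_cons0.
Proof.
by move=> a u v; congr (_, _); rewrite /= scale_row_mx add_row_mx scaler0 addr0.
Qed.
HB.instance Definition _ :=
  GRing.isLinear.Build o _ _ *:%R row_cons0 row_cons0_linear.

Lemma row_split w : w = (row_head w : o) *: row_unit + row_cons0 (row_tail w).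
Proof.
case: w => w z; congr (_, _); rewrite /= ?scaler0 ?add0r //.
rewrite scale_row_mx add_row_mx scaler0 add0r addr0 -[LHS]hsubmxK; congr row_mx.
apply/rowP => j; rewrite !mxE !ord1 eqxx mulr1 /row_head /=.
by congr (w _ _); apply/val_inj.
Qed.

Lemma row_head_unit : row_head row_unit = 1.
Proof. by rewrite /row_head /= mxE; case: splitP => j //= _; rewrite ord1 mxE. Qed.

Lemma row_tail_unit : row_tail row_unit = 0.
Proof. by rewrite /row_tail /= row_mxKr. Qed.

Lemma row_head_cons0 w : row_head (row_cons0 w) = 0.
Proof. by rewrite /row_head /= mxE; case: splitP => j //= _; rewrite mxE. Qed.

Lemma row_tail_cons0 w : row_tail (row_cons0 w) = w.
Proof. by case: w => w z; rewrite /row_tail /= row_mxKr. Qed.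

End SplitRow.

Section TraceSum.
Variables (F : finFieldType) (o : idomainType) (D : split_dvr F o) (R : realType).
Local Notation q := #|F|.

(** [Z] is the direct summand whose intersection with a lattice, the trace, is to
    be prescribed. *)
Definition bottom (o : idomainType) (d : nat) (Z : lmodType o) (z : Z) :
  'rV[o]_d * Z := (0, z).

Fact bottom_linear (d : nat) (Z : lmodType o) : linear (@bottom o d Z).
Proof. by move=> a u v; congr (_, _); rewrite /= scaler0 addr0. Qed.
HB.instance Definition _ (d : nat) (Z : lmodType o) :=
  GRing.isLinear.Build o _ _ *:%R (@bottom o d Z) (@bottom_linear d Z).

Definition trace (d : nat) (Z : lmodType o) (J : set ('rV[o]_d * Z)) : set Z :=
  @bottom o d Z @^-1` J.

Definition weight (s : R) (V : zmodType) (I : set V) : \bar R :=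
  (((coset_index I)%:R : R) `^ (- s))%:E.

Lemma weight_ge0 s (V : zmodType) (I : set V) : (0 <= weight s I)%E.
Proof. by rewrite lee_fin powR_ge0. Qed.

Lemma esum_row (d : nat) (Z : lmodType o) (a : set ('rV[o]_(1 + d) * Z) -> \bar R) :
    (forall J, (0 <= a J)%E) ->
  (\esum_(J in [set J | lattice J]) a J =
   \esum_(k in [set: nat]) \esum_(I in [set I : set ('rV[o]_d * Z) | lattice I])
      \esum_(C in cosets I)
        a (glue D (@row_head o d Z) (@row_tail o d Z) k I C))%E.
Proof.
exact: (esum_fibration D (@row_split o d Z) (row_head_unit d Z) (row_tail_unit d Z)
  (@row_head_cons0 o d Z) (@row_tail_cons0 o d Z)).
Qed.

Lemma row_glue_trace d (Z : lmodType o) k (I C : set ('rV[o]_d * Z)) :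
  lattice I -> cosets I C ->
  trace (glue D (@row_head o d Z) (@row_tail o d Z) k I C : set ('rV[o]_(1 + d) * Z)) = trace I.
Proof.
move=> lI CI.
have h := glue_preim D (@row_head_cons0 o d Z) (@row_tail_cons0 o d Z) k lI CI.
rewrite /trace -[in RHS]h; apply/seteqP; split => z /=.
all: by rewrite /bottom /row_cons0 /= row_mx0.
Qed.

Lemma row_glue_index d (Z : lmodType o) k (I C : set ('rV[o]_d * Z)) :
  lattice I -> cosets I C ->
  coset_index (glue D (@row_head o d Z) (@row_tail o d Z) k I C)
    = (q ^ k * coset_index I)%N.
Proof.
move=> lI CI; exact: (has_index_coset (glue_index D (@row_split o d Z) (row_head_unit d Z) (row_tail_unit d Z)
  (@row_head_cons0 o d Z) (@row_tail_cons0 o d Z) k lI CI)).2.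
Qed.

Lemma trace0K (Z : lmodType o) (J : set ('rV[o]_0 * Z)) : snd @^-1` trace J = J.
Proof. by apply/seteqP; split => -[w z]; rewrite /trace /bottom /= (thinmx0 w). Qed.

Lemma index_snd0 (Z : lmodType o) (I : set Z) : lattice I ->
  has_index (snd @^-1` I : set ('rV[o]_0 * Z)) (coset_index I).
Proof.
move=> lI; rewrite -[coset_index I]mul1n; apply: (index_split (th := @bottom o 0 Z)).
- have sI := submod_subgrp lI.1.
  by split=> [|u v /=]; [case: sI|exact: subgrpB].
- exact: lattice_index lI.
rewrite (_ : sum_im _ _ = setT); first exact: has_index_setT.
apply/seteqP; split => // -[w z] _; exists z => /=; rewrite subrr; exact: (submod0 lI.1).
Qed.

Lemma powR_lt1 (x s : R) : 1 < x -> 0 < s -> x `^ (- s) < 1.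
Proof.
move=> x1 s0; have x0 : 0 < x by apply: lt_trans x1.
by rewrite /powR gt_eqF // expR_lt1 mulNr oppr_lt0 mulr_gt0 // ln_gt0.
Qed.

(** Splitting off one coordinate of [o^d] multiplies the index by [q ^ k] and leaves
    [|W : I|] choices for the coset. The sum over [k] is geometric, and the factor
    [|W : I|] replaces [s] by [s - 1]; this is the induction on [d]. *)
Lemma trace_sum (d : nat) (Z : lmodType o) (Lam : set Z) (s : R) :
    lattice Lam -> d%:R < s + 1 ->
  (\esum_(J in [set J : set ('rV[o]_d * Z) | lattice J])
     (if `[< trace J = Lam >] then weight s J else 0) =
   ((\prod_(j < d) (1 - q%:R `^ (j%:R - s))^-1) *
     (coset_index Lam)%:R `^ (d%:R - s))%:E)%E.
Proof.
move=> lL; elim: d s => [|d IHd] s ds.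
  rewrite big_ord0 mul1r sub0r.
  rewrite (@esum_can _ _ _ [set I : set Z | lattice I] _ (fun I => snd @^-1` I)
             (@trace 0 Z)) /=.
  - rewrite (@eq_esum _ _ _ _ (fun I => if `[< I = Lam >] then weight s I else 0))%E.
      have e : [set I : set Z | lattice I /\ I = Lam] = [set Lam].
        by apply/seteqP; split => [I [_ ->]//|I ->].
      by rewrite esum_if e esum_set1 ?weight_ge0.
    move=> I /= lI; rewrite /weight (has_index_coset (index_snd0 lI)).2.
    by congr (if _ then _ else _).
  - by move=> I lI; apply: index_lattice (index_snd0 lI); apply: (submod_preim snd lI.1).
  - by move=> J lJ; exact: lattice_preim.
  - by [].
  - by move=> J _; exact: trace0K.
rewrite esum_row; last by move=> J; case: ifP => // _; exact: weight_ge0.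
have q1 : 1 < q%:R :> R by rewrite ltr1n; exact: q_gt1.
have s0 : 0 < s.
  by move: ds; rewrite -natr1 ltrD2r; apply: le_lt_trans; rewrite ler0n.
pose x : R := q%:R `^ (- s).
have x01 : 0 <= x < 1 by rewrite powR_ge0 powR_lt1.
pose S := (\esum_(J in [set J : set ('rV[o]_d * Z) | lattice J])
     (if `[< trace J = Lam >] then weight (s - 1) J else 0))%E.
rewrite (@eq_esum _ _ _ _ (fun k => (x ^+ k)%:E * S))%E => [|k _].
  rewrite /S IHd; last by move: ds; rewrite -natr1 subrK ltrD2r.
  set c := (X in X%:E); have c0 : 0 <= c.
    rewrite /c mulr_ge0 ?powR_ge0 // prodr_ge0 // => j _.
    have jd : j.+1%:R <= d%:R :> R by rewrite ler_nat.
    have h : 0 < s - 1 - j%:R.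
      by move: ds jd; rewrite -!natr1 => *; lra.
    by rewrite invr_ge0 subr_ge0 -opprB; apply/ltW; exact: (powR_lt1 q1 h).
  under eq_esum do rewrite muleC.
  rewrite esumZl // => [|k]; last by rewrite lee_fin exprn_ge0 //; case/andP: x01.
  rewrite esum_geometric // -EFinM; congr EFin.
  rewrite /c big_ord_recl sub0r -/x.
  have -> : d%:R - (s - 1) = d.+1%:R - s by rewrite opprB addrA natr1 addrC.
  rewrite (eq_bigr (fun j : 'I_d => (1 - q%:R `^ ((bump 0 j)%:R - s))^-1)); last first.
    by move=> j _; rewrite /bump /= add1n opprB addrA natr1.
  by rewrite mulrAC [X in X * _]mulrC.
rewrite -esumZl; last 2 first.
  by rewrite exprn_ge0 //; case/andP: x01.
  by move=> J; case: ifP => // _; exact: weight_ge0.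
apply: eq_esum => I /= lI; rewrite (@eq_esum _ _ _ _ (fun=> (x ^+ k)%:E * (if `[< trace I = Lam >] then weight s I else 0)))%E => [|C CI].
  rewrite (esum_cst (lattice_index lI)); last first.
    rewrite mule_ge0 // ?lee_fin ?exprn_ge0 //; first by case/andP: x01.
    by case: ifP => // _; exact: weight_ge0.
  rewrite muleCA; congr (_ * _)%E; case: ifP => _; rewrite ?mule0 // /weight -EFinM.
  congr EFin; have N0 : (coset_index I)%:R != 0 :> R.
    by rewrite pnatr_eq0 -lt0n lattice_index_gt0.
  by rewrite -{1}[(coset_index I)%:R]powRr1 ?ler0n // -powRD ?N0 ?implybT // opprB.
rewrite row_glue_trace //.
case: ifP => _; rewrite ?mule0 //.
rewrite /weight row_glue_index // -EFinM; congr EFin.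
rewrite natrM powRM ?ler0n //; congr (_ * _).
by rewrite natrX -powR_mulrn ?ler0n // powRAC powR_mulrn ?powR_ge0.
Qed.

End TraceSum.

(** * Bases of lattices *)

Section Bases.
Variables (F : finFieldType) (o : idomainType) (D : split_dvr F o).
Local Notation res := (res D).
Local Notation pi := (pi D).

(** Induction on [d] through [glue_surj]: [pi ^+ k *: u + c] together with the image
    of the map obtained for the lower lattice generates the lattice. Fixing [Z]
    pointwise makes the isomorphism compatible with traces on [Z]. *)
Lemma free_lattice (d : nat) (Z : lmodType o) (J : set ('rV[o]_d * Z)) :
    lattice J -> (forall z, J (0, z)) ->
  exists Th : {linear ('rV[o]_d * Z)%type -> ('rV[o]_d * Z)%type},
    [/\ injective Th, range Th = J & forall z, Th (0, z) = (0, z)].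
Proof.
elim: d J => [|d IHd] J lJ JZ.
  exists idfun; split => //; apply/seteqP; split => [_ [[w z] _ <-]|w Jw].
    by rewrite (thinmx0 w); apply: JZ.
  by exists w.
have [k [C CI JE]] := glue_surj D (@row_split o d Z) (row_head_unit d Z) lJ.
set I := (X in cosets X) in CI JE; have lI : lattice I by exact: lattice_preim.
have [|Th [Thinj ThI Th0]] := IHd I lI.
  by move=> z; rewrite /I /= /row_cons0 /= row_mx0.
have [c _ CE] := CI.
have [w0 w0E] : exists w0 : 'rV[o]_(1 + d) * Z,
  w0 = pi ^+ k *: row_unit d Z + row_cons0 c by eexists.
pose f (w : 'rV[o]_(1 + d) * Z) := (row_head w : o) *: w0 + row_cons0 (Th (row_tail w)).
have flin : linear f.
  move=> a u v; rewrite /f [row_head _]linearP [row_tail _]linearP [Th _]linearP.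
  rewrite [row_cons0 _]linearP /= -[a *: row_head u]/(a * row_head u).
  by rewrite scalerDl scalerDr scalerA addrACA.
pose fL : {linear ('rV[o]_(1 + d) * Z)%type -> ('rV[o]_(1 + d) * Z)%type} :=
  HB.pack f (GRing.isLinear.Build o _ _ *:%R f flin).
have hw0 : row_head w0 = pi ^+ k.
  by rewrite w0E linearP /= row_head_unit row_head_cons0 addr0 /GRing.scale /= mulr1.
have tw0 : row_tail w0 = c.
  by rewrite w0E linearP /= row_tail_unit row_tail_cons0 scaler0 add0r.
have hf w : row_head (f w) = row_head w * pi ^+ k.
  by rewrite /f linearP /= hw0 row_head_cons0 addr0.
have tf w : row_tail (f w) = (row_head w : o) *: c + Th (row_tail w).
  by rewrite /f linearP /= tw0 row_tail_cons0.
exists fL; split.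
- move=> w w' /= e.
  have hh : row_head w = row_head w'.
    by apply: (mulIf (pi_exp_neq0 D k)); rewrite -!hf e.
  have := congr1 (@row_tail o d Z) e; rewrite !tf hh => /addrI /Thinj tt.
  by rewrite (row_split w) (row_split w') hh tt.
- rewrite JE -CE; apply/seteqP; split => [_ [w _ <-]|w] /=; rewrite (glueP D (row_head (Z:=Z)) (row_tail (Z:=Z)) k c _ lI.1).
    exists (row_head w); first exact: hf.
    suff: I (row_tail (f w) - (row_head w : o) *: c) by [].
    by rewrite tf addrAC subrr add0r -ThI; exists (row_tail w).
  move=> [x hx hI]; have : I (row_tail w - x *: c) by [].
  rewrite -ThI => -[v _ vE].
  pose w' := x *: row_unit d Z + row_cons0 v.
  have hw' : row_head w' = x.
    by rewrite /w' linearP /= row_head_unit row_head_cons0 addr0 /GRing.scale /= mulr1.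
  have tw' : row_tail w' = v.
    by rewrite /w' linearP /= row_tail_unit row_tail_cons0 scaler0 add0r.
  exists w' => //; change (f w' = w); rewrite (row_split w) hx (row_split (f w')).
  by rewrite hf tf hw' tw' vE [x *: c + _]addrC subrK.
- move=> z /=; rewrite /f.
  have -> : row_head ((0, z) : 'rV[o]_(1 + d) * Z) = 0 by rewrite /row_head mxE.
  rewrite scale0r add0r /row_tail /= (_ : rsubmx 0 = 0) ?Th0; last by apply/matrixP=> i j; rewrite !mxE.
  by rewrite /row_cons0 /= row_mx0.
Qed.

Lemma free_row_lattice (d : nat) (J : set 'rV[o]_d) : lattice J ->
  exists Th : {linear 'rV[o]_d -> 'rV[o]_d}, injective Th /\ range Th = J.
Proof.
move=> lJ; pose Z : lmodType o := 'rV[o]_0.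
have lJ' : lattice (fst @^-1` J : set ('rV[o]_d * Z)) by exact: lattice_preim.
have [|Th [Thinj ThJ _]] := free_lattice lJ'; first by move=> z /=; exact: submod0 lJ.1.
pose f w := (Th (w, 0)).1.
have flin : linear f.
  move=> a u v; rewrite /f -[in RHS]/(_.1) .
  have -> : (a *: u + v, 0) = a *: (u, 0) + (v, 0) :> 'rV[o]_d * Z by congr (_, _); rewrite /= ?scaler0 ?addr0.
  by rewrite linearP.
pose fL : {linear 'rV[o]_d -> 'rV[o]_d} := HB.pack f (GRing.isLinear.Build o _ _ *:%R f flin).
have z0 (z : Z) : z = 0 by exact: thinmx0.
exists fL; split => [w w' /= e|].
  have : Th (w, 0) = Th (w', 0).
    by apply/eqP; rewrite -pair_eqE /pair_eq /= -/(f w) e eqxx /= (z0 (Th _).2) (z0 (Th (w', 0)).2).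
  by move=> /Thinj[].
apply/seteqP; split => [_ [w _ <-]|w Jw] /=.
  have : range Th (Th (w, 0)) by exists (w, 0).
  by rewrite ThJ.
have : (fst @^-1` J : set ('rV[o]_d * Z)) (w, 0) by [].
rewrite -ThJ => -[[v z] _ e]; exists v => //=.
by rewrite /f -(z0 z) e.
Qed.

Lemma esum_im (R : realType) (V W : lmodType o) (th : {linear V -> W})
    (a : set W -> \bar R) : injective th -> lattice (range th) ->
  (\esum_(J in [set J : set W | lattice J /\ J `<=` range th]) a J =
   \esum_(J in [set J : set V | lattice J]) a (th @` J))%E.
Proof.
move=> thI lth; apply: (esum_can (e' := fun J => th @^-1` J)).
- move=> J lJ; split; last by move=> _ [v _ <-]; exists v.
  apply: index_lattice (index_im thI lJ.1 (lattice_index lJ) (lattice_index lth)).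
  exact: submod_im lJ.1.
- by move=> J [lJ _]; exact: lattice_preim.
- move=> J _; apply/seteqP; split => [v [v' Jv' /thI <-] //|v Jv].
  by exists v.
- move=> J [_ sJ]; apply/seteqP; split => [_ [v Jv <-] //|w Jw].
  by have [v _ vw] := sJ w Jw; exists v; rewrite /= ?vw.
Qed.

Lemma coset_index_im (V W : lmodType o) (th : {linear V -> W}) (J : set V) :
    injective th -> lattice (range th) -> lattice J ->
  coset_index (th @` J) = (coset_index (range th) * coset_index J)%N.
Proof.
move=> thI lth lJ; apply: (has_index_coset (index_im thI lJ.1 _ _)).2; exact: lattice_index.
Qed.

Lemma unit_res (x : o) : (x \is a GRing.unit) = (res x != 0).
Proof.
apply/idP/idP => [ux|]; first by rewrite -unitfE rmorph_unit.
have [->|x0] := eqVneq x 0; first by rewrite rmorph0 eqxx.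
have [u [[|k] [uu ->]]] := valP D x0; first by rewrite mulr1.
by rewrite rmorphM rmorphXn /= res_pi expr0n mulr0 eqxx.
Qed.

Lemma res_row0 n (z : 'rV[o]_n) : (forall j, res (z 0 j) = 0) -> exists v, z = pi *: v.
Proof.
move=> h; have ch j : exists y, z 0 j = pi * y by exact: res_ker.
pose y j := projT1 (cid (ch j)).
exists (\row_j y j); apply/rowP => j; rewrite !mxE /y.
by case: cid.
Qed.

End Bases.

(** * Reduced echelon form modulo the uniformizer *)
Section Echelon.
Variables (F : finFieldType) (o : idomainType) (D : split_dvr F o).
Local Notation io := (io D).
Local Notation res := (res D).
Local Notation pi := (pi D).
Local Notation q := #|F|.

(** Reduced echelon form of the image of a submodule modulo [pi]: [J] is the
    set of columns without pivot. *)
Definition echelon n (Lam : set 'rV[o]_n) (J : {set 'I_n}) (A : 'M[o]_n) : Prop :=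
  (forall k, k \notin J -> Lam (delta_mx 0 k + \sum_(j in J) A k j *: delta_mx 0 j)) /\
  (forall z, Lam z -> forall j, j \in J ->
     res (z 0 j) = \sum_(k | k \notin J) res (z 0 k) * res (A k j)).

(** A family in [Lam] with linearly independent residues and of maximal size spans
    the image of [Lam] modulo [pi]. A maximal minor of it that is invertible modulo
    [pi] is invertible over [o], so the family can be normalised to the identity
    on the columns [f] of this minor; these are the pivots. *)
Lemma echelon_ex n (Lam : set 'rV[o]_n) : submod Lam ->
  exists J A, echelon Lam J A.
Proof.
move=> sL.
pose P r := `[< exists2 M : 'M[o]_(r, n), (forall i, Lam (row i M)) & row_free (map_mx res M) >].
have P0 : exists r, P r.
  exists 0%N; apply/asboolP; exists 0; first by case.
  by rewrite /row_free (flatmx0 (map_mx _ _)) mxrank0.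
have Pn r : P r -> (r <= n)%N.
  by move=> /asboolP[M _ /eqP <-]; exact: rank_leq_col.
case: (ex_maxnP P0 Pn) => r /asboolP[M ML Mfree] rmax.
have spanM z : Lam z -> (map_mx res z <= map_mx res M)%MS.
  move=> Lz; apply/negPn/negP => nz.
  (* otherwise [z] could be added to the family *)
  have : P (1 + r)%N.
    apply/asboolP; exists (col_mx z M).
      move=> i; rewrite -(splitK i); case: (fintype.split i) => s /=.
        rewrite rowKu (_ : row s z = z) //.
        by apply/rowP => j; rewrite mxE ord1.
      by rewrite rowKd.
    apply: inj_row_free => v; rewrite -(hsubmxK v) map_col_mx mul_row_col.
    set a := lsubmx v; set b := rsubmx v.
    have aE : a = (a 0 0)%:M := mx11_scalar a.
    rewrite {1}aE mul_scalar_mx; have [a0|a0] := eqVneq (a 0 0) 0.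
      rewrite a0 scale0r add0r => /eqP; rewrite mulmx_free_eq0 // => /eqP ->.
      by rewrite aE a0 raddf0 row_mx0.
    move=> e; case/negP: nz; apply/submxP; exists (- (a 0 0)^-1 *: b).
    rewrite -scalemxAl; move/eqP: e; rewrite addrC addr_eq0 => /eqP ->.
    by rewrite scaleNr scalerN opprK scalerA mulVf // scale1r.
  by move=> /rmax; rewrite ltnn.
have fullM : row_full (map_mx res M)^T by rewrite /row_full mxrank_tr.
pose f := fullrankfun fullM.
have finj : injective f by exact: fullrankfun_inj.
pose MS := colsub f M.
have uMS : MS \in unitmx.
  rewrite unitmxE (unit_res D) -det_map_mx -unitfE -unitmxE -unitmx_tr.
  have := fullrowsub_unit fullM; congr (_ \in unitmx).
  by apply/matrixP => s t; rewrite !mxE.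
pose B := invmx MS *m M.
have BL i : Lam (row i B).
  rewrite /B row_mul mulmx_sum_row; apply: submod_sum => // s _.
  by apply: submodZ => //; exact: ML.
have Bf s t : B s (f t) = (s == t)%:R.
  have := congr1 (fun X : 'M[o]_r => X s t) (mulVmx uMS); rewrite [RHS]mxE => <-.
  by rewrite !mxE; apply: eq_bigr => k _; rewrite [MS _ _]mxE.
have BE : map_mx res MS *m map_mx res B = map_mx res M.
  by rewrite -map_mxM /B mulmxA mulmxV // mul1mx.
clearbody B.
pose J := ~: (f @: [set: 'I_r]%SET).
have fJ s : f s \notin J by rewrite finset.in_setC negbK; apply: imset_f; rewrite finset.in_setT.
have [A AE] : exists A : 'M[o]_n, forall k j, A k j = \sum_(s | f s == k) B s j.
  by exists (\matrix_(k, j) \sum_(s | f s == k) B s j) => k j; rewrite mxE.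
have Af s j : A (f s) j = B s j.
  by rewrite AE (bigD1 s) //= big1 ?addr0 // => s' /andP[/eqP/finj ->]; rewrite eqxx.
exists J, A; split.
  move=> k; rewrite finset.in_setC negbK => /imsetP[s _ ->].
  rewrite (_ : _ + _ = row s B) //; apply/rowP => j.
  rewrite mxE summxE [RHS]mxE; have [jJ|jJ] := boolP (j \in J).
    rewrite (bigD1 j) //= big1 => [|j' /andP[_ /negPf nj']]; last first.
      by rewrite !mxE [j == j']eq_sym nj' andbF mulr0.
    rewrite !mxE Af !eqxx mulr1 addr0 /=; case: eqP => [e|_]; last by rewrite add0r.
    by have := fJ s; rewrite -e jJ.
  move: (jJ); rewrite finset.in_setC negbK => /imsetP[t _ jE].
  rewrite jE Bf mxE eqxx (inj_eq finj) [t == s]eq_sym big1 ?addr0 // => j' j'J.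
  have nf : (f t == j') = false.
    by apply/negbTE/negP => /eqP e; move: j'J; rewrite -e (negbTE (fJ t)).
  by rewrite !mxE nf andbF mulr0.
move=> z Lz j jJ.
have [y yE] : exists y, map_mx res z = y *m map_mx res B.
  have /submxP[y yE] := spanM z Lz; exists (y *m map_mx res MS).
  by rewrite -mulmxA BE.
have zE k : res (z 0 k) = \sum_s y 0 s * res (B s k).
  have := congr1 (fun X : 'rV[F]_n => X 0 k) yE; rewrite !mxE => ->.
  by apply: eq_bigr => s _; rewrite !mxE.
have yz t : res (z 0 (f t)) = y 0 t.
  rewrite zE (bigD1 t) //= big1 => [|s /negPf st]; last by rewrite Bf st rmorph0 mulr0.
  by rewrite Bf eqxx rmorph1 mulr1 addr0.
rewrite zE (eq_bigl (mem (f @: [set: 'I_r]%SET))) => [|k]; last by rewrite finset.in_setC negbK.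
rewrite big_imset /= => [|s t _ _ /finj //].
by apply: eq_big => [s|s _]; [rewrite finset.in_setT | rewrite yz Af].
Qed.

(** [L + pi V]; working with this preimage avoids the quotient by [pi]. *)
Definition modpi (V : lmodType o) (L : set V) : set V :=
  sum_im ( *:%R pi : {linear V -> V}) L.

Section EchelonTheory.
Variables (n : nat) (Lam : set 'rV[o]_n) (J : {set 'I_n}) (A : 'M[o]_n).
Hypotheses (sL : submod Lam) (ech : echelon Lam J A).

Definition ech_row (k : 'I_n) : 'rV[o]_n :=
  delta_mx 0 k + \sum_(j in J) A k j *: delta_mx 0 j.

Lemma ech_rowP k : k \notin J -> Lam (ech_row k). Proof. by case: ech => h _; exact: h. Qed.

Lemma ech_rowE k l : k \notin J -> l \notin J -> ech_row k 0 l = (l == k)%:R.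
Proof.
move=> kJ lJ; rewrite mxE summxE big1 ?addr0 => [|j jJ]; first by rewrite mxE.
have nf : (l == j) = false by apply/negbTE/negP => /eqP e; move: lJ; rewrite e jJ.
by rewrite !mxE nf andbF mulr0.
Qed.

(** The element of [Lam] that agrees with [z] on the pivot columns. *)
Definition ech_head (z : 'rV[o]_n) : 'rV[o]_n := \sum_(k | k \notin J) z 0 k *: ech_row k.

Lemma ech_headP z : Lam (ech_head z).
Proof. by apply: submod_sum => // k kJ; apply: submodZ => //; exact: ech_rowP. Qed.

Lemma ech_headE z l : l \notin J -> ech_head z 0 l = z 0 l.
Proof.
move=> lJ; rewrite /ech_head summxE (bigD1 l) //= big1 => [|k /andP[kJ /negPf kl]].
  by rewrite mxE ech_rowE // eqxx mulr1 addr0.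
by rewrite mxE ech_rowE // eq_sym kl mulr0.
Qed.

Lemma echelon_modpi z : modpi Lam z -> forall j, j \in J ->
  res (z 0 j) = \sum_(k | k \notin J) res (z 0 k) * res (A k j).
Proof.
have e (u v : 'rV[o]_n) l : res ((u - pi *: v) 0 l) = res (u 0 l).
  by rewrite !mxE rmorphB rmorphM res_pi mul0r subr0.
move=> [v Lv] j jJ; rewrite -(e z v) ech.2 //; apply: eq_bigr => k _.
by rewrite e.
Qed.

Lemma echelon_zero z : modpi Lam z -> (forall k, k \notin J -> res (z 0 k) = 0) ->
  exists v, z = pi *: v.
Proof.
move=> mz z0; apply: (res_row0 (D := D)) => j; have [jJ|/z0//] := boolP (j \in J).
by rewrite echelon_modpi // big1 // => k kJ; rewrite z0 // mul0r.
Qed.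

(** The coordinates in [J] of [z - ech_head z] may be prescribed freely modulo [pi]. *)
Lemma echelon_index : has_index (modpi Lam) (q ^ #|J|).
Proof.
pose T := {ffun {j | j \in J} -> F}.
pose f (t : T) : 'rV[o]_n := \row_j (if insub j is Some s then io (t s) else 0).
have -> : (q ^ #|J|)%N = #|T| by rewrite card_ffun card_sig; congr (_ ^ _)%N; apply: eq_card.
have f0 t k : k \notin J -> f t 0 k = 0.
  by move=> kJ; rewrite mxE; case: insubP => [s|//]; rewrite (negbTE kJ).
have fE t (s : {j | j \in J}) : f t 0 (val s) = io (t s) by rewrite mxE valK.
have sm : subgrp (modpi Lam) by apply/subgrp_sum_im/submod_subgrp.
apply: (@has_index_finType _ _ _ f sm) => [z|t t' h].
  pose t : T := [ffun s : {j | j \in J} => res ((z - ech_head z) 0 (val s))]; exists t.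
  have [v vE] : exists v, z - ech_head z - f t = pi *: v.
    apply: (res_row0 (D := D)) => j; rewrite [_ 0 j]mxE [X in _ + X]mxE rmorphB.
    have [jJ|jJ] := boolP (j \in J).
      pose sj : {j | j \in J} := exist _ j jJ.
      have -> : f t 0 j = io (t sj) by rewrite -fE.
      by rewrite resK ffunE subrr.
    by rewrite f0 // rmorph0 subr0 mxE [X in _ + X]mxE ech_headE // subrr rmorph0.
  exists v; rewrite (_ : _ - _ = ech_head z); first exact: ech_headP.
  by rewrite /= -vE [z - _ - f t]addrAC subKr.
have [|v vE] := echelon_zero h.
  by move=> k kJ; rewrite mxE [X in _ + X]mxE !f0 // subr0 rmorph0.
apply/ffunP => s; apply: (can_inj (resK D)).
have := congr1 (fun X : 'rV[o]_n => res (X 0 (val s))) vE.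
rewrite [in RHS]mxE rmorphM res_pi mul0r mxE [X in _ + X]mxE !fE rmorphB !resK.
by move/eqP; rewrite subr_eq0 => /eqP ->.
Qed.

End EchelonTheory.

End Echelon.

(** * Counting the lattices with a given colon lattice *)

Section Fibre.
Variables (F : finFieldType) (o : idomainType) (D : split_dvr F o).
Local Notation pi := (pi D).

Definition colon (V : lmodType o) (L : set V) : set V := [set v | L (pi *: v)].

Lemma lattice_colon (V : lmodType o) (L : set V) : lattice L -> lattice (colon L).
Proof. exact: (lattice_preim ( *:%R pi : {linear V -> V})). Qed.

Lemma sub_colon (V : lmodType o) (L : set V) : submod L -> L `<=` colon L.
Proof. by move=> sL v Lv; apply: submodZ. Qed.

Lemma index_colon (V : lmodType o) (L : set V) k : lattice L ->
  has_index (modpi D L) k -> coset_index L = (k * coset_index (colon L))%N.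
Proof.
move=> lL hk; apply: (has_index_uniq (lattice_index lL)).
apply: (index_split (th := ( *:%R pi : {linear V -> V}))) => //.
  exact: submod_subgrp lL.1.
exact: lattice_index (lattice_colon lL).
Qed.

(** In [Lam] the echelon rows form a basis of a complement of the part of [Lam] that
    is supported on [J], and this part lies in [pi o^n]. So the elements of [Lam]
    divisible by [pi] in [o^n] are recognised on the first component. *)
Lemma adapted_basis n (Lam : set 'rV[o]_n) (J : {set 'I_n}) (A : 'M[o]_n) :
    lattice Lam -> echelon D Lam J A ->
  exists th : {linear ('rV[o]_#|~: J| * 'rV[o]_#|J|)%type -> 'rV[o]_n},
    [/\ injective th, range th = Lam &
     forall y, (exists v, th y = pi *: v) <-> (exists v, y.1 = pi *: v)].
Proof.
move=> lL ech; have sL := lL.1.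
pose ep (y : 'rV[o]_#|J|) : 'rV[o]_n := \sum_(i < #|J|) y 0 i *: delta_mx 0 (enum_val i).
have ep_lin : linear ep.
  move=> a u v; rewrite /ep scaler_sumr -big_split /=; apply: eq_bigr => i _.
  by rewrite !mxE scalerDl scalerA.
have epJ y i : ep y 0 (enum_val i) = y 0 i.
  rewrite summxE (bigD1 i) //= big1 => [|i' /negPf ii]; last first.
    by rewrite !mxE (inj_eq enum_val_inj) eq_sym ii andbF mulr0.
  by rewrite !mxE !eqxx mulr1 addr0.
have epC y k : k \notin J -> ep y 0 k = 0.
  move=> kJ; rewrite summxE big1 // => i _; rewrite !mxE.
  have -> : (k == enum_val i) = false.
    by apply/negbTE/negP => /eqP e; move: kJ; rewrite e enum_valP.
  by rewrite andbF mulr0.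
pose be (y : 'rV[o]_#|~: J|) : 'rV[o]_n := \sum_(i < #|~: J|) y 0 i *: ech_row J A (enum_val i).
have be_lin : linear be.
  move=> a u v; rewrite /be scaler_sumr -big_split /=; apply: eq_bigr => i _.
  by rewrite !mxE scalerDl scalerA.
have nJ (i : 'I_#|~: J|) : enum_val i \notin J.
  by have := enum_valP i; rewrite finset.in_setC.
have beC y i : be y 0 (enum_val i) = y 0 i.
  rewrite summxE (bigD1 i) //= big1 => [|i' /negPf ii]; last first.
    by rewrite mxE ech_rowE // (inj_eq enum_val_inj) eq_sym ii mulr0.
  by rewrite mxE ech_rowE // eqxx mulr1 addr0.
have beL y : Lam (be y).
  by apply: submod_sum => // i _; apply: submodZ => //; exact: (ech_rowP ech).
pose epL : {linear 'rV[o]_#|J| -> 'rV[o]_n} := HB.pack ep (GRing.isLinear.Build o _ _ *:%R ep ep_lin).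
have lL2 : lattice (ep @^-1` Lam) by exact: (lattice_preim epL).
have [th2 [th2_inj th2_im]] := free_row_lattice D lL2.
pose th (y : 'rV[o]_#|~: J| * 'rV[o]_#|J|) : 'rV[o]_n := be y.1 + ep (th2 y.2).
have th_lin : linear th.
  by move=> a u v; rewrite /th /= be_lin linearP ep_lin scalerDr addrACA.
have thC y i : th y 0 (enum_val i : 'I_n) = y.1 0 i by rewrite mxE beC epC // addr0.
have ep2L y : Lam (ep (th2 y)).
  by have : range th2 (th2 y) by [exists y]; rewrite th2_im.
pose thL : {linear ('rV[o]_#|~: J| * 'rV[o]_#|J|)%type -> 'rV[o]_n} :=
  HB.pack th (GRing.isLinear.Build o _ _ *:%R th th_lin).
exists thL; split.
- move=> [y1 y2] [z1 z2] /= e.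
  have e1 : y1 = z1 by apply/rowP => i; rewrite -(thC (y1, y2)) -(thC (z1, z2)) e.
  congr (_, _) => //; apply: th2_inj; apply/rowP => i; rewrite -!epJ.
  by move: e; rewrite /th /= e1 => /addrI ->.
- apply/seteqP; split => [_ [y _ <-]|z Lz]; first exact: submodD.
  pose y1 : 'rV[o]_#|~: J| := \row_i z 0 (enum_val i).
  pose w : 'rV[o]_#|J| := \row_i (z - be y1) 0 (enum_val i).
  have wE : z = be y1 + ep w.
    rewrite -[LHS](subrK (be y1)) addrC; congr (_ + _); apply/rowP => k.
    have [kJ|kJ] := boolP (k \in J).
      by rewrite -(enum_rankK_in kJ kJ) epJ [RHS]mxE.
    have kJ' : k \in ~: J by rewrite finset.in_setC.
    by rewrite epC // -(enum_rankK_in kJ' kJ') mxE [X in _ + X]mxE beC mxE subrr.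
  have : (ep @^-1` Lam) w.
    rewrite /= (_ : ep w = z - be y1); first exact: submodB.
    by rewrite [in RHS]wE addrAC subrr add0r.
  rewrite -th2_im => -[y2 _ y2E]; exists (y1, y2) => //.
  by change (be y1 + ep (th2 y2) = z); rewrite y2E -wE.
- move=> y; change ((exists v, th y = pi *: v) <-> exists v, y.1 = pi *: v).
  split => [[v vE]|[v vE]].
    by exists (\row_i v 0 (enum_val i)); apply/rowP => i; rewrite -thC vE !mxE.
  apply: (echelon_zero ech); first by exists 0; rewrite /= scaler0 subr0; exact: submodD.
  move=> k kJ; have kJ' : k \in ~: J by rewrite finset.in_setC.
  by rewrite -(enum_rankK_in kJ' kJ') thC vE mxE rmorphM res_pi mul0r.
Qed.

End Fibre.

(** [gcoef x k l j] is [x ^ (k (l - j))] times the Gaussian binomial coefficient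
    of [l] and [j]. For [x = q] it counts the subspaces of codimension [k + j] of
    [F ^ l + F ^ k] that meet [F ^ k] in zero: there is one Gaussian coefficient
    for the projection to [F ^ l], and a linear map to [F ^ k] on it. The
    recursion on [l] splits off one coordinate. *)
Fixpoint gcoef (A : nzRingType) (x : A) (k l j : nat) : A :=
  if l is l'.+1 then
    x ^+ (k + j) * gcoef x k l' j + (if j is j'.+1 then gcoef x k l' j' else 0)
  else (j == 0%N)%:R.

Lemma gcoef_gt (A : nzRingType) (x : A) k l j : (l < j)%N -> gcoef x k l j = 0.
Proof.
elim: l j => [|l IHl] [|j] //= lj; rewrite !IHl ?mulr0 ?addr0 //.
exact: ltnW.
Qed.

Lemma gcoef_ge0 (A : numDomainType) (x : A) k l j : 0 <= x -> 0 <= gcoef x k l j.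
Proof.
move=> x0; elim: l j => [|l IHl] [|j] //=; rewrite ?ler01 ?addr0 ?addr_ge0 ?mulr_ge0 ?exprn_ge0 //.
Qed.

Lemma gcoef1 (A : nzRingType) k l j : gcoef (1 : A) k l j = 'C(l, j)%:R.
Proof.
elim: l j => [|l IHl] [|j] //=; rewrite expr1n mul1r !IHl ?bin0 ?addr0 //.
by rewrite binS natrD addrC.
Qed.

Lemma gcoef_rmorph (A B : nzRingType) (f : {rmorphism A -> B}) x k l j :
  f (gcoef x k l j) = gcoef (f x) k l j.
Proof.
elim: l j => [|l IHl] j /=; first by rewrite rmorph_nat.
rewrite rmorphD rmorphM rmorphXn IHl; congr (_ + _).
by case: j => [|j]; rewrite ?rmorph0.
Qed.

Lemma gcoef0 (A : comNzRingType) (x : A) k l : gcoef x k l 0 = x ^+ (k * l).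
Proof.
by elim: l => [|l IHl] /=; rewrite ?muln0 // addr0 addn0 IHl -exprD mulnS.
Qed.

Section FibreSum.
Variables (F : finFieldType) (o : idomainType) (D : split_dvr F o).
Local Notation io := (io D).
Local Notation res := (res D).
Local Notation pi := (pi D).
Local Notation q := #|F|.
Variable R : realType.

Definition pi_range (V : lmodType o) : set V := [set pi *: v | v in [set: V]].

(** The submodules of [o^l + Z] that correspond to the subspaces of the
    reduction modulo [pi] with zero intersection with the reduction of [Z]. In the
    coordinates of [adapted_basis] these are the lattices with colon lattice
    [Lam]. *)
Definition transverse (l : nat) (Z : lmodType o) (M : set ('rV[o]_l * Z)) : Prop :=
  (forall w, M (pi *: w)) /\ trace M = @pi_range Z.

Lemma pi_row_inj n (u v : 'rV[o]_n) : pi *: u = pi *: v -> u = v.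
Proof.
move=> e; apply/rowP => j; have := congr1 (fun X : 'rV[o]_n => X 0 j) e.
by rewrite !mxE => /(mulfI (pi_neq0 D)).
Qed.

Lemma pi_range_index n : has_index (@pi_range ('rV[o]_n)) (q ^ n).
Proof.
have -> : (q ^ n)%N = #|{: 'rV[F]_n}| by rewrite card_mx mul1n.
apply: (@has_index_finType _ _ _ (map_mx io)).
- have sT : submod [set: 'rV[o]_n] by [].
  exact: submod_subgrp (submod_im ( *:%R pi : {linear 'rV[o]_n -> 'rV[o]_n}) sT).
- move=> z; exists (map_mx res z).
  have [j|v vE] := @res_row0 _ _ D n (z - map_mx io (map_mx res z)).
    by rewrite !mxE rmorphB resK subrr.
  by exists v; rewrite ?vE.
- move=> t t' [v _ e]; apply/rowP => j; have := congr1 (fun X : 'rV[o]_n => res (X 0 j)) e.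
  rewrite !mxE rmorphM res_pi mul0r rmorphB !resK => /esym/eqP.
  by rewrite subr_eq0 => /eqP.
Qed.

(** The projection of a subspace to the first coordinate is either everything
    ([k = 0]), and then the coset is arbitrary, or zero ([k = 1]), and then the
    subspace lies in the other coordinates. *)
Lemma row_glue_transverse l (Z : lmodType o) k (I C : set ('rV[o]_l * Z)) :
    lattice I -> cosets I C ->
  transverse (glue D (@row_head o l Z) (@row_tail o l Z) k I C : set ('rV[o]_(1 + l) * Z)) <->
  transverse I /\ (k = 0%N \/ (k = 1%N /\ C = I)).
Proof.
move=> lI CI; have sI := lI.1; rewrite /transverse row_glue_trace //.
have pre := glue_preim D (@row_head_cons0 o l Z) (@row_tail_cons0 o l Z) k lI CI.
have [c _ CE] := CI; split.
  move=> [pM ->]; split; first split => // v.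
    by rewrite -pre /= linearZ; apply: pM.
  have [x xE] : exists2 x : o, row_head (pi *: row_unit l Z) = x * pi ^+ k &
      I (row_tail (pi *: row_unit l Z) - x *: c).
    by apply/(glueP D _ _ k c _ sI); rewrite -[coset_of_elt I c]/([set c + y | y in I]) CE; exact: pM.
  move: xE; rewrite [row_head _]linearZ [row_tail _]linearZ /=.
  rewrite row_head_unit row_tail_unit scaler0 sub0r.
  rewrite -[pi%:A]/(pi * 1) mulr1.
  case: k pre pM => [|[|k]] pre pM; first by left.
    rewrite expr1 -{1}(mul1r pi) => /(mulIf (pi_neq0 D)) <-.
    rewrite scale1r => Ic; right; split => //.
    have Ic' : I c by rewrite -(opprK c); exact: (subgrpN (submod_subgrp sI)).
    rewrite -CE; apply/seteqP; split => [_ [v Iv <-]|v Iv]; first exact: submodD.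
    by exists (v - c); [exact: submodB|rewrite addrC subrK].
  rewrite 2!exprS mulrCA => e.
  have e' : 1 = x * (pi * pi ^+ k) by apply: (mulfI (pi_neq0 D)); rewrite mulr1.
  have := oner_neq0 F; rewrite -(rmorph1 res) e'.
  by rewrite mulrCA rmorphM res_pi mul0r eqxx.
move=> [[pI ->] kC]; split => // w; rewrite -CE; apply/(glueP D _ _ k c _ sI).
change (exists2 x : o, row_head (pi *: w) = x * pi ^+ k & I (row_tail (pi *: w) - x *: c)).
rewrite [row_head _]linearZ [row_tail _]linearZ /=; case: kC => [->|[-> CI']].
  exists (pi * row_head w); first by rewrite expr0 mulr1.
  by rewrite -scalerA -scalerBr; exact: pI.
exists (row_head w); first by rewrite expr1 mulrC.
apply: submodB => //; apply: submodZ => //.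
by rewrite -CI' -CE; exists 0; rewrite ?addr0 //; exact: submod0.
Qed.

Lemma transverse_sum (l k : nat) (Z : lmodType o) (w : nat -> R) :
    has_index (@pi_range Z) (q ^ k) -> (forall N, 0 <= w N) ->
  (\esum_(M in [set M : set ('rV[o]_l * Z) | lattice M])
     (if `[< transverse M >] then (w (coset_index M))%:E else 0) =
   (\sum_(j < l.+1) gcoef q%:R k l j * w (q ^ (k + j))%N)%:E)%E.
Proof.
move=> hZ; elim: l w => [|l IHl] w w0.
  have sP : submod (@pi_range Z).
    have sT : submod [set: Z] by [].
    exact: (submod_im ( *:%R pi : {linear Z -> Z}) sT).
  have lP : lattice (@pi_range Z) by exact: index_lattice hZ.
  rewrite big_ord1 /= mul1r addn0 -(has_index_coset hZ).2.
  rewrite (@esum_can _ _ _ [set I : set Z | lattice I] _ (fun I => snd @^-1` I)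
             (@trace o 0 Z)) /=.
  - rewrite (@eq_esum _ _ _ _ (fun I => if `[< I = @pi_range Z >] then (w (coset_index I))%:E else 0))%E.
      have e : [set I : set Z | lattice I /\ I = @pi_range Z] = [set @pi_range Z].
        by apply/seteqP; split => [I [_ ->]//|I ->].
      by rewrite esum_if e esum_set1 ?lee_fin.
    move=> I /= lI; rewrite (has_index_coset (index_snd0 lI)).2.
    congr (if _ then _ else _); apply: asbool_equiv_eq; split => [[_ <-] //|IP].
    by split => //= v; rewrite IP; exists v.2.
  - by move=> I lI; apply: index_lattice (index_snd0 lI); apply: (submod_preim snd lI.1).
  - by move=> J lJ; exact: lattice_preim.
  - by [].
  - by move=> J _; exact: trace0K.
have a0 (J : set ('rV[o]_(1 + l) * Z)) :
  (0 <= if `[< transverse J >] then (w (coset_index J))%:E else 0)%E.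
  by case: ifP => // _; rewrite lee_fin.
rewrite (esum_row D) //.
pose w1 N := N%:R * w N; pose w2 N := w (q * N)%N.
have w10 N : 0 <= w1 N by rewrite mulr_ge0 ?ler0n.
have w20 N : 0 <= w2 N by exact: w0.
pose S (u : nat -> R) := (\esum_(M in [set M : set ('rV[o]_l * Z) | lattice M])
     (if `[< transverse M >] then (u (coset_index M))%:E else 0))%E.
have S0 u : (forall N, 0 <= u N) -> (0 <= S u)%E.
  by move=> u0; apply: esum_ge0 => M _; case: ifP => // _; rewrite lee_fin.
rewrite (@eq_esum _ _ _ _ (fun k => (if `[< k = 0%N >] then S w1 else 0) +
                                   (if `[< k = 1%N >] then S w2 else 0)))%E; last first.
  move=> j _; case: j => [|[|j]].
  - rewrite asboolT // asboolF // adde0; apply: eq_esum => I /= lI.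
    rewrite (@eq_esum _ _ _ _ (fun=> if `[< transverse I >] then (w (coset_index I))%:E else 0))%E => [|C CI].
      rewrite (esum_cst (lattice_index lI)); last by case: ifP => // _; rewrite lee_fin.
      by case: ifP => _; rewrite ?mule0.
    rewrite row_glue_index // expn0 mul1n; congr (if _ then _ else _).
    apply: asbool_equiv_eq; split => [/(row_glue_transverse _ lI CI)[]//|tI].
    by apply/(row_glue_transverse _ lI CI); split => //; left.
  - rewrite asboolF // asboolT // add0e; apply: eq_esum => I /= lI.
    rewrite (@eq_esum _ _ _ _ (fun C => if `[< C = I >] then (if `[< transverse I >] then (w2 (coset_index I))%:E else 0) else 0))%E => [|C CI].
      rewrite esum_if (_ : [set C | _ /\ _] = [set I]); last first.
        apply/seteqP; split => [C [_ ->]//|C ->]; split => //; exists 0 => //.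
        by apply/seteqP; split => [_ [v Iv <-]|v Iv]; [rewrite add0r|exists v; rewrite ?add0r].
      by rewrite esum_set1 //; case: ifP => // _; rewrite lee_fin.
    rewrite row_glue_index // expn1 -/(w2 _).
    have -> : `[< transverse (glue D (@row_head o l Z) (@row_tail o l Z) 1 I C : set ('rV[o]_(1 + l) * Z)) >]
        = `[< C = I >] && `[< transverse I >].
      rewrite -asbool_and; apply: asbool_equiv_eq.
      split => [/(row_glue_transverse _ lI CI)[tI []// [_ CI']]//|[CI' tI]].
      by apply/(row_glue_transverse _ lI CI); split => //; right.
    by case: (`[< C = I >]).
  - rewrite !asboolF // add0e; apply: esum1 => I /= lI; apply: esum1 => C CI.
    by case: ifP => // /asboolP /(row_glue_transverse _ lI CI)[_ [|[]]].
rewrite esumD; last 2 first.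
  by move=> i _; case: ifP => // _; exact: S0.
  by move=> i _; case: ifP => // _; exact: S0.
rewrite !esum_if.
have e1 j : [set i | [set: nat] i /\ i = j] = [set j].
  by apply/seteqP; split => [i [_ ->]//|i ->].
rewrite !e1 !esum_set1 ?S0 // /S !IHl // -EFinD; congr EFin.
under [RHS]eq_bigr do rewrite /= mulrDl.
rewrite [RHS]big_split /=; congr (_ + _).
  rewrite [RHS]big_ord_recr /= gcoef_gt // mulr0 mul0r addr0.
  by apply: eq_bigr => j _; rewrite /w1 natrX mulrCA mulrA.
rewrite [RHS]big_ord_recl /= mul0r add0r; apply: eq_bigr => j _.
by rewrite /w2 -expnS addnS.
Qed.

(** The lattices with colon lattice [Lam] lie between [pi Lam] and [Lam], and
    [L] has colon [Lam] if and only if it meets [pi o^n] exactly in [pi Lam]. *)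
Lemma fibre_sum n (Lam : set 'rV[o]_n) (J : {set 'I_n}) (A : 'M[o]_n) (w : nat -> R) :
    lattice Lam -> echelon D Lam J A -> (forall N, 0 <= w N) ->
  (\esum_(L in [set L | lattice L /\ colon D L = Lam]) (w (coset_index L))%:E =
   (\sum_(j < #|~: J|.+1) gcoef q%:R #|J| #|~: J| j *
       w (coset_index Lam * q ^ (#|J| + j))%N)%:E)%E.
Proof.
move=> lL ech w0; have [th [thI thL thpi]] := adapted_basis lL ech.
have sL := lL.1.
have -> : [set L | lattice L /\ colon D L = Lam] =
    [set L | [set L | lattice L /\ L `<=` range th] L /\ colon D L = Lam].
  apply/seteqP; split => [L [lL' cL]|L [[lL' _] cL]] //; split=> //; split => //.
  by rewrite thL -cL; apply: sub_colon lL'.1.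
have lth : lattice (range th) by rewrite thL.
rewrite -esum_if (esum_im (fun L => if `[< colon D L = Lam >] then (w (coset_index L))%:E else 0)%E thI lth).
rewrite -(transverse_sum #|~: J| (pi_range_index #|J|) (w := fun N => w (coset_index Lam * N)%N)) //.
apply: eq_esum => M /= lM; have sM := lM.1.
rewrite (coset_index_im thI lth lM) thL; congr (if _ then _ else _).
apply: asbool_equiv_eq; split => [cM|[pM tM]].
  have pM y : M (pi *: y).
    have : colon D (th @` M) (th y) by rewrite cM -thL; exists y.
    by rewrite /colon /= -linearZ => -[y' My' /thI <-].
  split => //; apply/seteqP; split => [z Mz|_ [z _ <-]].
    have [|v vE] := (thpi (0, z)).2; first by exists 0; rewrite scaler0.
    have : colon D (th @` M) v by exists (0, z).
    rewrite cM -thL => -[y _ yv]; exists y.2 => //.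
    have e : th (pi *: y) = th (0, z) by rewrite linearZ /= yv vE.
    by have := thI _ _ e; case=> _ <-.
  by rewrite /trace /bottom /=; have := pM (0, z); congr M; congr (_, _); rewrite /= scaler0.
apply/seteqP; split => [v [y My yv]|v].
  have [|v1 v1E] := (thpi y).1; first by exists v.
  have : trace M y.2.
    have := submodB sM My (pM (v1, 0)); congr M; rewrite /bottom.
    by rewrite (surjective_pairing y) v1E; congr (_, _); rewrite /= ?subrr // scaler0 subr0.
  rewrite tM => -[z _ zE]; rewrite -thL; exists (v1, z) => //.
  apply: pi_row_inj; rewrite -yv -linearZ /=; congr (th _).
  by rewrite (surjective_pairing y) v1E -zE.
rewrite -thL => -[y _ <-]; rewrite /colon /= -linearZ; exists (pi *: y) => //.
Qed.

End FibreSum.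

(** * Contractions of symmetric tensors *)

Section SymmetricExtension.
Variables (o : comNzRingType) (n m : nat) (J : {set 'I_n}) (A : 'M[o]_n).

Definition mnm_of (f : 'I_n -> nat) : mpoly.multinom n := mpoly.Multinom [tuple f i | i < n].

Lemma mnm_ofE f i : mpoly.fun_of_multinom (mnm_of f) i = f i.
Proof. by rewrite mpoly.mnmE. Qed.

Definition subst_var (i : 'I_n) : mpoly.mpoly n o :=
  if i \in J then \sum_(k | k \notin J) A k i *: mpoly.mpolyX o (mpoly.mnm1 k)
  else mpoly.mpolyX o (mpoly.mnm1 i).

Definition subst_monomial (f : 'I_n -> nat) : mpoly.mpoly n o :=
  \prod_i subst_var i ^+ f i.

Lemma subst_monomialS (e : 'I_n -> nat) i :
  subst_monomial (fun j => e j + (j == i))%N = subst_monomial e * subst_var i.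
Proof.
rewrite /subst_monomial (eq_bigr (fun j => subst_var j ^+ e j * subst_var j ^+ (j == i))).
  rewrite big_split /=; congr (_ * _).
  rewrite (bigD1 i) //= eqxx expr1 big1 ?mulr1 // => j /negPf ->.
  by rewrite expr0.
by move=> j _; rewrite exprD.
Qed.

(** Substituting for the variables in [J] linear forms in the others and then
    applying a linear functional: every functional on the monomials free of [J]
    extends to one that satisfies the linear relations given by [A]. *)
Lemma symmetric_extension (I : finType) (mon : I -> 'I_n -> nat) (u : I -> o) :
    (forall g h, mon g =1 mon h -> g = h) ->
  exists w : ('I_n -> nat) -> o,
    (forall e j, j \in J -> w (fun i => e i + (i == j))%N =
       \sum_(k | k \notin J) A k j * w (fun i => e i + (i == k))%N) /\
    (forall g, (forall j, j \in J -> mon g j = 0%N) -> w (mon g) = u g).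
Proof.
move=> mon_inj.
pose ell (p : mpoly.mpoly n o) : o := \sum_g mpoly.mcoeff (mnm_of (mon g)) p * u g.
have ellZ a p : ell (a *: p) = a * ell p.
  rewrite /ell mulr_sumr; apply: eq_bigr => g _.
  by rewrite mpoly.mcoeffZ mulrA.
have ell_sum (K : finType) (P : pred K) (p : K -> mpoly.mpoly n o) :
    ell (\sum_(k | P k) p k) = \sum_(k | P k) ell (p k).
  rewrite /ell exchange_big /=; apply: eq_bigr => g _.
  by rewrite raddf_sum /= mulr_suml.
exists (fun f => ell (subst_monomial f)); split.
  move=> e j jJ; rewrite subst_monomialS /subst_var jJ mulr_sumr ell_sum.
  apply: eq_bigr => k kJ; rewrite -scalerAr ellZ; congr (_ * ell _).
  by rewrite subst_monomialS /subst_var (negbTE kJ).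
move=> g gJ; rewrite (_ : subst_monomial (mon g) = mpoly.mpolyX o (mnm_of (mon g))); last first.
  rewrite mpoly.mpolyXE_id; apply: eq_bigr => i _; rewrite mnm_ofE /subst_var.
  by case: ifP => // iJ; rewrite gJ // !expr0.
rewrite /ell (bigD1 g) //= big1 => [|h hg]; last first.
  rewrite mpoly.mcoeffX; case: eqP => [e|_]; last by rewrite mul0r.
  case/eqP: hg; apply/esym/mon_inj => i.
  by rewrite -[LHS]mnm_ofE -[RHS]mnm_ofE e.
by rewrite mpoly.mcoeffX eqxx mul1r addr0.
Qed.

End SymmetricExtension.

Section WeakCompositions.

Definition wc (n k : nat) (v : weak_comp n k) (i : 'I_n) : nat := val v i.

Lemma wc_inj n k (v w : weak_comp n k) : wc v =1 wc w -> v = w.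
Proof.
case: v => v vP; case: w => w wP h.
have e : v = w by apply/ffunP => i; apply: ord_inj; exact: h.
by subst w; rewrite (bool_irrelevance vP wP).
Qed.

Lemma wc_sum n k (v : weak_comp n k) : (\sum_i wc v i)%N = k.
Proof. by case: v => v vP; exact: (eqP vP). Qed.

Lemma wc_ex n k (g : 'I_n -> nat) : (\sum_i g i)%N = k ->
  exists v : weak_comp n k, wc v =1 g.
Proof.
move=> gk; have gle i : (g i < k.+1)%N by rewrite ltnS -gk (bigD1 i) //= leq_addr.
pose v : {ffun 'I_n -> 'I_k.+1} := [ffun i => Ordinal (gle i)].
have vP : (\sum_i v i)%N == k.
  by rewrite -[X in _ == X]gk; apply/eqP/eq_bigr => i _; rewrite ffunE.
by exists (exist _ v vP) => i; rewrite /wc /= ffunE.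
Qed.

Lemma card_wc n k : #|{: weak_comp n k}| = 'C((n + k).-1, k).
Proof.
case: n => [|n].
  case: k => [|k].
    have [v _] : exists v : weak_comp 0 0, wc v =1 (fun=> 0%N) by apply: wc_ex; rewrite big_ord0.
    rewrite bin0 -(cards1 v); apply: eq_card => w; rewrite !inE.
    by apply/esym/eqP; apply: wc_inj => -[].
  rewrite add0n bin_small //; apply: eq_card0 => v.
  by have := wc_sum v; rewrite big_ord0.
rewrite addSn /= -bin_sub ?leq_addl // addnK -card_ord_partitions.
pose f (t : n.+1.-tuple 'I_k.+1) : {ffun 'I_n.+1 -> 'I_k.+1} := [ffun i => tnth t i].
have finj : injective f.
  move=> t t' e; apply: eq_from_tnth => i.
  by have := congr1 (fun h : {ffun 'I_n.+1 -> 'I_k.+1} => h i) e; rewrite !ffunE.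
rewrite -(card_imset _ finj) card_sig; apply: eq_card => v; rewrite !inE.
apply/idP/imsetP => [/eqP vk|[t]].
  have vE : v = f [tuple v i | i < n.+1] by apply/ffunP => i; rewrite ffunE tnth_mktuple.
  exists [tuple v i | i < n.+1] => //; rewrite inE big_tuple.
  by apply/eqP; rewrite -[RHS]vk; apply: eq_bigr => i _; rewrite tnth_mktuple.
rewrite inE big_tuple => /eqP tk ->; apply/eqP; rewrite -[RHS]tk.
by apply: eq_bigr => i _; rewrite ffunE.
Qed.

(** These are the compositions indexed by the complement of [J], extended by zero. *)
Lemma card_wc_avoid n k (J : {set 'I_n}) :
  #|[set v : weak_comp n k | [forall j in J, wc v j == 0%N]]%SET| =
  'C((#|~: J| + k).-1, k).
Proof.
rewrite -card_wc; set r := #|~: J|.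
pose g (w : weak_comp r k) (i : 'I_n) := (\sum_(s < r | enum_val s == i) wc w s)%N.
have gE w s : g w (enum_val s) = wc w s.
  rewrite /g (bigD1 s) //= big1 ?addn0 // => s' /andP[/eqP/enum_val_inj -> ].
  by rewrite eqxx.
have gsum w : (\sum_i g w i)%N = k.
  rewrite /g (exchange_big_dep predT) //= -[RHS](wc_sum w).
  by apply: eq_bigr => s _; rewrite (big_pred1 (enum_val s)) // => i; rewrite eq_sym.
pose f w := projT1 (cid (wc_ex (gsum w))).
have fE w : wc (f w) =1 g w by rewrite /f; case: cid.
have finj : injective f.
  by move=> w w' e; apply: wc_inj => s; rewrite -!gE -!fE e.
rewrite -cardsT -(card_imset _ finj); apply: eq_card => v; rewrite inE.
apply/forall_inP/imsetP => [vJ|[w _ ->] j jJ]; last first.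
  rewrite fE /g big1 // => s /eqP e; have := enum_valP s.
  by rewrite e finset.in_setC jJ.
have [|w wE] := @wc_ex r k (fun s => wc v (enum_val s)).
  rewrite -[RHS](wc_sum v) (bigID (mem J)) /= [X in (X + _)%N]big1 ?add0n.
    rewrite (eq_bigl (fun j => j \in ~: J)) => [|j]; last by rewrite finset.in_setC.
    by rewrite [RHS]big_enum_val.
  by move=> j /vJ/eqP.
exists w => //; apply: wc_inj => i; rewrite fE.
have [iJ|iJ] := boolP (i \in J).
  rewrite (eqP (vJ i iJ)) /g big1 // => s /eqP e; have := enum_valP s.
  by rewrite e finset.in_setC iJ.
have iJ' : i \in ~: J by rewrite finset.in_setC.
by rewrite -(enum_rankK_in iJ' iJ') gE wE.
Qed.

End WeakCompositions.

(** * The Lie ring and its ideals *)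

Section LieIdeals.
Variables (m n : nat).

(** With [e] and [f] seen as monomials, [f] is the product of [e] and of the
    [i]-th variable. *)
Definition adj (e : weak_comp n m.-1) (f : weak_comp n m) (i : 'I_n) : bool :=
  [forall j, val f j == (val e j + (j == i))%N :> nat].

Lemma adjP e f i : reflect (wc f =1 (fun j => wc e j + (j == i))%N) (adj e f i).
Proof.
apply: (iffP forallP) => h j; first exact: (eqP (h j)).
by apply/eqP; exact: h.
Qed.

Lemma adj_inji e f i i' : adj e f i -> adj e f i' -> i = i'.
Proof.
move=> /adjP h /adjP h'; have := h i; rewrite h' eqxx => /addnI.
by case: eqP.
Qed.

Lemma adj_inje e e' f i : adj e f i -> adj e' f i -> e = e'.
Proof.
move=> /adjP h /adjP h'; apply: wc_inj => j.
by have := h j; rewrite h' => /addIn.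
Qed.

Lemma adj_injf e f f' i : adj e f i -> adj e f' i -> f = f'.
Proof. by move=> /adjP h /adjP h'; apply: wc_inj => j; rewrite h h'. Qed.

Lemma sum_delta (i : 'I_n) : (\sum_j (j == i))%N = 1%N.
Proof. by rewrite (bigD1 i) //= eqxx big1 // => j /negPf ->. Qed.

Hypothesis hm : (0 < m)%N.

Lemma adj_up e i : exists f, adj e f i.
Proof.
have [|f fE] := @wc_ex n m (fun j => wc e j + (j == i))%N.
  by rewrite big_split /= wc_sum sum_delta addn1 prednK.
by exists f; apply/adjP.
Qed.

Lemma adj_down f i : (0 < wc f i)%N -> exists e, adj e f i.
Proof.
move=> fi; have le j : ((j == i) <= wc f j)%N by case: eqP => [->|].
have [|e eE] := @wc_ex n m.-1 (fun j => wc f j - (j == i))%N.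
  by rewrite sumnB // wc_sum sum_delta subn1.
by exists e; apply/adjP => j; rewrite eE subnK.
Qed.

Section Bracket.
Variable (o : comNzRingType).
Local Notation L := (Lmn m n o).

Definition zin (z : 'rV[o]_n) : L := [ffun b => if b is inr i then z 0 i else 0].
Definition zout (u : L) : 'rV[o]_n := \row_i u (inr i).

Fact zin_linear : linear zin.
Proof.
by move=> a u v; apply/ffunP => -[b|i]; rewrite !ffunE ?mxE // scaler0 addr0.
Qed.
HB.instance Definition _ := GRing.isLinear.Build o _ _ *:%R zin zin_linear.

Lemma zinZ a z : zin (a *: z) = a *: zin z. Proof. exact: linearZ. Qed.

Definition adj_vec (e : weak_comp n m.-1) (f : weak_comp n m) : 'rV[o]_n :=
  \row_i (adj e f i)%:R.

Lemma bracket_xyE e f : bracket_xy o e f = zin (adj_vec e f).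
Proof.
rewrite /bracket_xy; apply/ffunP => b; case: pickP => [i ai|na].
  rewrite !ffunE; case: b => [b|j] //=; rewrite mxE; case: eqP => [[->]|ji].
    by rewrite /adj ai.
  by case: (boolP (adj e f j)) => // aj; case: ji; congr inr; exact: adj_inji aj ai.
rewrite !ffunE; case: b => [b|j] //=; rewrite mxE.
by rewrite /adj na.
Qed.

Definition coordE (u : L) (e : weak_comp n m.-1) : o := u (inl (inl e)).
Definition coordF (u : L) (f : weak_comp n m) : o := u (inl (inr f)).

(** The brackets of [u] with [y_f] and, up to sign, with [x_e], as elements of the
    span of the [z_i]. *)
Definition rowE (u : L) (f : weak_comp n m) : 'rV[o]_n :=
  \sum_e coordE u e *: adj_vec e f.
Definition rowF (u : L) (e : weak_comp n m.-1) : 'rV[o]_n :=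
  \sum_f coordF u f *: adj_vec e f.

Lemma sum_Lbasis (V : zmodType) (G : Lbasis m n -> V) :
  \sum_b G b = \sum_e G (inl (inl e)) + \sum_f G (inl (inr f)) + \sum_i G (inr i).
Proof. by rewrite big_sumType big_sumType. Qed.

Lemma bracketE (u v : L) : bracket u v =
  zin (\sum_f coordF v f *: rowE u f - \sum_e coordE v e *: rowF u e).
Proof.
rewrite /bracket sum_Lbasis [X in _ + X]big1 ?addr0 => [|i _]; last first.
  by apply: big1 => b _; rewrite scaler0.
rewrite linearB /=; congr (_ + _).
  rewrite linear_sum exchange_big /= sum_Lbasis [X in X + _ + _]big1 => [|e _]; last first.
    by apply: big1 => e' _; rewrite scaler0.
  rewrite add0r [X in _ + X]big1 ?addr0 => [|i _]; last first.
    by apply: big1 => e' _; rewrite scaler0.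
  apply: eq_bigr => f _; rewrite linearZ /= linear_sum scaler_sumr.
  apply: eq_bigr => e _; rewrite /= zinZ scalerA bracket_xyE.
  by rewrite mulrC.
rewrite linear_sum -sumrN exchange_big /= sum_Lbasis addrAC.
rewrite [X in _ + X]big1 ?addr0 => [|f _]; last first.
  by apply: big1 => f' _; rewrite scaler0.
rewrite [X in _ + X]big1 ?addr0 => [|i _]; last first.
  by apply: big1 => f' _; rewrite scaler0.
apply: eq_bigr => e _; rewrite linearZ /= linear_sum scaler_sumr -sumrN.
apply: eq_bigr => f _; rewrite /= zinZ scalerA bracket_xyE.
by rewrite mulrC scalerN.
Qed.

Lemma rowE_bracket u f : zin (rowE u f) = bracket u (gen o (inl (inr f))).
Proof.
rewrite bracketE; congr zin; rewrite [X in _ - X]big1 ?subr0 => [|e _]; last first.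
  by rewrite /coordE ffunE scale0r.
rewrite (bigD1 f) //= big1 ?addr0 => [|f' ff']; last first.
  by rewrite /coordF ffunE (inj_eq inl_inj) (inj_eq inr_inj) (negPf ff') scale0r.
by rewrite /coordF ffunE eqxx scale1r.
Qed.

Lemma rowF_bracket u e : zin (rowF u e) = - bracket u (gen o (inl (inl e))).
Proof.
rewrite bracketE -linearN; congr zin; rewrite big1 ?sub0r ?opprK => [|f _]; last first.
  by rewrite /coordF ffunE scale0r.
rewrite (bigD1 e) //= big1 ?addr0 => [|e' ee']; last first.
  by rewrite /coordE ffunE (inj_eq inl_inj) (inj_eq inl_inj) (negPf ee') scale0r.
by rewrite /coordE ffunE eqxx scale1r.
Qed.

Lemma rowE_linear a u v f : rowE (a *: u + v) f = a *: rowE u f + rowE v f.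
Proof.
rewrite /rowE scaler_sumr -big_split /=; apply: eq_bigr => e _.
by rewrite /coordE !ffunE scalerDl scalerA.
Qed.

Lemma rowF_linear a u v e : rowF (a *: u + v) e = a *: rowF u e + rowF v e.
Proof.
rewrite /rowF scaler_sumr -big_split /=; apply: eq_bigr => f _.
by rewrite /coordF !ffunE scalerDl scalerA.
Qed.

Lemma rowF_entry u e f i : adj e f i -> rowF u e 0 i = coordF u f.
Proof.
move=> ae; rewrite summxE (bigD1 f) //= big1 => [|f' ff']; last first.
  rewrite !mxE; case: (boolP (adj e f' i)) => [ae'|]; last by rewrite mulr0.
  by rewrite (adj_injf ae' ae) eqxx in ff'.
by rewrite !mxE ae mulr1 addr0.
Qed.

(** The preimage of the centre of the quotient of the Lie ring by [Lam]; it is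
    enough to test the brackets with the generators. *)
Definition centraliser (Lam : set 'rV[o]_n) : set L :=
  [set u | (forall f, Lam (rowE u f)) /\ (forall e, Lam (rowF u e))].

End Bracket.
End LieIdeals.

(** * The centraliser modulo the uniformizer *)
Section CentraliserIndex.
Variables (F : finFieldType) (o : idomainType) (D : split_dvr F o).
Local Notation io := (io D).
Local Notation res := (res D).
Local Notation pi := (pi D).
Local Notation q := #|F|.
Variables (m n : nat).
Hypothesis hm : (0 < m)%N.
Local Notation L := (Lmn m n o).
Local Notation centraliser := (@centraliser m n o).

Lemma submod_centraliser (Lam : set 'rV[o]_n) : submod Lam -> submod (centraliser Lam).
Proof.
move=> sL; split; first split => [f|e].
- rewrite /rowE big1 => [|e _]; first exact: submod0.
  by rewrite /coordE ffunE scale0r.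
- rewrite /rowF big1 => [|f _]; first exact: submod0.
  by rewrite /coordF ffunE scale0r.
move=> a u v [uE uF] [vE vF]; split => [f|e].
  by rewrite rowE_linear; apply: sL.2.
by rewrite rowF_linear; apply: sL.2.
Qed.

Lemma colon_centraliser (Lam : set 'rV[o]_n) :
  colon D (centraliser Lam) = centraliser (colon D Lam).
Proof.
have rE (u : L) f : rowE (pi *: u) f = pi *: rowE u f.
  rewrite -[pi *: u]addr0 rowE_linear [X in _ + X]big1 ?addr0 // => e _.
  by rewrite /coordE ffunE scale0r.
have rF (u : L) e : rowF (pi *: u) e = pi *: rowF u e.
  rewrite -[pi *: u]addr0 rowF_linear [X in _ + X]big1 ?addr0 // => f _.
  by rewrite /coordF ffunE scale0r.
by apply/seteqP; split => u [uE uF]; split => [f|e]; move: (uE, uF);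
  case=> a b; rewrite /colon /=; [have := a f|have := b e|have := a f|have := b e];
  rewrite /colon /= ?rE ?rF.
Qed.

(** If [x] gives the coefficients of a form of degree [m - 1] and [l] those of a
    linear form, the hypothesis says that their product is zero. Give the [k]-th
    variable weight [k]. Then [l] has only one term of maximal weight, and its
    product with a term of maximal weight of [x] does not cancel. *)
Lemma linear_form_regular (x : weak_comp n m.-1 -> F) (l : 'I_n -> F) (j : 'I_n) :
    l j != 0 ->
    (forall f, \sum_i l i * \sum_e x e * (adj e f i)%:R = 0) ->
  forall e, x e = 0.
Proof.
move=> lj eq0 e0; apply/eqP/negPn/negP => xe0.
pose wt k (v : weak_comp n k) := (\sum_k wc v k * k)%N.
pose P : pred (weak_comp n m.-1) := fun e => x e != 0.
pose Q : pred 'I_n := fun i => l i != 0.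
case: (@arg_maxnP _ e0 P (@wt _) xe0) => e xe emax.
case: (@arg_maxnP _ j Q (fun i => i : nat) lj) => i li imax.
have [f aef] := adj_up hm e i.
have wtS e' i' : adj e' f i' -> wt _ f = (wt _ e' + i')%N.
  move=> /adjP fE; rewrite /wt (eq_bigr (fun k => wc e' k * k + (k == i') * k)%N).
    rewrite big_split /=; congr (_ + _)%N.
    by rewrite (bigD1 i') //= eqxx mul1n big1 ?addn0 // => k /negPf ->.
  by move=> k _; rewrite fE mulnDl.
have := eq0 f; rewrite (bigD1 i) //= [X in _ + X]big1 => [|i' ii'].
  rewrite (bigD1 e) //= big1 => [|e' ee'].
    by rewrite aef mulr1 !addr0; apply/eqP; rewrite mulf_neq0.
  case: (boolP (adj e' f i)) => [ae'|]; last by rewrite mulr0.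
  by rewrite (adj_inje ae' aef) eqxx in ee'.
have [->|li'] := eqVneq (l i') 0; first by rewrite mul0r.
rewrite big1 ?mulr0 // => e' _.
case: (boolP (adj e' f i')) => [ae'|]; last by rewrite mulr0.
have [->|xe'] := eqVneq (x e') 0; first by rewrite mul0r.
have h1 : (wt _ e' <= wt _ e)%N := emax e' xe'.
have h2 : (i' <= i)%N := imax i' li'.
have h3 : (i' < i)%N by rewrite ltn_neqAle h2 andbT; apply: contra ii' => /eqP/ord_inj ->.
have h4 := wtS _ _ aef; rewrite (wtS _ _ ae') in h4.
by move: h1 h3 h4; lia.
Qed.

Section Layer.
Variables (Lam : set 'rV[o]_n) (J : {set 'I_n}) (A : 'M[o]_n).
Hypotheses (sL : submod Lam) (ech : echelon D Lam J A).

(** Such a [z] is the combination of the echelon rows with its own pivot entries as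
    coefficients. *)
Lemma ech_fix (z : 'rV[o]_n) :
  (forall j, j \in J -> z 0 j = \sum_(k | k \notin J) A k j * z 0 k) -> Lam z.
Proof.
move=> zJ; suff -> : z = ech_head J A z by exact: (ech_headP sL ech).
apply/rowP => j; have [jJ|jJ] := boolP (j \in J); last by rewrite ech_headE.
rewrite zJ // /ech_head summxE; apply: eq_bigr => k kJ.
rewrite mxE mulrC; congr (_ * _); rewrite mxE summxE mxE eqxx /=.
have -> : (j == k) = false by apply/negbTE/negP => /eqP e; move: kJ; rewrite -e jJ.
rewrite add0r (bigD1 j) //= big1 => [|j' /andP[_ /negPf j'j]].
  by rewrite !mxE !eqxx mulr1 addr0.
by rewrite !mxE [j == j']eq_sym j'j andbF mulr0.
Qed.

(** The coordinates of [u] outside of this set may be prescribed arbitrarily modulo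
    [pi] in the centraliser of [Lam], and those in it are then determined. If [J] is
    not empty, the [x]-coordinates have to vanish modulo [pi]. The
    [y]-coordinates form a functional on the monomials of degree [m] that respects
    the relations expressing the variables in [J] by the others, so it is determined
    by its values on the monomials free of [J]. *)
Definition touched : {set weak_comp n m.-1 + weak_comp n m} :=
  [set t | match t with
           | inl e => J != finset.set0
           | inr f => [exists j in J, wc f j != 0%N] end]%SET.

Lemma touchedF f : (inr f \in touched) = false -> forall j, j \in J -> wc f j = 0%N.
Proof.
rewrite inE => h j jJ; apply/eqP/negPn/negP => fj; move: h.
by move/negbT/negP; apply; apply/exists_inP; exists j.
Qed.

(** Here the relations are solved over [o], by [symmetric_extension], and not only
    modulo [pi]. *)
Lemma centraliser_approx (u : L) :
  exists2 w, centraliser Lam w &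
    (forall i, w (inr i) = u (inr i)) /\
    (forall t, t \notin touched -> w (inl t) = u (inl t)).
Proof.
have [w0 [w0J w0C]] := symmetric_extension J A (coordF u) (@wc_inj n m).
pose w : L := [ffun b => match b with
  | inl (inl e) => if J == finset.set0 then coordE u e else 0
  | inl (inr f) => w0 (wc f)
  | inr i => u (inr i) end].
exists w; last split => [i|[e|f] nt]; rewrite ?ffunE //.
- split => [f|e].
    have [J0|J0] := eqVneq J finset.set0.
      by apply: ech_fix => j; rewrite J0 inE.
    rewrite /rowE big1 => [|e _]; first exact: submod0.
    by rewrite /coordE ffunE (negbTE J0) scale0r.
  have rE k : rowF w e 0 k = w0 (fun i => wc e i + (i == k))%N.
    have [f /[dup] aef /adjP fE] := adj_up hm e k.
    by rewrite (rowF_entry _ aef) /coordF ffunE; congr w0; apply/funext.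
  apply: ech_fix => j jJ; rewrite rE w0J //.
  by apply: eq_bigr => k _; rewrite rE.
- by move: nt; rewrite inE negbK => ->.
- by apply: w0C; apply: touchedF; apply/negbTE.
Qed.

(** On the [x]-coordinates the relation for [j] in [J] is the vanishing of the product
    with a nonzero linear form. On the [y]-coordinates the relations replace a
    variable in [J] by variables outside of [J], which lowers the degree in [J]. *)
Lemma centraliser_res0 (x : L) : centraliser Lam x ->
    (forall t, t \notin touched -> res (x (inl t)) = 0) ->
  forall t, res (x (inl t)) = 0.
Proof.
move=> [xE xF] x0 [e|f].
  have [eT|] := boolP (inl e \in touched); last exact: x0.
  move: (eT); rewrite inE => /set0Pn[j jJ].
  pose l i : F := (i == j)%:R - (i \notin J)%:R * res (A i j).
  apply: (@linear_form_regular (fun e => res (coordE x e)) l j).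
    by rewrite /l eqxx jJ mul0r subr0 oner_neq0.
  move=> f; have rE i : \sum_e' res (coordE x e') * (adj e' f i)%:R = res (rowE x f 0 i).
    rewrite summxE rmorph_sum; apply: eq_bigr => e' _.
    by rewrite !mxE rmorphM rmorph_nat.
  under eq_bigr do rewrite rE mulrBl.
  rewrite sumrB (bigD1 j) //= eqxx mul1r big1 ?addr0 => [|i /negPf ->]; last by rewrite mul0r.
  rewrite (ech.2 _ (xE f) j jJ) big_mkcond /= -sumrB big1 // => i _.
  by case: ifP => iJ; rewrite ?mul1r ?mul0r ?subrr // mulrC subrr.
have [N] := ubnP (\sum_(j in J) wc f j); elim: N f => // N IHN f fN.
have [fT|] := boolP (inr f \in touched); last exact: x0.
move: fT; rewrite inE => /exists_inP[j jJ]; rewrite -lt0n => /adj_down[e aef].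
change (res (coordF x f) = 0); rewrite -(rowF_entry _ aef) (ech.2 _ (xF e) j jJ).
rewrite big1 // => k kJ; have [f' aef'] := adj_up hm e k.
rewrite (rowF_entry _ aef') [res (coordF x f')]IHN ?mul0r //.
move: fN; rewrite !ltnS; apply: leq_trans.
rewrite (eq_bigr (wc e)) => [|i iJ].
  rewrite [X in (_ < X)%N](eq_bigr (fun i => wc e i + (i == j))%N) => [|i _].
    rewrite big_split /= [X in (_ < _ + X)%N](bigD1 j) //= eqxx add1n addnS ltnS.
    exact: leq_addr.
  exact: (adjP _ _ _ aef).
rewrite (adjP _ _ _ aef') (_ : (i == k) = false) ?addn0 //.
by apply/negbTE/negP => /eqP ik; move: kJ; rewrite -ik iJ.
Qed.

Lemma centraliser_index : has_index (modpi D (centraliser Lam)) (q ^ #|touched|).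
Proof.
pose T := {ffun {t | t \in touched} -> F}.
pose f (t : T) : L := [ffun b => if b is inl t0 then
  (if insub t0 is Some s then io (t s) else 0) else 0].
have -> : (q ^ #|touched|)%N = #|T| by rewrite card_ffun card_sig; congr (_ ^ _)%N; apply: eq_card.
have f0 t t0 : t0 \notin touched -> f t (inl t0) = 0.
  by move=> nt; rewrite ffunE; case: insubP => [s|//]; rewrite (negbTE nt).
have fr t i : f t (inr i) = 0 by rewrite ffunE.
have fE t (s : {t | t \in touched}) : f t (inl (val s)) = io (t s) by rewrite ffunE valK.
have sX := submod_centraliser sL.
have sm : subgrp (modpi D (centraliser Lam)) by apply/subgrp_sum_im/submod_subgrp.
apply: (@has_index_finType _ _ _ f sm) => [u|t t' [v Xv]].
  have [w Xw [wr wl]] := centraliser_approx u.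
  pose t : T := [ffun s : {t | t \in touched} => res ((u - w) (inl (val s)))].
  have ch b : exists y, (u - w - f t) b = pi * y.
    apply: res_ker; rewrite !ffunE; case: b => [t0|i]; last by rewrite wr subrr subr0 rmorph0.
    have [tT|tT] := boolP (t0 \in touched).
      pose s : {t | t \in touched} := exist _ t0 tT.
      have /= := fE t s; rewrite ffunE => ->.
      by rewrite rmorphB resK ffunE !ffunE subrr.
    have := f0 t t0 tT; rewrite ffunE => ->.
    by rewrite wl // subrr subr0 rmorph0.
  pose v : L := [ffun b => projT1 (cid (ch b))]; exists t, v.
  rewrite (_ : _ - _ = w) //.
  have e : pi *: v = u - w - f t.
    by apply/ffunP => b; rewrite [LHS]ffunE /v ffunE; case: cid.
  by rewrite /= e [u - w - _]addrAC subKr.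
have hx b : res ((f t - f t' - pi *: v) b) = res ((f t - f t') b).
  by rewrite !ffunE rmorphB rmorphM res_pi mul0r subr0.
apply/ffunP => s; apply: (can_inj (resK D)).
have x0 t0 : t0 \notin touched -> res ((f t - f t' - pi *: v) (inl t0)) = 0.
  move=> nt; rewrite hx -[f t - f t']/(f t + (- f t')) ffunE [X in _ + X]ffunE.
  by rewrite !f0 // subr0 rmorph0.
have := centraliser_res0 Xv x0 (val s); rewrite [res _]hx.
have -> : (f t - f t') (inl (val s)) = io (t s) - io (t' s) by rewrite -!fE !ffunE.
by rewrite rmorphB !resK => /eqP; rewrite subr_eq0 => /eqP ->.
Qed.

End Layer.
End CentraliserIndex.

(** * The ideal zeta function as a sum over lattices *)
Section IdealSum.
Variables (F : finFieldType) (o : idomainType) (D : split_dvr F o) (R : realType).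
Local Notation q := #|F|.
Variables (m n : nat).
Hypothesis hm : (0 < m)%N.
Local Notation L := (Lmn m n o).
Local Notation centraliser := (@centraliser m n o).
Local Notation d := #|{: weak_comp n m.-1 + weak_comp n m}|.

Lemma lattice_modpi_colon (Lam : set 'rV[o]_n) J A :
    lattice Lam -> echelon D Lam J A ->
  coset_index Lam = (q ^ #|J| * coset_index (colon D Lam))%N.
Proof. by move=> lL ech; apply: index_colon => //; exact: (echelon_index lL.1 ech). Qed.

Lemma echelon0 (Lam : set 'rV[o]_n) (J : {set 'I_n}) A : submod Lam -> echelon D Lam J A -> J = finset.set0 ->
  Lam = setT.
Proof.
move=> sL ech J0; apply/seteqP; split => // z _.
by apply: (ech_fix sL ech) => j; rewrite J0 inE.
Qed.

Lemma centraliserT : centraliser setT = setT.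
Proof. by apply/seteqP; split. Qed.

(** Induction on the index of [Lam]: the colon lattice has smaller index unless [Lam]
    is everything, and the two centralisers are related by [centraliser_index]. *)
Lemma lattice_centraliser (Lam : set 'rV[o]_n) :
  lattice Lam -> lattice (centraliser Lam).
Proof.
have [N] := ubnP (coset_index Lam); elim: N Lam => // N IHN Lam iN lL.
have [J [A ech]] := echelon_ex D lL.1.
have [J0|J0] := eqVneq J finset.set0.
  by rewrite (echelon0 lL.1 ech J0) centraliserT; exact: lattice_setT.
have lc : lattice (centraliser (colon D Lam)).
  apply: IHN; last exact: lattice_colon.
  rewrite ltnS in iN; apply: leq_trans iN.
  rewrite (lattice_modpi_colon lL ech) -[X in (X < _)%N]mul1n ltn_pmul2r.
    by rewrite -(expn0 q) ltn_exp2l ?q_gt1 // card_gt0.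
  exact/lattice_index_gt0/lattice_colon.
have sX := submod_centraliser m lL.1.
apply: (index_lattice sX (k := q ^ #|touched m J| * coset_index (centraliser (colon D Lam)))).
apply: (index_split (th := ( *:%R (pi D) : {linear L -> L}))).
- exact: submod_subgrp.
- have := lattice_index lc; rewrite -(colon_centraliser D m Lam); apply.
- exact: (centraliser_index hm lL.1 ech).
Qed.

Lemma centraliser_colon_index (Lam : set 'rV[o]_n) J A :
    lattice Lam -> echelon D Lam J A ->
  coset_index (centraliser Lam) =
    (q ^ #|touched m J| * coset_index (centraliser (colon D Lam)))%N.
Proof.
move=> lL ech; rewrite -(colon_centraliser D m Lam).
apply: index_colon; first exact: lattice_centraliser.
exact: (centraliser_index hm lL.1 ech).
Qed.

(** The Lie ring as [o^d + Z], with [Z] the span of the [z_i]. *)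
Definition coords (w : 'rV[o]_d * 'rV[o]_n) : L :=
  [ffun b => match b with inl t => w.1 0 (enum_rank t) | inr i => w.2 0 i end].

Fact coords_linear : linear coords.
Proof. by move=> a u v; apply/ffunP => -[t|i]; rewrite !ffunE !mxE. Qed.
HB.instance Definition _ := GRing.isLinear.Build o _ _ *:%R coords coords_linear.

Definition coords_inv (u : L) : 'rV[o]_d * 'rV[o]_n :=
  (\row_i u (inl (enum_val i)), zout u).

Lemma coordsK : cancel coords coords_inv.
Proof.
move=> [v z]; congr (_, _); apply/rowP => i; rewrite !mxE ffunE //.
by rewrite enum_valK.
Qed.

Lemma coords_invK : cancel coords_inv coords.
Proof.
by move=> u; apply/ffunP => -[t|i]; rewrite ffunE /= mxE ?enum_rankK.
Qed.

Lemma coords0 z : coords (0, z) = zin m z.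
Proof. by apply/ffunP => -[t|i]; rewrite !ffunE ?mxE. Qed.

Lemma zin_centraliser (Lam : set 'rV[o]_n) z : submod Lam -> centraliser Lam (zin m z).
Proof.
move=> sL; split => [f|e].
  rewrite /rowE big1 => [|e _]; first exact: submod0.
  by rewrite /coordE ffunE scale0r.
rewrite /rowF big1 => [|f _]; first exact: submod0.
by rewrite /coordF ffunE scale0r.
Qed.

Lemma is_ideal_submod (I : set L) : is_ideal I -> submod I.
Proof. by move=> [I0 ID IZ _]; split => // a u v Iu Iv; apply: ID => //; apply: IZ. Qed.

Lemma ideal_centraliser (I : set L) : submod I ->
  is_ideal I <-> I `<=` centraliser (@zin m n o @^-1` I).
Proof.
move=> sI; split => [[_ _ _ Ib] u Iu|sub].
  split => [f|e] /=.
    by rewrite rowE_bracket; exact: Ib.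
  by rewrite rowF_bracket -scaleN1r; apply: submodZ => //; exact: Ib.
split; [exact: submod0|by move=> *; exact: submodD|by move=> *; exact: submodZ|].
move=> u v /sub[uE uF]; rewrite bracketE linearB; apply: (submodB sI).
  by rewrite linear_sum; apply: submod_sum => // f _; rewrite linearZ; apply: submodZ => //; exact: uE.
by rewrite linear_sum; apply: submod_sum => // e _; rewrite linearZ; apply: submodZ => //; exact: uF.
Qed.

(** The contribution to the zeta function of the ideals over [Lam], up to a factor
    that does not depend on [Lam]. *)
Definition phi (s : R) (Lam : set 'rV[o]_n) : R :=
  (coset_index Lam)%:R `^ (d%:R - s) * (coset_index (centraliser Lam))%:R `^ (- s).

Lemma phi_ge0 s Lam : 0 <= phi s Lam.
Proof. by rewrite mulr_ge0 ?powR_ge0. Qed.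

(** A basis of the centraliser of [Lam] that contains the [z_i] turns the ideals over
    [Lam] into the lattices with trace [Lam]. *)
Lemma ideals_over (s : R) (Lam : set 'rV[o]_n) : lattice Lam -> d%:R < s + 1 ->
  (\esum_(I in [set I : set L | (is_ideal I /\ finite_set (cosets I)) /\
                                 @zin m n o @^-1` I = Lam]) weight s I =
   ((\prod_(j < d) (1 - q%:R `^ (j%:R - s))^-1) * phi s Lam)%:E)%E.
Proof.
move=> lL ds; have lX := lattice_centraliser lL; have sL := lL.1.
have lX' : lattice (coords @^-1` centraliser Lam) by exact: lattice_preim.
have [|Th [ThI ThX Th0]] := free_lattice D lX'.
  by move=> z /=; rewrite coords0; exact: zin_centraliser.
pose th : {linear ('rV[o]_d * 'rV[o]_n)%type -> L} := (coords : {linear _ -> _}) \o Th.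
have thI : injective th by move=> u v /= /(can_inj coordsK)/ThI.
have thX : range th = centraliser Lam.
  apply/seteqP; split => [_ [w _ <-] /=|u Xu].
    by have : range Th (Th w) by [exists w]; rewrite ThX.
  have : (coords @^-1` centraliser Lam) (coords_inv u) by rewrite /= coords_invK.
  rewrite -ThX => -[w _ e]; exists w => //=; by rewrite e coords_invK.
have th0 z : th (0, z) = zin m z by rewrite /= Th0 coords0.
have -> : [set I : set L | (is_ideal I /\ finite_set (cosets I)) /\ @zin m n o @^-1` I = Lam] =
   [set I | [set I | lattice I /\ I `<=` range th] I /\ @zin m n o @^-1` I = Lam].
  apply/seteqP; split => I [[]].
    move=> iI fI zI; split => //; split; first by split => //; exact: is_ideal_submod.
    by rewrite thX -zI; apply/ideal_centraliser => //; exact: is_ideal_submod.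
  move=> lI sI zI; split => //; split; last by case: lI.
  by apply/ideal_centraliser; [exact: lI.1|rewrite zI -thX].
have lth : lattice (range th) by rewrite thX.
rewrite -esum_if (esum_im (fun I => if `[< @zin m n o @^-1` I = Lam >] then weight s I else 0)%E thI lth).
transitivity (\esum_(J in [set J : set ('rV[o]_d * 'rV[o]_n) | lattice J])
   (((coset_index (centraliser Lam))%:R `^ (- s))%:E *
     (if `[< trace J = Lam >] then weight s J else 0)))%E.
  apply: eq_esum => J /= lJ.
  have -> : @zin m n o @^-1` (th @` J) = trace J.
    apply/seteqP; split => z /=.
      move=> [w Jw] e; have e' : w = (0, z) by apply: thI; exact: etrans e (esym (th0 z)).
      by rewrite e' in Jw.
    by move=> Jz; exists (0, z) => //; exact: th0.
  case: ifP => _; last by rewrite mule0.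
  by rewrite /weight (coset_index_im thI lth lJ) thX natrM powRM ?ler0n.
rewrite esumZl ?powR_ge0 //; last by move=> J; case: ifP => // _; exact: weight_ge0.
rewrite (trace_sum D lL ds) -EFinM; congr EFin.
by rewrite /phi mulrCA [X in _ * X]mulrC.
Qed.

Lemma ideal_zeta_sum (s : R) : d%:R < s + 1 ->
  (ideal_zeta m n o s = (\prod_(j < d) (1 - q%:R `^ (j%:R - s))^-1)%:E *
     \esum_(Lam in [set Lam : set 'rV[o]_n | lattice Lam]) (phi s Lam)%:E)%E.
Proof.
move=> ds; rewrite /ideal_zeta.
rewrite (@esum_fibers _ _ _ [set Lam : set 'rV[o]_n | lattice Lam] _ (fun I => @zin m n o @^-1` I)).
- rewrite -esumZl; last 2 first.
  + rewrite prodr_ge0 // => j _; rewrite invr_ge0 subr_ge0 -opprB ltW //; apply: powR_lt1.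
      by rewrite ltr1n; exact: q_gt1.
    have jd : j.+1%:R <= d%:R :> R by rewrite ler_nat.
    by move: ds jd; rewrite -natr1 => *; lra.
  + by move=> I; rewrite lee_fin phi_ge0.
  by apply: eq_esum => Lam /= lL; rewrite -EFinM -(ideals_over lL ds).
- move=> I [iI fI]; apply: (@lattice_preim _ _ _ (@zin m n o : {linear _ -> _})); split => //.
  exact: is_ideal_submod.
- by move=> I; exact: weight_ge0.
Qed.

End IdealSum.

(** * The recursion for the sum over lattices *)

Definition top_part (o : idomainType) (n : nat) (Z : lmodType o) (v : 'rV[o]_n) :
  'rV[o]_n * Z := (v, 0).

Fact top_part_linear o n Z : linear (@top_part o n Z).
Proof. by move=> a u v; congr (_, _); rewrite /= scaler0 addr0. Qed.
HB.instance Definition _ (o : idomainType) (n : nat) (Z : lmodType o) :=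
  GRing.isLinear.Build o _ _ *:%R (@top_part o n Z) (@top_part_linear o n Z).

Section Recursion.
Variables (F : finFieldType) (o : idomainType) (D : split_dvr F o) (R : realType).
Local Notation q := #|F|.
Variables (m n : nat).
Hypothesis hm : (0 < m)%N.
Local Notation d := #|{: weak_comp n m.-1 + weak_comp n m}|.

Definition touched_card (c : nat) : nat :=
  ((c != 0%N) * #|{: weak_comp n m.-1}| +
   (#|{: weak_comp n m}| - 'C((n - c + m).-1, m)))%N.

Lemma card_touched (J : {set 'I_n}) : #|touched m J| = touched_card #|J|.
Proof.
rewrite -sum1_card big_sumType /=; congr (_ + _)%N.
  rewrite (eq_bigl (fun=> J != finset.set0)) => [|e]; last by rewrite inE.
  rewrite -cards_eq0; case: eqP => _; first by rewrite big_pred0.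
  by rewrite sum1_card mul1n.
rewrite sum1_card; have := card_wc_avoid m J.
have -> : #|~: J| = (n - #|J|)%N by rewrite cardsCs finset.setCK card_ord.
move=> <-; rewrite -[#|{: weak_comp n m}|](cardC [pred f | inr f \in touched m J]).
rewrite [X in (_ - X)%N](_ : _ = #|[predC [pred f | inr f \in touched m J]]|) ?addnK //.
apply: eq_card => f; rewrite !inE; apply/forall_inP/exists_inPn => h j jJ.
  by rewrite negbK h.
by have := h j jJ; rewrite negbK.
Qed.

(** The codimension of the image of [Lam] modulo [pi], read off from an index because
    the echelon data are not unique. *)
Definition codim (Lam : set 'rV[o]_n) : nat :=
  xget 0%N [set c | has_index (modpi D Lam) (q ^ c)].

Lemma codimE (Lam : set 'rV[o]_n) J A : lattice Lam -> echelon D Lam J A ->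
  codim Lam = #|J|.
Proof.
move=> lL ech; have hJ := echelon_index lL.1 ech.
have h : has_index (modpi D Lam) (q ^ codim Lam).
  by rewrite /codim; case: xgetP => [c _ //|/(_ #|J|)/(_ hJ)].
by apply/eqP; rewrite -(eqn_exp2l _ _ (q_gt1 F)); apply/eqP; exact: has_index_uniq h hJ.
Qed.

Lemma codim_le (Lam : set 'rV[o]_n) : lattice Lam -> (codim Lam <= n)%N.
Proof.
move=> lL; have [J [A ech]] := echelon_ex D lL.1.
by rewrite (codimE lL ech) -[X in (_ <= X)%N]card_ord max_card.
Qed.

Lemma codim_index (Lam : set 'rV[o]_n) : lattice Lam ->
  coset_index Lam = (q ^ codim Lam * coset_index (colon D Lam))%N.
Proof.
move=> lL; have [J [A ech]] := echelon_ex D lL.1.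
by rewrite (codimE lL ech); exact: lattice_modpi_colon ech.
Qed.

Lemma codim0 (Lam : set 'rV[o]_n) : lattice Lam -> codim Lam = 0%N <-> Lam = setT.
Proof.
move=> lL; have [J [A ech]] := echelon_ex D lL.1; rewrite (codimE lL ech).
split => [/eqP|e]; first by rewrite cards_eq0 => /eqP; exact: (echelon0 lL.1 ech).
rewrite -(codimE lL ech); apply/eqP; rewrite -(eqn_exp2l _ _ (q_gt1 F)).
have cT : colon D [set: 'rV[o]_n] = setT by apply/seteqP; split.
have := codim_index lL; rewrite e cT -{1}[coset_index setT]mul1n => /eqP.
 rewrite eqn_pmul2r; last exact: lattice_index_gt0 (lattice_setT _).
by rewrite expn0 eq_sym.
Qed.

Variable s : R.

(** The factor that relates [phi] of a lattice of invariant [c] to [phi] of its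
    colon lattice. *)
Definition xwt (c : nat) : R :=
  (q%:R ^+ c) `^ (d%:R - s) * (q%:R ^+ touched_card c) `^ (- s).

Lemma phi_layer (Lam : set 'rV[o]_n) : lattice Lam ->
  phi m s Lam = xwt (codim Lam) * phi m s (colon D Lam).
Proof.
move=> lL; have [J [A ech]] := echelon_ex D lL.1.
rewrite /phi (centraliser_colon_index hm lL ech) (codim_index lL) (codimE lL ech).
rewrite card_touched !natrM !powRM ?ler0n // !natrX /xwt.
by rewrite mulrACA.
Qed.

Definition Gsum (c : nat) : \bar R :=
  (\esum_(Lam in [set Lam : set 'rV[o]_n | lattice Lam /\ codim Lam = c])
     (phi m s Lam)%:E)%E.

Lemma Gsum_ge0 c : (0 <= Gsum c)%E.
Proof. by apply: esum_ge0 => Lam _; rewrite lee_fin phi_ge0. Qed.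

Lemma esum_codim (a : set 'rV[o]_n -> \bar R) : (forall Lam, (0 <= a Lam)%E) ->
  (\esum_(Lam in [set Lam : set 'rV[o]_n | lattice Lam]) a Lam =
   \sum_(c < n.+1) \esum_(Lam in [set Lam : set 'rV[o]_n | lattice Lam /\ codim Lam = c]) a Lam)%E.
Proof.
move=> a0; rewrite (@esum_fibers _ _ _ [set c | (c < n.+1)%N] _ codim) //; last first.
  by move=> Lam lL; rewrite /= ltnS; exact: codim_le.
rewrite esum_fset //; last by move=> c _; exact: esum_ge0.
by rewrite -fsbig_ord.
Qed.

Lemma phi_sum : (\esum_(Lam in [set Lam : set 'rV[o]_n | lattice Lam]) (phi m s Lam)%:E =
  \sum_(c < n.+1) Gsum c)%E.
Proof. by rewrite esum_codim // => Lam; rewrite lee_fin phi_ge0. Qed.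

Lemma Gsum0 : Gsum 0 = 1%:E.
Proof.
rewrite /Gsum (_ : [set Lam : set 'rV[o]_n | _] = [set setT]); last first.
  apply/seteqP; split => [Lam [lL /(codim0 lL)]//|_ ->].
  by split; [exact: lattice_setT|apply/codim0 => //; exact: lattice_setT].
rewrite esum_set1 ?lee_fin ?phi_ge0 // /phi centraliserT.
by rewrite !(has_index_coset (has_index_setT _)).2 !powR1 mulr1.
Qed.

(** The number of lattices of invariant [c] over a given colon lattice of invariant
    [c']. *)
Definition gtrans (c' c : nat) : R :=
  if (c' <= c)%N then gcoef q%:R c' (n - c') (c - c') else 0.

Lemma gtrans_ge0 c' c : 0 <= gtrans c' c.
Proof. by rewrite /gtrans; case: ifP => // _; rewrite gcoef_ge0 // ler0n. Qed.

Lemma xwt_ge0 c : 0 <= xwt c. Proof. by rewrite mulr_ge0 ?powR_ge0. Qed.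

Lemma colon_fibre (Lam : set 'rV[o]_n) (c : nat) : (c <= n)%N -> lattice Lam ->
  (\esum_(K in [set K | (lattice K /\ codim K = c) /\ colon D K = Lam]) (phi m s K)%:E =
   (xwt c * gtrans (codim Lam) c * phi m s Lam)%:E)%E.
Proof.
move=> cn lL; have [J [A ech]] := echelon_ex D lL.1.
pose w N : R := (N == coset_index Lam * q ^ c)%N%:R * (xwt c * phi m s Lam).
have w0 N : 0 <= w N by rewrite mulr_ge0 ?ler0n // mulr_ge0 ?xwt_ge0 ?phi_ge0.
have q0 := q_gt1 F.
have iL : (0 < coset_index Lam)%N by exact: lattice_index_gt0.
transitivity (\esum_(K in [set K | lattice K /\ colon D K = Lam]) (w (coset_index K))%:E)%E.
  rewrite (_ : [set K | (lattice K /\ codim K = c) /\ colon D K = Lam] =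
    [set K | [set K | lattice K /\ colon D K = Lam] K /\ codim K = c]); last first.
    by apply/seteqP; split => K [[? ?] ?].
  rewrite -esum_if; apply: eq_esum => K [lK cK].
  rewrite /w (codim_index lK) cK mulnC eqn_pmul2l // eqn_exp2l //.
  case: eqP => [e|ne]; first by rewrite asboolT // (phi_layer lK) e cK mul1r.
  by rewrite asboolF // mul0r.
rewrite (fibre_sum lL ech w0) (codimE lL ech); congr EFin.
have cardJ : #|~: J| = (n - #|J|)%N by rewrite cardsCs finset.setCK card_ord.
have Jn : (#|J| <= n)%N by rewrite -[X in (_ <= X)%N]card_ord max_card.
rewrite cardJ /gtrans; case: leqP => [Jc|cJ]; last first.
  rewrite mulr0 mul0r big1 // => j _.
  rewrite /w eqn_pmul2l // eqn_exp2l // (_ : (_ == c) = false) ?mul0r ?mulr0 //.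
  by apply/negbTE; rewrite gtn_eqF // (leq_trans cJ) // leq_addr.
have lt : (c - #|J| < (n - #|J|).+1)%N by rewrite ltnS leq_sub2r.
rewrite (bigD1 (Ordinal lt)) //= big1 ?addr0 => [|j jn].
  by rewrite /w subnKC // eqxx mul1r mulrA [gcoef _ _ _ _ * _]mulrC.
rewrite /w eqn_pmul2l // eqn_exp2l // (_ : (_ == c) = false) ?mul0r ?mulr0 //.
apply/negbTE; apply: contra jn => /eqP jc; apply/eqP/val_inj => /=.
by rewrite -jc addKn.
Qed.

(** Sort the lattices of invariant [c] by their colon lattice. *)
Lemma Gsum_rec (c : nat) : (c <= n)%N ->
  (Gsum c = \sum_(c' < n.+1) (xwt c * gtrans c' c)%:E * Gsum c')%E.
Proof.
move=> cn; rewrite {1}/Gsum.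
rewrite (@esum_fibers _ _ _ [set Lam : set 'rV[o]_n | lattice Lam] _ (fun K : set 'rV[o]_n => colon D K)); last 2 first.
- by move=> K [lK _]; exact: lattice_colon.
- by move=> K; rewrite lee_fin phi_ge0.
rewrite (@eq_esum _ _ _ _ (fun Lam => (xwt c * gtrans (codim Lam) c * phi m s Lam)%:E)%E); last first.
  by move=> Lam lL; exact: colon_fibre.
have ge0 Lam : (0 <= (xwt c * gtrans (codim Lam) c * phi m s Lam)%:E)%E.
  by rewrite lee_fin !mulr_ge0 ?xwt_ge0 ?gtrans_ge0 ?phi_ge0.
rewrite esum_codim //; apply: eq_bigr => c' _.
rewrite -esumZl; last 2 first.
- by rewrite mulr_ge0 ?xwt_ge0 ?gtrans_ge0.
- by move=> Lam; rewrite lee_fin phi_ge0.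
by apply: eq_esum => Lam [_ ->].
Qed.

(** Convergence follows by comparison with the sum of [|Z : Lam| ^ (d - s)], which
    [trace_sum] computes. *)
Lemma Gsum_fin c : (n + d)%:R < s -> Gsum c \is a fin_num.
Proof.
move=> ds; rewrite ge0_fin_numE ?Gsum_ge0 //.
apply: (@le_lt_trans _ _ (\esum_(Lam in [set Lam : set 'rV[o]_n | lattice Lam]) (phi m s Lam)%:E)%E).
  rewrite esum_codim; last by move=> Lam; rewrite lee_fin phi_ge0.
  have [cn|cn] := leqP c n.
    rewrite -ltnS in cn; rewrite (bigD1 (Ordinal cn)) //= leeDl //.
    by apply: sume_ge0 => i _; exact: Gsum_ge0.
  rewrite /Gsum (_ : [set Lam | _] = set0).
    by rewrite esum_set0; apply: sume_ge0 => i _; exact: Gsum_ge0.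
  apply/seteqP; split => // Lam [lL cL]; have := codim_le lL.
  by rewrite cL leqNgt cn.
pose Z : lmodType o := 'rV[o]_0.
have lZ : lattice [set: Z] by exact: lattice_setT.
have ns : n%:R < (s - d%:R) + 1 :> R by move: ds; rewrite natrD => *; lra.
have S := trace_sum D lZ ns.
pose a (J : set ('rV[o]_n * Z)) : \bar R :=
  (if `[< trace J = setT >] then weight (s - d%:R) J else 0)%E.
have traceT (J : set ('rV[o]_n * Z)) : lattice J -> trace J = setT.
  by move=> lJ; apply/seteqP; split => // z _; rewrite /trace /bottom /= (thinmx0 z); exact: (submod0 lJ.1).
apply: (@le_lt_trans _ _ (\esum_(J in [set J : set ('rV[o]_n * Z) | lattice J]) a J)%E); last first.
  by rewrite S ltry.
rewrite [leRHS](@esum_can _ _ _ [set Lam : set 'rV[o]_n | lattice Lam] _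
   (fun Lam => (fst @^-1` Lam : set ('rV[o]_n * Z)))
   (fun J => [set v | J (v, 0)])) /=.
- apply: le_esum => Lam /= lL; rewrite /a traceT; last exact: lattice_preim.
  rewrite asboolT // /weight /phi lee_fin opprB.
  have -> : coset_index (fst @^-1` Lam : set ('rV[o]_n * Z)) = coset_index Lam.
    have lf : lattice (fst @^-1` Lam : set ('rV[o]_n * Z)) by exact: lattice_preim.
    apply: (has_index_uniq (V := 'rV[o]_n) (I := Lam)); last exact: lattice_index.
    rewrite -[coset_index _]mul1n.
    apply: (index_split (th := (fst : {linear ('rV[o]_n * Z)%type -> 'rV[o]_n}))).
    - exact: submod_subgrp lL.1.
    - exact: lattice_index lf.
    rewrite (_ : sum_im _ _ = setT); first exact: has_index_setT.
    apply/seteqP; split => // v _; exists (v, 0) => /=; rewrite subrr.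
    exact: (submod0 lL.1).
  rewrite ler_piMr ?powR_ge0 //; set N := coset_index _.
  rewrite -[leRHS](powRr0 (N%:R : R)) ler_powR //.
    by rewrite ler1n /N; exact/lattice_index_gt0/(lattice_centraliser D hm lL).
  by rewrite oppr_le0; move: ds; rewrite natrD => h; have := ler0n R n; have := ler0n R d; lra.
- by move=> Lam lL; exact: lattice_preim.
- by move=> J lJ; exact: (lattice_preim (@top_part o n Z : {linear _ -> _})).
- by move=> Lam _; apply/seteqP; split.
- move=> J lJ; apply/seteqP; split => -[v z] /=; by rewrite (thinmx0 z).
Qed.

End Recursion.

(** * A recursion of Igusa type *)

Section Igusa.
Variable (A : comNzRingType).
Implicit Types (xp XX : nat -> A) (gt : nat -> nat -> A).

(** The list of the numerators [igusaM 0], ..., [igusaM c], so that each of them may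
    refer to all the previous ones. *)
Fixpoint igusa_seq xp gt XX (c : nat) : seq A :=
  if c is c'.+1 then
    let s := igusa_seq xp gt XX c' in
    rcons s (xp c * \sum_(i < c) gt i c * s`_i * \prod_(i.+1 <= j < c) (1 - XX j))
  else [:: 1].

(** [igusaM c] is the numerator of the [c]-th unknown of the recursion solved in
    [igusa_solve], over the denominator [(1 - XX 1) ... (1 - XX c)]. It is defined
    without division, so that it can be evaluated in any commutative ring. *)
Definition igusaM xp gt XX (c : nat) : A := (igusa_seq xp gt XX c)`_c.

Definition igusaN xp gt XX (n : nat) : A :=
  \sum_(c < n.+1) igusaM xp gt XX c * \prod_(c.+1 <= j < n.+1) (1 - XX j).

Lemma size_igusa_seq xp gt XX c : size (igusa_seq xp gt XX c) = c.+1.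
Proof. by elim: c => //= c IH; rewrite size_rcons IH. Qed.

Lemma nth_igusa_seq xp gt XX c i : (i <= c)%N ->
  (igusa_seq xp gt XX c)`_i = igusaM xp gt XX i.
Proof.
elim: c => [|c IH] ic; first by rewrite /igusaM; case: i ic.
case: (ltngtP i c.+1) ic => // [ic _|-> //].
by rewrite /= nth_rcons size_igusa_seq ic IH.
Qed.

Lemma igusaM0 xp gt XX : igusaM xp gt XX 0 = 1. Proof. by []. Qed.

Lemma igusaMS xp gt XX c : (0 < c)%N -> igusaM xp gt XX c =
  xp c * \sum_(i < c) gt i c * igusaM xp gt XX i * \prod_(i.+1 <= j < c) (1 - XX j).
Proof.
case: c => // c _; rewrite {1}/igusaM /= nth_rcons size_igusa_seq ltnn eqxx.
by congr (_ * _); apply: eq_bigr => i _; rewrite nth_igusa_seq // -ltnS.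
Qed.

Lemma eq_igusaM xp gt XX xp' gt' XX' n :
    (forall c, (0 < c <= n)%N -> xp c = xp' c) ->
    (forall i c, (i < c <= n)%N -> gt i c = gt' i c) ->
    (forall c, (0 < c <= n)%N -> XX c = XX' c) ->
  forall c, (c <= n)%N -> igusaM xp gt XX c = igusaM xp' gt' XX' c.
Proof.
move=> ex eg eX c; elim/ltn_ind: c => c IH cn; case: (posnP c) => [->//|c0].
rewrite !igusaMS // ex ?c0 //; congr (_ * _); apply: eq_bigr => i _.
rewrite eg ?ltn_ord // IH ?ltn_ord ?(leq_trans (ltnW (ltn_ord i))) //; congr (_ * _).
apply: eq_big_nat => j /andP[ij jc]; rewrite eX //.
by rewrite (leq_ltn_trans _ ij) // (leq_trans (ltnW jc)).
Qed.

Lemma eq_igusaN xp gt XX xp' gt' XX' n :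
    (forall c, (0 < c <= n)%N -> xp c = xp' c) ->
    (forall i c, (i < c <= n)%N -> gt i c = gt' i c) ->
    (forall c, (0 < c <= n)%N -> XX c = XX' c) ->
  igusaN xp gt XX n = igusaN xp' gt' XX' n.
Proof.
move=> ex eg eX; apply: eq_bigr => c _.
rewrite (eq_igusaM ex eg eX) -1?ltnS //; congr (_ * _).
apply: eq_big_nat => j /andP[ij jc]; rewrite eX //.
by rewrite (leq_ltn_trans _ ij).
Qed.

End Igusa.

Lemma igusaM_rmorph (A B : comNzRingType) (f : {rmorphism A -> B}) xp gt XX c :
  f (igusaM xp gt XX c) =
  igusaM (f \o xp) (fun i j => f (gt i j)) (f \o XX) c.
Proof.
elim/ltn_ind: c => c IH; case: (posnP c) => [->|c0]; first by rewrite !igusaM0 rmorph1.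
rewrite !igusaMS // rmorphM rmorph_sum; congr (_ * _); apply: eq_bigr => i _.
rewrite !rmorphM IH // rmorph_prod; congr (_ * _); apply: eq_bigr => j _.
by rewrite rmorphB rmorph1.
Qed.

Lemma igusaN_rmorph (A B : comNzRingType) (f : {rmorphism A -> B}) xp gt XX n :
  f (igusaN xp gt XX n) =
  igusaN (f \o xp) (fun i j => f (gt i j)) (f \o XX) n.
Proof.
rewrite rmorph_sum; apply: eq_bigr => c _.
rewrite rmorphM igusaM_rmorph rmorph_prod; congr (_ * _); apply: eq_bigr => j _.
by rewrite rmorphB rmorph1.
Qed.

(** The term [i = c] of the recursion is [XX c * G c]; moving it to the left shows that
    [G c] has denominator [1 - XX c]. *)
Lemma igusa_solve (K : fieldType) (xp XX : nat -> K) (gt : nat -> nat -> K) n (G : nat -> K) :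
    (forall c, (0 < c <= n)%N -> XX c = xp c * gt c c) ->
    (forall c, (0 < c <= n)%N -> 1 - XX c != 0) ->
    G 0%N = 1 ->
    (forall c, (0 < c <= n)%N -> G c = xp c * \sum_(i < c.+1) gt i c * G i) ->
  \sum_(c < n.+1) G c = igusaN xp gt XX n / \prod_(1 <= j < n.+1) (1 - XX j).
Proof.
move=> XE Xn0 G0 Grec.
have prod_n0 c : (c <= n)%N -> \prod_(1 <= j < c.+1) (1 - XX j) != 0.
  move=> cn; rewrite prodf_seq_neq0; apply/allP => j.
  rewrite mem_index_iota => /andP[j0 jc] /=.
  by apply: Xn0; rewrite j0 (leq_trans _ cn).
have GM c : (c <= n)%N -> igusaM xp gt XX c = G c * \prod_(1 <= j < c.+1) (1 - XX j).
  elim/ltn_ind: c => c IH cn; case: (posnP c) => [->|c0].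
    by rewrite igusaM0 G0 big_nil mul1r.
  have cn' : (0 < c <= n)%N by rewrite c0.
  rewrite igusaMS // (big_nat_recr c) //= mulrCA [G c * _]mulrC mulrBl mul1r.
  have -> : G c - XX c * G c = xp c * \sum_(i < c) gt i c * G i.
    by rewrite {1}Grec // big_ord_recr /= mulrDr mulrA -XE // addrK.
  rewrite mulrCA; congr (_ * _); rewrite mulr_sumr; apply: eq_bigr => i _.
  rewrite IH // ?(leq_trans (ltnW (ltn_ord i))) //.
  rewrite [in RHS](big_cat_nat (n := i.+1)) //=.
  by rewrite /=; ring.
apply: (canRL (mulfK (prod_n0 n (leqnn n)))); rewrite mulr_suml.
apply: eq_bigr => c _; have cn : (c <= n)%N by rewrite -ltnS.
by rewrite GM // [in LHS](big_cat_nat (n := c.+1)) //= mulrA.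
Qed.

(** * The numerical invariants *)
Section Numbers.
Variables (m n : nat).
Hypotheses (hm : (0 < m)%N) (hn : (0 < n)%N).

Lemma e_numE j : (0 < j)%N -> e_num m j = 'C((j + m.-1).-1, m.-1).
Proof.
case: j => // j _; rewrite /e_num; case: m hm => //= m' _.
have -> : (j.+1 + m'.+1 - 2 = j + m')%N by lia.
by rewrite subn1 /= -bin_sub ?leq_addr // addKn.
Qed.

Lemma f_numE : f_num m n = 'C((n + m).-1, m).
Proof.
rewrite /f_num -subn1; case: n hn => // n' _.
by rewrite addSn !subn1 /= -bin_sub ?leq_addr // addKn.
Qed.

(** Hockey stick identity. *)
Lemma sum_e_num r k : (r <= k)%N ->
  (\sum_(r.+1 <= j < k.+1) e_num m j + 'C((r + m).-1, m) = 'C((k + m).-1, m))%N.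
Proof.
elim: k => [|k IH]; first by rewrite leqn0 => /eqP ->; rewrite big_geq.
case: (ltngtP r k.+1) => // [rk _|-> _]; last by rewrite big_geq.
rewrite big_nat_recr //= addnAC IH // e_numE //.
case: m hm => //= m' _; rewrite ?addSn ?addnS /=.
by rewrite binS.
Qed.

Lemma card_basis : #|{: weak_comp n m.-1 + weak_comp n m}| = d_num m n.
Proof. by rewrite card_sum !card_wc /d_num f_numE e_numE. Qed.

(** The exponent [c] of the layer and the size of the set [touched] add up to
    [b_(n - c)], by the hockey stick identity. *)
Lemma touched_b c : (0 < c <= n)%N -> (c + touched_card m n c)%N = b_num m n (n - c).
Proof.
move=> /andP[c0 cn]; rewrite /touched_card /b_num subKn // -lt0n c0 mul1n !card_wc.
rewrite -(sum_e_num (leq_subr c n)) addnK e_numE //.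
by rewrite addnA.
Qed.

Lemma b_num0 : b_num m n 0 = h_num m n.
Proof.
rewrite /b_num /h_num /d_num subn0 f_numE -(sum_e_num (leq0n n)) add0n.
by rewrite [X in (_ = _ + (_ + X) + _)%N]bin_small ?prednK // addn0; lia.
Qed.

Lemma e_num_gt0 j : (0 < j)%N -> (0 < e_num m j)%N.
Proof. by move=> j0; rewrite e_numE // bin_gt0; case: j j0 => //= j _; rewrite leq_addl. Qed.

Lemma b_num_gt0 i : (i < n)%N -> (0 < b_num m n i)%N.
Proof. by move=> ni; rewrite /b_num -addnA addn_gt0 subn_gt0 ni. Qed.

Lemma b_num_dec i j : (i < j <= n)%N -> (b_num m n j < b_num m n i)%N.
Proof.
move=> /andP[ij jn]; rewrite /b_num (big_cat_nat (n := j.+1) (m := i.+1)) ?ltnS //=; last exact: ltnW.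
have : (n - j < n - i)%N by rewrite ltn_sub2l // (leq_trans ij).
lia.
Qed.

Lemma d_num_gt0 : (0 < d_num m n)%N.
Proof. by rewrite /d_num addn_gt0 e_num_gt0. Qed.

Lemma a_numE c : (c <= n)%N -> a_num m n (n - c) = (c * (n - c) + c * d_num m n)%N.
Proof. by move=> cn; rewrite /a_num subKn // mulnDr. Qed.

End Numbers.

(** * Closed form of the ideal zeta function *)
Section ZetaPolynomials.
Variables (m n : nat) (A : comNzRingType) (X Y : A).

(** The data of the recursion for the sums over lattices with [X] for [q] and [Y] for
    [q ^ (- s)]. As polynomial expressions they make sense in every commutative ring,
    in particular for [X = 1]. *)
Definition zeta_x (c : nat) : A := X ^+ (c * d_num m n) * Y ^+ b_num m n (n - c).
Definition zeta_g (i c : nat) : A := gcoef X i (n - i) (c - i).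
Definition zeta_X (c : nat) : A := X ^+ a_num m n (n - c) * Y ^+ b_num m n (n - c).
Definition zeta_num : A := igusaN zeta_x zeta_g zeta_X n.
Definition zeta_den : A :=
  (\prod_(j < d_num m n) (1 - X ^+ j * Y)) * \prod_(1 <= c < n.+1) (1 - zeta_X c).

Lemma zeta_XE c : (0 < c <= n)%N -> zeta_X c = zeta_x c * zeta_g c c.
Proof.
move=> /andP[_ cn]; rewrite /zeta_X /zeta_x /zeta_g subnn gcoef0 a_numE // exprD.
by ring.
Qed.

End ZetaPolynomials.

Lemma zeta_num_rmorph (A B : comNzRingType) (f : {rmorphism A -> B}) m n X Y :
  f (zeta_num m n X Y) = zeta_num m n (f X) (f Y).
Proof.
rewrite igusaN_rmorph; apply: eq_igusaN => [c _|i c _|c _] /=.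
- by rewrite rmorphM !rmorphXn.
- exact: gcoef_rmorph.
- by rewrite rmorphM !rmorphXn.
Qed.

Lemma zeta_den_rmorph (A B : comNzRingType) (f : {rmorphism A -> B}) m n X Y :
  f (zeta_den m n X Y) = zeta_den m n (f X) (f Y).
Proof.
rewrite rmorphM !rmorph_prod; congr (_ * _); apply: eq_bigr => j _.
  by rewrite rmorphB rmorph1 rmorphM rmorphXn.
by rewrite rmorphB rmorph1 rmorphM !rmorphXn.
Qed.

Section ZetaClosedForm.
Variables (F : finFieldType) (o : idomainType) (D : split_dvr F o) (R : realType).
Local Notation q := #|F|.
Variables (m n : nat) (s : R).
Hypotheses (hm : (0 < m)%N) (hn : (0 < n)%N).
Hypothesis hs : (n + d_num m n)%:R < s.
Let y : R := q%:R `^ (- s).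
Let q1 : 1 < q%:R :> R. Proof. by rewrite ltr1n; exact: q_gt1. Qed.
Let q0 : 0 < q%:R :> R. Proof. exact: lt_trans q1. Qed.

Let qy k l : (k%:R < s * l%:R) -> q%:R ^+ k * y ^+ l < 1 :> R.
Proof.
move=> kl; rewrite -powR_mulrn ?ltW // -[y ^+ l]powR_mulrn ?powR_ge0 // -powRrM.
have q00 : q%:R != 0 :> R by rewrite gt_eqF.
rewrite -powRD ?q00 ?implybT // mulNr -opprB.
by apply: powR_lt1 => //; rewrite subr_gt0.
Qed.

Lemma xwt_zeta c : (0 < c <= n)%N -> xwt F m n s c = zeta_x m n q%:R y c.
Proof.
move=> cn; rewrite /xwt /zeta_x card_basis // -touched_b //.
have q00 : q%:R != 0 :> R by rewrite gt_eqF.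
have ge0 k : 0 <= (q%:R : R) ^+ k by rewrite exprn_ge0 // ltW.
have pw k t : ((q%:R : R) ^+ k) `^ t = (q%:R `^ t) ^+ k.
  by rewrite -powR_mulrn ?ltW // powRAC powR_mulrn ?powR_ge0.
rewrite !pw powRD ?q00 ?implybT // powR_mulrn ?ltW //.
by rewrite exprMn -exprM mulnC exprD mulrA.
Qed.

Lemma zeta_X_lt1 c : (0 < c <= n)%N -> 1 - zeta_X m n q%:R y c != 0.
Proof.
move=> /andP[c0 cn]; rewrite subr_eq0 eq_sym lt_eqF //; apply: qy.
have cb : (c <= b_num m n (n - c))%N by rewrite -touched_b ?c0 // leq_addr.
have s0 : 0 < s by apply: le_lt_trans hs; rewrite ler0n.
apply: (@lt_le_trans _ _ (s * c%:R)); last by rewrite ler_pM2l // ler_nat.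
rewrite /a_num subKn // natrM mulrC ltr_pM2r ?ltr0n //.
by apply: le_lt_trans hs; rewrite ler_nat leq_add2r leq_subr.
Qed.

Lemma zeta_closed_form :
  zeta_den m n q%:R y != 0 /\
  ideal_zeta m n o s = (zeta_num m n q%:R y / zeta_den m n q%:R y)%:E.
Proof.
have s0 : 0 < s by apply: le_lt_trans hs; rewrite ler0n.
have P1 : \prod_(j < d_num m n) (1 - q%:R ^+ j * y) != 0.
  apply/prodf_neq0 => j _; rewrite subr_eq0 eq_sym lt_eqF // -[y]expr1; apply: qy.
  rewrite mulr1; apply: lt_trans hs; rewrite ltr_nat.
  by rewrite (leq_trans (ltn_ord j)) // leq_addl.
have P2 : \prod_(1 <= c < n.+1) (1 - zeta_X m n q%:R y c) != 0.
  rewrite prodf_seq_neq0; apply/allP => c.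
  by rewrite mem_index_iota => cn /=; apply: zeta_X_lt1.
split; first by rewrite mulf_neq0.
have ds : #|{: weak_comp n m.-1 + weak_comp n m}|%:R < s + 1 :> R.
  rewrite card_basis //; apply: (lt_trans _ (_ : s < s + 1)); last by rewrite ltrDl.
  by apply: le_lt_trans hs; rewrite ler_nat leq_addl.
rewrite (ideal_zeta_sum D hm ds) (phi_sum D m n s).
have hs' : (n + #|{: weak_comp n m.-1 + weak_comp n m}|)%:R < s by rewrite card_basis.
pose G c : R := fine (Gsum D m n s c).
have GE c : Gsum D m n s c = (G c)%:E by rewrite /G fineK //; exact: Gsum_fin.
rewrite [X in (_ * X)%E](eq_bigr (fun c : 'I_n.+1 => (G c)%:E)) => [|c _]; last exact: GE.
rewrite sumEFin -EFinM; congr EFin.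
rewrite (@igusa_solve _ (zeta_x m n q%:R y) (zeta_X m n q%:R y) (zeta_g n q%:R) n G).
- rewrite -/(zeta_num m n q%:R y) /zeta_den invfM mulrCA; congr (_ * (_ * _)).
  rewrite card_basis // -prodfV; apply: eq_bigr => j _; congr (1 - _)^-1.
  have q00 : q%:R != 0 :> R by rewrite gt_eqF.
  by rewrite powRD ?q00 ?implybT // powR_mulrn // ltW.
- exact: zeta_XE.
- exact: zeta_X_lt1.
- by rewrite /G Gsum0.
move=> c /andP[c0 cn]; rewrite /G (Gsum_rec D hm s cn).
under eq_bigr do rewrite GE -EFinM.
rewrite sumEFin /= -xwt_zeta ?c0 //.
rewrite (bigID (fun i : 'I_n.+1 => (i <= c)%N)) /= [X in _ + X]big1 ?addr0 => [|i]; last first.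
  by rewrite /gtrans => /negbTE ->; rewrite mulr0 mul0r.
rewrite (big_ord_narrow_leq cn) /= mulr_sumr.
by apply: eq_bigr => i _; rewrite /gtrans /= -ltnS ltn_ord mulrA.
Qed.

End ZetaClosedForm.

(** * Formal power series *)

(** Coefficient sequences; the same type serves for the discrete valuation rings and
    for the Laurent expansions in [q - 1]. *)
Definition pseries (K : fieldType) : Type := nat -> K.
HB.instance Definition _ (K : fieldType) := GRing.Zmodule.on (pseries K).

Section PowerSeries.
Variable K : fieldType.
Local Notation S := (pseries K).

Definition ps_trunc (N : nat) (f : S) : {poly K} := \poly_(i < N) f i.
Definition ps_one : S := fun k => (k == 0%N)%:R.
Definition ps_mul (f g : S) : S := fun k => \sum_(i < k.+1) f i * g (k - i)%N.

Lemma ps_truncE N (f : S) k : (k < N)%N -> (ps_trunc N f)`_k = f k.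
Proof. by move=> kN; rewrite coef_poly kN. Qed.

Lemma ps_mulE N f g k : (k < N)%N -> ps_mul f g k = (ps_trunc N f * ps_trunc N g)`_k.
Proof.
move=> kN; rewrite coefM; apply: eq_bigr => i _; rewrite !ps_truncE //.
  by rewrite (leq_ltn_trans _ kN) // leq_subr.
by rewrite (leq_ltn_trans _ kN) // -ltnS.
Qed.

(** This transfers the ring axioms from polynomials: up to any given order, the
    product of series is the product of truncations. *)
Lemma coefM_trunc (A : nzRingType) N (p p' r r' : {poly A}) :
    (forall k, (k < N)%N -> p`_k = p'`_k) -> (forall k, (k < N)%N -> r`_k = r'`_k) ->
  forall k, (k < N)%N -> (p * r)`_k = (p' * r')`_k.
Proof.
move=> pp rr k kN; rewrite !coefM; apply: eq_bigr => i _; rewrite pp ?rr //.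
  by rewrite (leq_ltn_trans _ kN) // leq_subr.
by rewrite (leq_ltn_trans _ kN) // -ltnS.
Qed.

Lemma ps_trunc_mul N f g k : (k < N)%N ->
  (ps_trunc N (ps_mul f g))`_k = (ps_trunc N f * ps_trunc N g)`_k.
Proof. by move=> kN; rewrite ps_truncE // (ps_mulE _ _ kN). Qed.

Lemma ps_mulA : associative ps_mul.
Proof.
move=> f g h; apply/funext => k; rewrite !(ps_mulE _ _ (ltnSn k)).
rewrite (@coefM_trunc _ k.+1 _ (ps_trunc k.+1 f) _ (ps_trunc k.+1 g * ps_trunc k.+1 h)) //; last first.
  by move=> i; exact: ps_trunc_mul.
rewrite mulrA; apply/esym; apply: (@coefM_trunc _ k.+1) => // i; exact: ps_trunc_mul.
Qed.

Lemma ps_mulC : commutative ps_mul.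
Proof. by move=> f g; apply/funext => k; rewrite !(ps_mulE _ _ (ltnSn k)) mulrC. Qed.

Lemma ps_mul1 : left_id ps_one ps_mul.
Proof.
move=> f; apply/funext => k; rewrite /ps_mul big_ord_recl subn0 /ps_one mul1r big1 ?addr0 //.
by move=> i _; rewrite mul0r.
Qed.

Lemma ps_mulDl : left_distributive ps_mul +%R.
Proof.
move=> f g h; apply/funext => k; rewrite /ps_mul -[RHS]big_split /=.
by apply: eq_bigr => i _; rewrite -mulrDl.
Qed.

Lemma ps_one_neq0 : ps_one != 0 :> S.
Proof.
apply/eqP => /(congr1 (fun f : S => f 0%N)) /eqP.
by rewrite /ps_one oner_eq0.
Qed.

HB.instance Definition _ :=
  GRing.Zmodule_isComNzRing.Build S ps_mulA ps_mulC ps_mul1 ps_mulDl ps_one_neq0.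

Lemma psM (f g : S) k : (f * g : S) k = \sum_(i < k.+1) f i * g (k - i)%N.
Proof. by []. Qed.
Lemma psD (f g : S) k : (f + g : S) k = f k + g k. Proof. by []. Qed.
Lemma psN (f : S) k : (- f : S) k = - f k. Proof. by []. Qed.
Lemma ps0 k : (0 : S) k = 0. Proof. by []. Qed.
Lemma ps1 k : (1 : S) k = (k == 0%N)%:R. Proof. by []. Qed.
Lemma psM0 (f g : S) : (f * g : S) 0%N = f 0%N * g 0%N.
Proof. by rewrite psM big_ord1. Qed.

Lemma psP (f g : S) : (forall k, f k = g k) -> f = g.
Proof. exact: funext. Qed.

(** Leading coefficients multiply; in particular there are no zero divisors. *)
Lemma psM_lead (f g : S) a b : (forall i, (i < a)%N -> f i = 0) ->
  (forall i, (i < b)%N -> g i = 0) ->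
  (forall i, (i < a + b)%N -> (f * g : S) i = 0) /\ (f * g : S) (a + b)%N = f a * g b.
Proof.
move=> fa gb; split => [i iab|].
  rewrite psM big1 // => j _; have [ja|aj] := ltnP j a; first by rewrite fa ?mul0r.
  rewrite [g _]gb ?mulr0 // ltn_subLR; last by rewrite -ltnS.
  by rewrite (leq_trans iab) // leq_add2r.
have lt : (a < (a + b).+1)%N by rewrite ltnS leq_addr.
rewrite psM (bigD1 (Ordinal lt)) //= addKn big1 ?addr0 // => j ja.
have : (j != a :> nat) by apply: contra ja => /eqP ja; apply/eqP/val_inj.
rewrite neq_ltn => /orP[ja'|aj]; first by rewrite fa ?mul0r.
by rewrite [g _]gb ?mulr0 // ltn_subLR ?ltn_add2r // -ltnS.
Qed.

Lemma ps_lead (f : S) : f != 0 -> exists2 a, f a != 0 & forall i, (i < a)%N -> f i = 0.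
Proof.
move=> f0; have ex : exists a, f a != 0.
  apply: contrapT => h; case/eqP: f0; apply: psP => k; apply/eqP/negPn/negP => fk.
  by apply: h; exists k.
case: (ex_minnP ex) => a fa amin; exists a => // i ia.
by apply/eqP/negPn/negP => /amin; rewrite leqNgt ia.
Qed.

Lemma ps_integral (f g : S) : f * g = 0 -> (f == 0) || (g == 0).
Proof.
move=> fg; apply/orP; case: (eqVneq f 0) => [_|/ps_lead[a fa fl]]; first by left.
case: (eqVneq g 0) => [_|/ps_lead[b gb gl]]; first by right.
have [_] := psM_lead fl gl; rewrite fg ps0 => /esym/eqP.
by rewrite mulf_eq0 (negPf fa) (negPf gb).
Qed.

(** The sum of all powers of [g], for [g] without constant term: the [k]-th coefficient
    only involves the powers up to [k]. *)
Definition ps_geom (g : S) : S := fun k => (\sum_(i < k.+1) g ^+ i : S) k.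

Lemma ps_exp_lead (g : S) i k : g 0%N = 0 -> (k < i)%N -> (g ^+ i : S) k = 0.
Proof.
move=> g0; elim: i k => [|i IH] k // ki; rewrite exprS.
have g1 j : (j < 1)%N -> g j = 0 by case: j.
have [h _] := @psM_lead g (g ^+ i) 1 i g1 (fun j ji => IH j ji).
by apply: h; rewrite add1n.
Qed.

Lemma ps_sumE (I : Type) (r : seq I) (P : pred I) (f : I -> S) k :
  (\sum_(i <- r | P i) f i : S) k = \sum_(i <- r | P i) f i k.
Proof. by elim/big_rec2: _ => // i x y _ <-. Qed.

Lemma ps_geomE (g : S) N k : g 0%N = 0 -> (k < N)%N -> ps_geom g k = (\sum_(i < N) g ^+ i : S) k.
Proof.
move=> g0 kN; rewrite /ps_geom !ps_sumE; pose h (i : nat) : K := (g ^+ i : S) k.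
have h0 i : (k < i)%N -> h i = 0 by move=> ki; exact: ps_exp_lead.
change (\sum_(i < k.+1) h i = \sum_(i < N) h i); clearbody h.
rewrite (big_ord_widen N h) // [RHS](bigID (fun i : 'I_N => (i < k.+1)%N)) /=.
by rewrite [X in _ + X]big1 ?addr0 // => i; rewrite -leqNgt => /h0.
Qed.

Lemma ps_geom_inv (g : S) : g 0%N = 0 -> (1 - g) * ps_geom g = 1.
Proof.
move=> g0; apply: psP => k.
have -> : ((1 - g) * ps_geom g : S) k = ((1 - g) * \sum_(i < k.+1) g ^+ i : S) k.
  rewrite !psM; apply: eq_bigr => i _; congr (_ * _).
  by apply: ps_geomE => //; rewrite ltnS leq_subr.
by rewrite -(opprB g) mulNr -subrX1 opprB psD psN ps_exp_lead // subr0.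
Qed.

Definition ps_const (a : K) : S := fun k => if k is 0 then a else 0.

Definition ps_unit : pred S := fun f => f 0%N != 0.
Definition ps_inv (f : S) : S :=
  if ps_unit f then ps_const (f 0%N)^-1 * ps_geom (1 - ps_const (f 0%N)^-1 * f) else f.

Lemma ps_mulVf : {in ps_unit, left_inverse 1 ps_inv *%R}.
Proof.
move=> f uf; have {}uf : ps_unit f := uf; rewrite /ps_inv uf.
set c := ps_const _; rewrite mulrAC -[X in X * _](subKr 1) ps_geom_inv //.
by rewrite psD psN psM0 ps1 /= mulVf // subrr.
Qed.

Lemma ps_unitP (f g : S) : g * f = 1 -> ps_unit f.
Proof.
move=> /(congr1 (fun h : S => h 0%N)); rewrite psM0 ps1 /= => gf.
by apply: contraNneq (oner_neq0 K) => f0; rewrite -[X in X == _]gf f0 mulr0.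
Qed.

Lemma ps_inv_out : {in [predC ps_unit], ps_inv =1 id}.
Proof. move=> f nf; have {}nf : ~~ ps_unit f := nf.
by rewrite /ps_inv (negPf nf). Qed.

HB.instance Definition _ :=
  GRing.ComNzRing_hasMulInverse.Build S ps_mulVf ps_unitP ps_inv_out.
HB.instance Definition _ := GRing.ComUnitRing_isIntegral.Build S ps_integral.

Fact ps_const_additive : zmod_morphism (ps_const).
Proof. by move=> a b; apply: psP => -[|k]; rewrite psD psN /= ?subr0. Qed.
HB.instance Definition _ := GRing.isZmodMorphism.Build K S (ps_const) ps_const_additive.

Fact ps_const_multiplicative : monoid_morphism (ps_const).
Proof.
split => [|a b]; apply: psP => -[|k] //=.
  by rewrite psM0.
rewrite psM big1 // => -[[|i] ilt] _ /=; rewrite ?mulr0 ?mul0r //.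
Qed.
HB.instance Definition _ := GRing.isMonoidMorphism.Build K S (ps_const) ps_const_multiplicative.

Definition ps_res (f : S) : K := f 0%N.

Fact ps_res_additive : zmod_morphism ps_res.
Proof. by move=> f g; rewrite /ps_res psD psN. Qed.
HB.instance Definition _ := GRing.isZmodMorphism.Build S K ps_res ps_res_additive.
Fact ps_res_multiplicative : monoid_morphism ps_res.
Proof. by split => [//|f g]; rewrite /ps_res psM0. Qed.
HB.instance Definition _ := GRing.isMonoidMorphism.Build S K ps_res ps_res_multiplicative.

Definition ps_var : S := fun k => (k == 1%N)%:R.

Lemma ps_varM f k : (ps_var * f : S) k = if k is k'.+1 then f k' else 0.
Proof.
case: k => [|k]; first by rewrite psM0 mul0r.
rewrite psM big_ord_recl /= mul0r add0r big_ord_recl /= mul1r subn1 /= big1 ?addr0 //.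
by move=> i _; rewrite mul0r.
Qed.

Lemma ps_var_expM f N k : (ps_var ^+ N * f : S) k = if (k < N)%N then 0 else f (k - N)%N.
Proof.
elim: N f k => [|N IH] f k; first by rewrite mul1r subn0.
rewrite exprSr -mulrA IH ltnS; case: (ltngtP k N) => // [Nk|->].
  by rewrite ps_varM -(subnSK Nk).
by rewrite ps_varM subnn.
Qed.

Lemma ps_shift (f : S) N : (forall i, (i < N)%N -> f i = 0) ->
  f = ps_var ^+ N * ((fun k => f (k + N)%N) : S).
Proof.
move=> fN; apply: psP => k; rewrite ps_var_expM.
by case: ltnP => [/fN//|Nk]; rewrite subnK.
Qed.

Lemma ps_unitE (f : S) : (f \is a GRing.unit) = (f 0%N != 0).
Proof. by []. Qed.

Lemma ps_val (f : S) : f != 0 -> exists (u : S) (k : nat), u \is a GRing.unit /\ f = u * ps_var ^+ k.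
Proof.
move=> /ps_lead[a fa fl]; exists (fun k => f (k + a)%N), a; split; first by rewrite ps_unitE.
by rewrite mulrC; exact: ps_shift.
Qed.

Lemma ps_var_neq0 : ps_var != 0.
Proof.
apply/eqP => /(congr1 (fun f : S => f 1%N))/eqP; rewrite /ps_var /= ps0.
by rewrite oner_eq0.
Qed.

End PowerSeries.
Arguments ps_var {K}.
Arguments ps_res {K}.

(** * Power series over a finite field *)
Section PowerSeriesDVR.
Variable F : finFieldType.
Local Notation S := (pseries F).

Definition ps_dvr : split_dvr F S.
Proof.
refine (@SplitDVR F S (@ps_const F) (@ps_res F) (@ps_var F) _ _ _ _ _).
- by move=> a.
- move=> f f0; exists (fun k => f k.+1); rewrite {1}(@ps_shift _ f 1) => [|[]//].
  by rewrite expr1; congr (_ * _); apply/funext => k; rewrite addn1.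
- by [].
- exact: ps_var_neq0.
- exact: ps_val.
Qed.

Lemma is_dvr_pseries : is_dvr S.
Proof.
exists ps_var; last exact: ps_val.
by split; [exact: ps_var_neq0|rewrite ps_unitE eqxx].
Qed.

Lemma residue_card_pseries : residue_card S = #|F|.
Proof.
rewrite /residue_card; apply: (has_index_coset _).2.
apply: (@has_index_finType S _ F (@ps_const F)).
- split => /= [|u v]; rewrite !ps_unitE !negbK; first by rewrite eqxx.
  by move=> /eqP u0 /eqP v0; rewrite psD psN u0 v0 subrr.
- by move=> f; exists (f 0%N); rewrite /= ps_unitE psD psN subrr eqxx.
- move=> a b; rewrite /= ps_unitE psD psN negbK subr_eq0 => /eqP //.
Qed.

(** An ultrafilter converges: as [F] is finite, it selects one value for each
    coefficient, and the series with these coefficients is a limit, because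
    neighbourhoods only restrict finitely many coefficients. *)
Lemma compact_pseries : compact [set: adic S].
Proof.
rewrite compact_ultra => U UU _.
have coef k : exists a : F, U [set f : S | f k = a].
  apply: contrapT => /forallNP na.
  have : U set0; last exact: filter_not_empty.
  have nU a : U (~` [set f : S | f k = a]) by case: (in_ultra_setVsetC [set f : S | f k = a] UU) => // /na.
  have h : U [set f : S | forall a, f k <> a] by exact: (@filter_forall (adic S) F (fun a => ~` [set f : adic S | (f : S) k = a]) U _ nU).
  by apply: filterS h => f /(_ (f k)).
pose x : adic S := fun k => projT1 (cid (coef k)).
have Ux k : U [set f : S | f k = x k] by rewrite /x; case: cid.
exists x; split => // B Bx; have {Bx} : nbhs (x : adic S) B := Bx.
rewrite nbhsE => -[V [oV Vx] VB].
apply: filterS VB _; have [a a0 aV] := oV x Vx.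
have [u [N [uu aE]]] := ps_val a0.
have UN : U [set f : S | forall i, (i < N)%N -> f i = x i].
  elim: N {aE} => [|N IHN]; first by apply: filterS filterT => f.
  apply: filterS (filterI IHN (Ux N)) => f [fN fx] i.
  by rewrite ltnS leq_eqVlt => /predU1P[->|/fN].
apply: filterS UN => f fN.
pose g : S := fun k => (f - x : S) (k + N)%N.
have fxE : (f : S) - x = ps_var ^+ N * g.
  by apply: ps_shift => i /fN fx; rewrite psD psN fx subrr.
have := aV (u^-1 * g); rewrite aE [u * _]mulrC -mulrA mulVKr // -fxE.
by rewrite addrC subrK.
Qed.

End PowerSeriesDVR.

(** * Descents of permutations *)

Section Descents.
Variables (A : comNzRingType) (z : nat -> A).

(** The position [j] is counted from 1, between the entries [j.-1] and [j]. *)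
Definition des_weight (w : seq nat) : A :=
  \prod_(1 <= j < size w) (if (nth 0%N w j < nth 0%N w j.-1)%N then z j else 1).

Definition z_ (i : nat) : A := if i is 0 then 1 else z i.

Lemma des_weight_rcons w x : (0 < size w)%N ->
  des_weight (rcons w x) = des_weight w * (if (x < last 0%N w)%N then z (size w) else 1).
Proof.
move=> w0; rewrite /des_weight size_rcons big_nat_recr //= nth_rcons ltnn eqxx.
congr (_ * _).
  apply: eq_big_nat => j /andP[j0 jw]; rewrite !nth_rcons jw.
  by rewrite (leq_ltn_trans (leq_pred j) jw).
by rewrite nth_rcons prednK // leqnn nth_last.
Qed.

(** The factor at [j] is [z j] at a descent and [1 = z j + (1 - z j)] at an ascent.
    Expand, and sort the terms by the last position [i] at which [z i] is chosen:
    all positions after [i] are ascents. *)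
Lemma des_weight_split w : uniq w -> (0 < size w)%N ->
  des_weight w = \sum_(i < size w) (sorted ltn (drop i w))%:R *
    (des_weight (take i w) * z_ i * \prod_(i.+1 <= j < size w) (1 - z j)).
Proof.
elim/last_ind: w => // w x IH; rewrite rcons_uniq => /andP[xw uw] _.
case: (posnP (size w)) => [/size0nil -> /=|w0].
  by rewrite big_ord1 /= /des_weight !big_geq // !mulr1.
rewrite des_weight_rcons // size_rcons big_ord_recr /=.
have dE : drop (size w) (rcons w x) = [:: x] by rewrite -cats1 drop_size_cat.
have tE : take (size w) (rcons w x) = w by rewrite -cats1 take_size_cat.
rewrite dE tE big_geq // mulr1 mul1r.
have lastx : last 0%N w != x.
  apply: contraNneq xw => <-; case: w w0 {IH uw dE tE} => //= y w _.
  exact: mem_last.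
have zE : z_ (size w) = z (size w) by case: (size w) w0.
rewrite (eq_bigr (fun i : 'I_(size w) => (last 0%N w < x)%N%:R * (1 - z (size w)) *
   ((sorted ltn (drop i w))%:R *
    (des_weight (take i w) * z_ i * \prod_(i.+1 <= j < size w) (1 - z j))))); last first.
  move=> i _; have iw := ltn_ord i.
  rewrite -cats1 drop_cat iw take_cat iw big_nat_recr //=.
  have dw : (0 < size (drop i w))%N by rewrite size_drop subn_gt0.
  have lE : last 0%N w = last 0%N (drop i w).
    have := last_cat 0%N (take i w) (drop i w); rewrite cat_take_drop => ->.
    by case: (drop i w) dw.
  have -> : sorted ltn (drop i w ++ [:: x]) = sorted ltn (drop i w) && (last 0%N w < x)%N.
    by rewrite lE; case: (drop i w) dw => //= y s _; rewrite cat_path /= andbT.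
  by case: (sorted _ _); case: (_ < x)%N => /=; ring.
rewrite -mulr_sumr -IH // zE.
by case: (ltngtP x (last 0%N w)) lastx => //= _ _; ring.
Qed.

Variable n : nat.
Notation vals w := (map (@nat_of_ord n) w).

Lemma card_sorted_avoid i k (v : i.-tuple 'I_n) : uniq v ->
  #|[set u : k.-tuple 'I_n | uniq (v ++ u) && sorted ltn (vals u)]%SET| = 'C(n - i, k).
Proof.
move=> uv; pose f (u : k.-tuple 'I_n) : {set 'I_n} := [set x in u]%SET.
have srtE u : sorted ltn (vals u) = sorted (relpre (@nat_of_ord n) ltn) u by rewrite sorted_map.
have finj : {in [set u : k.-tuple 'I_n | uniq (v ++ u) && sorted ltn (vals u)]%SET &, injective f}.
  move=> u u'; rewrite !inE => /andP[_ su] /andP[_ su'] fe; apply: val_inj => /=.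
  apply: (@irr_sorted_eq _ (relpre (@nat_of_ord n) ltn)).
  - by move=> a b c /=; exact: ltn_trans.
  - by move=> a /=; exact: ltnn.
  - by rewrite -srtE.
  - by rewrite -srtE.
  by move=> a; have := congr1 (fun B : {set 'I_n} => a \in B) fe; rewrite !inE.
rewrite -(card_in_imset finj).
have -> : (n - i)%N = #|~: [set x in v]%SET|.
  by rewrite cardsCs finset.setCK card_ord cardsE (card_uniqP uv) size_tuple.
rewrite -cards_draws; apply: eq_card => B; rewrite inE; apply/imsetP/andP.
  move=> [u]; rewrite inE cat_uniq => /andP[/and3P[_ hv uu] su] ->; split.
    apply/fintype.subsetP => x; rewrite !inE => xu; apply/negP => xv.
    by case/negP: hv; apply/hasP; exists x.
  by rewrite cardsE (card_uniqP uu) size_tuple.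
move=> [Bv /eqP Bk].
have sz : size (enum B) == k by rewrite -cardE Bk.
exists (Tuple sz); last by apply/setP => x; rewrite inE /= mem_enum.
rewrite inE /= cat_uniq uv enum_uniq andbT /=; apply/andP; split.
  apply/hasPn => x; rewrite mem_enum => /(fintype.subsetP Bv).
  by rewrite !inE.
rewrite srtE /enum_mem; apply: sorted_filter => [a b c /=|]; first exact: ltn_trans.
by rewrite -enumT -sorted_map val_enum_ord iota_ltn_sorted.
Qed.

(** An increasing suffix is determined by its set of values. *)
Lemma sum_sorted_suffix i k (phi : seq nat -> A) :
  \sum_(w : (i + k).-tuple 'I_n | uniq w)
     (sorted ltn (drop i (vals w)))%:R * phi (take i (vals w)) =
  'C(n - i, k)%:R * \sum_(v : i.-tuple 'I_n | uniq v) phi (vals v).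
Proof.
pose h (p : i.-tuple 'I_n * k.-tuple 'I_n) : (i + k).-tuple 'I_n := cat_tuple p.1 p.2.
have hinj : injective h.
  move=> [v u] [v' u'] /(congr1 val) /= /eqP; rewrite eqseq_cat ?size_tuple //.
  by move=> /andP[/eqP/val_inj -> /eqP/val_inj ->].
have hbij : bijective h.
  by apply: inj_card_bij hinj _; rewrite card_prod !card_tuple expnD.
rewrite (reindex h) /=; last exact: onW_bij.
rewrite big_mkcond /= -(pair_bigA _ (fun (v : i.-tuple 'I_n) (u : k.-tuple 'I_n) => if uniq (v ++ u) then
   (sorted ltn (drop i (vals (v ++ u))))%:R * phi (take i (vals (v ++ u))) else 0)) /=.
rewrite mulr_sumr [RHS]big_mkcond /=; apply: eq_bigr => v _.
rewrite (eq_bigr (fun u : k.-tuple 'I_n => (uniq (v ++ u) && sorted ltn (vals u))%:R * phi (vals v))); last first.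
  move=> u _; rewrite map_cat drop_size_cat ?size_map ?size_tuple // take_size_cat ?size_map ?size_tuple //.
  by case: (uniq _); rewrite ?mul0r.
rewrite -mulr_suml; case: ifP => uv; last first.
  rewrite big1 ?mul0r // => u _; by rewrite cat_uniq uv.
rewrite -(card_sorted_avoid k uv) -sum1_card natr_sum; congr (_ * _).
rewrite [RHS]big_mkcond /=; apply: eq_bigr => u _; rewrite inE.
by case: (_ && _).
Qed.

(** The injective words of length [c]; for [c = n] these are the permutations. *)
Definition des_sum (c : nat) : A :=
  \sum_(w : c.-tuple 'I_n | uniq w) des_weight (vals w).

Lemma des_sum_rec c : (0 < c)%N -> des_sum c =
  \sum_(i < c) 'C(n - i, c - i)%:R * (z_ i * des_sum i) * \prod_(i.+1 <= j < c) (1 - z j).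
Proof.
move=> c0; rewrite /des_sum.
rewrite (eq_bigr (fun w : c.-tuple 'I_n => \sum_(i < c) (sorted ltn (drop i (vals w)))%:R *
    (des_weight (take i (vals w)) * z_ i * \prod_(i.+1 <= j < c) (1 - z j)))); last first.
  move=> w uw; rewrite des_weight_split ?size_map ?size_tuple //.
  by rewrite map_inj_uniq //; exact: ord_inj.
rewrite exchange_big /=; apply: eq_bigr => i _.
have ic := ltn_ord i.
have := sum_sorted_suffix i (c - i) (fun v => des_weight v * z_ i * \prod_(i.+1 <= j < c) (1 - z j)).
rewrite subnKC; last exact: ltnW.
move=> ->; rewrite -!mulr_suml; ring.
Qed.

Lemma igusaM_descents c : igusaM z (fun i j => 'C(n - i, j - i)%:R) z c = z_ c * des_sum c.
Proof.
elim/ltn_ind: c => c IH; case: (posnP c) => [->|c0].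
  rewrite igusaM0 /des_sum mul1r (big_pred1 [tuple]) => [|w]; last by rewrite tuple0.
  by rewrite /des_weight big_geq.
rewrite igusaMS // des_sum_rec //; case: c c0 IH => // c _ IH /=.
by congr (_ * _); apply: eq_bigr => i _; rewrite IH.
Qed.

Lemma igusaN_des_sum : (0 < n)%N ->
  igusaN z (fun i j => 'C(n - i, j - i)%:R) z n = des_sum n.
Proof.
move=> n0; rewrite /igusaN big_ord_recr /= big_geq // mulr1 igusaM_descents.
have zE : z_ n = z n by case: (n) n0.
have dE : des_sum n = \sum_(i < n) igusaM z (fun i j => 'C(n - i, j - i)%:R) z i *
    \prod_(i.+1 <= j < n) (1 - z j).
  rewrite des_sum_rec //; apply: eq_bigr => i _; rewrite igusaM_descents.
  by rewrite binn mul1r.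
rewrite (eq_bigr (fun i : 'I_n => (igusaM z (fun i j => 'C(n - i, j - i)%:R) z i *
    \prod_(i.+1 <= j < n) (1 - z j)) * (1 - z n))); last first.
  by move=> i _; rewrite big_nat_recr //= mulrA.
by rewrite -mulr_suml -dE zE; ring.
Qed.

Lemma des_sum_perm : des_sum n = \sum_(w : 'S_n) \prod_(j in Des w) z j.
Proof.
pose h (w : 'S_n) : n.-tuple 'I_n := [tuple w i | i < n].
have hinj : injective h.
  move=> w w' e; apply/permP => i.
  by have := congr1 (fun t : n.-tuple 'I_n => tnth t i) e; rewrite !tnth_mktuple.
rewrite /des_sum (eq_bigl (fun t => t \in [set h w | w in [set: 'S_n]%SET]%SET)); last first.
  move=> t; apply/idP/imsetP => [ut|[w _ ->]]; last first.
    by rewrite map_inj_uniq ?enum_uniq //; exact: perm_inj.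
  have tinj : injective (tnth t) by apply/tuple_uniqP.
  exists (perm tinj) => //; apply: eq_from_tnth => i.
  by rewrite tnth_mktuple permE.
rewrite big_imset /=; last by move=> w w' _ _; exact: hinj.
rewrite (eq_bigl predT) => [|w]; last by rewrite finset.in_setT.
apply: eq_bigr => w _; rewrite /des_weight size_map (size_tuple (h w)).
have nthE (j : 'I_n) : nth 0%N (vals (h w)) j = w j.
  by rewrite (nth_map j) ?size_tuple // -tnth_nth tnth_mktuple.
rewrite big_geq_mkord [LHS]big_mkcond [RHS]big_mkcond /=.
apply: eq_bigr => j _.
have jn : (j.-1 < n)%N by rewrite (leq_ltn_trans (leq_pred j)).
rewrite nthE (_ : nth 0%N (vals (h w)) j.-1 = w (Ordinal jn)); last exact: (nthE (Ordinal jn)).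
rewrite inE (_ : [exists i, _] = (0 < j)%N && (w j < w (Ordinal jn))%N).
  by case: (0 < j)%N; case: (w j < _)%N.
apply/existsP/andP => [[i /andP[/eqP e wji]]|[j0 lt]].
  split; first by rewrite -e.
  by rewrite (_ : Ordinal jn = i) //; apply/val_inj; rewrite /= -e.
by exists (Ordinal jn); rewrite lt andbT /= prednK.
Qed.

End Descents.

(** * Evaluation of rational functions *)

(** There is at most one ring morphism from the rationals; hence the evaluations are
    ring morphisms wherever one exists. *)
Lemma ratr_hom (A : comUnitRingType) (f : {rmorphism rat -> A}) (x : rat) : ratr x = f x.
Proof.
rewrite /ratr -[x in RHS]divq_num_den rmorph_div ?unitfE ?intr_eq0 ?denq_neq0 //.
by rewrite !rmorph_int.
Qed.

Section Evaluation.
Variables (A : comUnitRingType) (f : {rmorphism rat -> A}).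

Definition ev1 (x : A) : {rmorphism {poly rat} -> A} :=
  (horner_eval x \o map_poly f : {rmorphism _ -> _}).

Definition ev2 (x y : A) : {rmorphism {poly {poly rat}} -> A} :=
  (horner_eval y \o horner_eval x%:P \o map_poly (map_poly f) : {rmorphism _ -> _}).

Lemma eval1E p x : eval1 p x = ev1 x p.
Proof.
by rewrite /eval1 /ev1 /= /horner_eval; congr (_.[x]); apply: eq_map_poly => c; exact: ratr_hom.
Qed.

Lemma eval2E p x y : eval2 p x y = ev2 x y p.
Proof.
rewrite /eval2 /ev2 /= /horner_eval; congr (_.[_].[_]); apply: eq_map_poly => c.
by apply: eq_map_poly => d; exact: ratr_hom.
Qed.

Lemma ev1X x : ev1 x 'X = x.
Proof. by rewrite /ev1 /= /horner_eval map_polyX hornerX. Qed.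
Lemma ev2X x y : ev2 x y 'X = x.
Proof. by rewrite /ev2 /= /horner_eval map_polyX hornerX hornerC. Qed.
Lemma ev2Y x y : ev2 x y 'X%:P = y.
Proof. by rewrite /ev2 /= /horner_eval map_polyC /= hornerC map_polyX hornerX. Qed.
Lemma ev2C x y c : ev2 x y c%:P%:P = f c.
Proof. by rewrite /ev2 /= /horner_eval map_polyC /= hornerC map_polyC hornerC. Qed.

End Evaluation.

Lemma tofrac_div_eq (P : idomainType) (a b c d : P) : b != 0 -> d != 0 ->
  (tofrac a / tofrac b = tofrac c / tofrac d) <-> a * d = c * b.
Proof.
move=> b0 d0; have tb : tofrac b != 0 by rewrite tofrac_eq0.
have td : tofrac d != 0 by rewrite tofrac_eq0.
split => [/eqP|e]; last by apply/eqP; rewrite eqr_div // -!tofracM e.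
by rewrite eqr_div // -!tofracM tofrac_eq => /eqP.
Qed.

Lemma frac_at_cross (P : idomainType) (L : fieldType) (phi : {rmorphism P -> L})
    (a b : P) (y : L) :
  b != 0 -> frac_at phi (tofrac a / tofrac b) y -> phi a = y * phi b.
Proof.
move=> b0 [p [q [q0 e ->]]].
have q0' : q != 0 by apply: contraNneq q0 => ->; rewrite rmorph0.
move: e => /(tofrac_div_eq _ _ b0 q0') e.
apply: (mulIf q0); rewrite -rmorphM e rmorphM.
by rewrite mulrAC divfK.
Qed.

Lemma frac_at_div (P : idomainType) (L : fieldType) (phi : {rmorphism P -> L}) (a b : P) :
  phi b != 0 -> frac_at phi (tofrac a / tofrac b) (phi a / phi b).
Proof. by move=> b0; exists a, b. Qed.

Lemma frac_at_uniq (P : idomainType) (L : fieldType) (phi : {rmorphism P -> L})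
    (a b : P) (y : L) : phi b != 0 ->
  frac_at phi (tofrac a / tofrac b) y -> y = phi a / phi b.
Proof.
move=> pb; have b0 : b != 0 by apply: contraNneq pb => ->; rewrite rmorph0.
by move=> /(frac_at_cross b0) ->; rewrite mulfK.
Qed.

Lemma poly_inf_roots (P : idomainType) (p : {poly P}) (f : nat -> P) :
  injective f -> (forall i, root p (f i)) -> p = 0.
Proof.
move=> finj fr; apply/eqP/negPn/negP => p0.
have rs : all (root p) (mkseq f (size p)) by apply/allP => _ /mapP[i _ ->].
have us : uniq (mkseq f (size p)) by rewrite mkseq_uniq.
by have := max_poly_roots p0 rs us; rewrite size_mkseq ltnn.
Qed.

Fixpoint nth_prime (k : nat) : nat := if k is k'.+1 then s2val (prime_above (nth_prime k')) else 2.

Lemma nth_primeP k : prime (nth_prime k).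
Proof. by case: k => //= k; case: prime_above. Qed.

Lemma nth_prime_inj : injective nth_prime.
Proof.
have lt k : (nth_prime k < nth_prime k.+1)%N by rewrite /=; case: prime_above.
have hom : {homo nth_prime : i j / (i < j)%N} by exact: (homo_ltn ltn_trans lt).
by move=> i j e; case: (ltngtP i j) => // /hom; rewrite e ltnn.
Qed.

(** * Determination of the rational function *)
Section Determination.
Variables (R : realType) (m n : nat) (W : ratfun2).
Hypotheses (hm : (0 < m)%N) (hn : (0 < n)%N) (hW : is_uniform_zeta R m n W).

Let ratrR : {rmorphism rat -> R} := @ratr R.

(** Two fractions that agree at [(p, p ^ (- s))] for all primes [p] and all large [s]
    are equal. For fixed [p] the cross product is a polynomial in [Y] with the roots
    [p ^ (- s)], so it vanishes; as a polynomial in [X] it then has all primes as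
    roots. *)
Lemma uniform_zeta_unique :
  zeta_den m n 'X 'X%:P != 0 :> {poly {poly rat}} /\
  W = tofrac (zeta_num m n 'X 'X%:P) / tofrac (zeta_den m n 'X 'X%:P).
Proof.
set N := zeta_num m n _ _; set Dn := zeta_den m n _ _.
have key p : prime p -> exists s0 : R, forall s, s0 < s ->
    let y := p%:R `^ (- s) in
    ev2 ratrR p%:R y Dn != 0 /\
    frac_at (ev2 ratrR p%:R y) W (ev2 ratrR p%:R y N / ev2 ratrR p%:R y Dn).
  move=> pp; have [sigma hs] := hW (conj (is_dvr_pseries 'F_p) (@compact_pseries 'F_p)).
  exists (Num.max sigma (n + d_num m n)%:R) => s; rewrite gt_max => /andP[s1 s2] y.
  have [] := zeta_closed_form (ps_dvr 'F_p) hm hn s2; rewrite card_Fp // -/y => d0 zE.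
  have [w] := hs s s1; rewrite residue_card_pseries card_Fp // zE -/y => fw [wE].
  have NE : ev2 ratrR p%:R y N = zeta_num m n p%:R y.
    by rewrite /N zeta_num_rmorph ev2X ev2Y.
  have DE : ev2 ratrR p%:R y Dn = zeta_den m n p%:R y.
    by rewrite /Dn zeta_den_rmorph ev2X ev2Y.
  rewrite NE DE; split => //; rewrite wE.
  by have -> : (ev2 ratrR p%:R y : _ -> _) = (fun P => eval2 P p%:R y)
    by apply/funext => P; rewrite (eval2E ratrR).
have [s0 h0] := key 2%N isT.
have s01 : s0 < s0 + 1 by rewrite ltrDl.
have [D0 [a [b [phib WE _]]]] := h0 _ s01.
have b0 : b != 0 by apply: contraNneq phib => ->; rewrite rmorph0.
clearbody N Dn.
have Ep p : prime p -> exists s1 : R, forall s, s1 < s ->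
    ev2 ratrR p%:R (p%:R `^ (- s)) (a * Dn - N * b) = 0.
  move=> /key[s1 h1]; exists s1 => s /h1[d0]; rewrite WE => /(frac_at_cross b0) e.
  by rewrite rmorphB !rmorphM e; field.
pose E' := map_poly (map_poly ratrR) (a * Dn - N * b).
have E'0 : E' = 0.
  apply: (@poly_inf_roots _ _ (fun k => (nth_prime k)%:R%:P)).
    by move=> k l /polyC_inj/eqP; rewrite eqr_nat => /eqP/nth_prime_inj.
  move=> k; set p := nth_prime k; have [s1 h1] := Ep p (nth_primeP k).
  have p1 : 1 < p%:R :> R by rewrite ltr1n prime_gt1 // nth_primeP.
  apply/rootP; apply: (@poly_inf_roots _ _ (fun i => p%:R `^ (- (s1 + i.+1%:R)))).
    move=> i j /(congr1 (@ln R)); rewrite !ln_powR.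
    move/(mulIf (lt0r_neq0 (ln_gt0 p1))) /oppr_inj/addrI/eqP.
    by rewrite eqr_nat => /eqP[].
  move=> i; apply/rootP; apply: h1.
  by rewrite ltrDl ltr0n.
have rinj : injective ratrR by exact: fmorph_inj.
have E0 : a * Dn - N * b = 0.
  apply: (map_inj_poly (map_inj_poly rinj (rmorph0 _)) (rmorph0 _)).
  by rewrite [RHS]rmorph0; exact: E'0.
have Dn0 : Dn != 0 by apply: contraNneq D0 => ->; rewrite rmorph0.
split => //; rewrite WE; apply/tofrac_div_eq => //.
by apply/eqP; rewrite -subr_eq0 E0.
Qed.

End Determination.

(** * Laurent expansions *)

Section Laurent.
Variable K : fieldType.
Local Notation S := (pseries K).

Lemma ps_var_exp_neq0 N : (ps_var : S) ^+ N != 0.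
Proof. by apply: expf_neq0; exact: ps_var_neq0. Qed.

Lemma is_laurentE (f g c : S) h :
  is_laurent f g h c <-> g != 0 /\ g * c = ps_var ^+ h * f.
Proof.
split => [[[k gk] e]|[g0 e]].
  split; first by apply: contraNneq gk => ->.
  apply: psP => l; rewrite ps_var_expM psM e.
  by case: leqP.
split.
  by have [a ga _] := ps_lead g0; exists a.
move=> k; have := congr1 (fun u : S => u k) e; rewrite ps_var_expM psM => ->.
by case: leqP.
Qed.

Lemma laurent_uniq (f g f' g' c c' : S) h : f * g' = f' * g ->
  is_laurent f g h c -> is_laurent f' g' h c' -> c = c'.
Proof.
move=> e /is_laurentE[g0 gc] /is_laurentE[g0' gc'].
apply: (mulfI (mulf_neq0 g0 g0')).
have -> : g * g' * c = g' * (g * c) by ring.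
have -> : g * g' * c' = g * (g' * c') by ring.
rewrite gc gc'; have -> : g' * (ps_var ^+ h * f) = ps_var ^+ h * (f * g') by ring.
by rewrite e; ring.
Qed.

Lemma laurent_ex (f g1 : S) h : g1 0%N != 0 ->
  exists2 c : S, is_laurent f (ps_var ^+ h * g1) h c & c 0%N = f 0%N / g1 0%N.
Proof.
move=> g10; have ug : g1 \is a GRing.unit by rewrite ps_unitE.
exists (f / g1).
  apply/is_laurentE; split.
    by rewrite mulf_neq0 ?ps_var_exp_neq0 //; apply: contraNneq g10 => ->.
  by rewrite -mulrA; congr (_ * _); rewrite mulrCA divrr // mulr1.
apply: (mulIf g10); rewrite -mulrA mulVf // mulr1 -psM0.
by rewrite divrK.
Qed.

(** First-order expansions suffice for the leading term: the factors [1 - f] of the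
    denominator have simple zeros at [q = 1]. *)
Definition jet (f : S) (a : K) : Prop := f 0%N = 1 /\ f 1%N = a.

Lemma jet1 : jet 1 0. Proof. by []. Qed.

Lemma jetM f g a b : jet f a -> jet g b -> jet (f * g) (a + b).
Proof.
move=> [f0 f1] [g0 g1]; split; first by rewrite psM0 f0 g0 mulr1.
by rewrite psM big_ord_recl big_ord1 /= f0 f1 g0 g1 mul1r mulr1 addrC.
Qed.

Lemma jetX f a k : jet f a -> jet (f ^+ k) (a *+ k).
Proof.
move=> fa; elim: k => [|k IH]; first exact: jet1.
by rewrite exprS mulrS; exact: jetM.
Qed.

Lemma jet_factor f a : jet f a -> exists2 g : S, 1 - f = ps_var * g & g 0%N = - a.
Proof.
move=> [f0 f1]; exists (fun k => (1 - f : S) k.+1).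
  rewrite -[ps_var]expr1 [LHS](@ps_shift _ _ 1); last by case=> // _; rewrite psD psN ps1 f0 subrr.
  by congr (_ * _); apply: psP => k; rewrite addn1.
by rewrite psD psN ps1 f1 sub0r.
Qed.

Lemma prod_factor (I : Type) (r : seq I) (f : I -> S) (a : I -> K) :
    (forall i, exists2 g : S, f i = ps_var * g & g 0%N = a i) ->
  exists2 g : S, \prod_(i <- r) f i = ps_var ^+ size r * g &
    g 0%N = \prod_(i <- r) a i.
Proof.
move=> fa; elim: r => [|i r [g gE g0]].
  by exists 1; rewrite ?big_nil // mul1r.
have [gi giE gi0] := fa i; exists (gi * g); rewrite !big_cons.
  by rewrite giE gE /= exprS; ring.
by rewrite psM0 gi0 g0.
Qed.

End Laurent.

Section Expansion.
Local Notation K := ratfun.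
Local Notation S := (pseries K).

Let ratK : {rmorphism rat -> K} := (@tofrac {poly rat} \o polyC : {rmorphism _ -> _}).
Let ratKp : {rmorphism rat -> {poly K}} := (polyC \o ratK : {rmorphism _ -> _}).
Let ratS : {rmorphism rat -> S} := (@ps_const K \o ratK : {rmorphism _ -> _}).

Definition binom_series : S := gbinom (- ratvar).

(** Substitution of the power series [1 + u] and [(1 + u) ^ (- s)]. *)
Definition exp_series : {rmorphism {poly {poly rat}} -> S} :=
  ev2 ratS (1 + ps_var) binom_series.

Lemma poly2_ind (P : {poly {poly rat}} -> Prop) :
    (forall c, P c%:P%:P) -> P 'X -> P 'X%:P ->
    (forall p r, P p -> P r -> P (p + r)) -> (forall p r, P p -> P r -> P (p * r)) ->
  forall p, P p.
Proof.
move=> PC PX PY PD PM; have PCP (p : {poly rat}) : P p%:P.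
  elim/poly_ind: p => [|p c IH]; first by rewrite -[0]polyC0; exact: PC.
  by rewrite polyCD polyCM; apply: PD => //; exact: PM.
elim/poly_ind => [|p c IH]; first by rewrite -[0]polyC0.
by apply: PD => //; exact: PM.
Qed.

(** The coefficients of a product up to a given order only depend on those of the
    factors; this compares the evaluation at a truncated binomial series with the
    evaluation at the full series. *)
Lemma agree_upto (N : nat) (phi : {rmorphism {poly {poly rat}} -> {poly K}})
    (psi : {rmorphism {poly {poly rat}} -> S}) :
    let agree p := forall i, (i < N)%N -> (phi p)`_i = (psi p : S) i in
  (forall c, agree c%:P%:P) -> agree 'X -> agree 'X%:P -> forall p, agree p.
Proof.
move=> agree aC aX aY; apply: poly2_ind => // p r IHp IHr i iN.
  by rewrite (rmorphD phi) (rmorphD psi) coefD psD IHp // IHr.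
rewrite (rmorphM phi) (rmorphM psi) coefM psM; apply: eq_bigr => j _; rewrite IHp ?IHr //.
  by rewrite (leq_ltn_trans _ iN) // leq_subr.
by rewrite (leq_ltn_trans _ iN) // -ltnS.
Qed.

Lemma expansionE p k : expansion p k = (exp_series p : S) k.
Proof.
rewrite /expansion (eval2E ratKp); set T := \poly_(j < k.+1) _.
apply: (@agree_upto k.+1 (ev2 ratKp (1 + 'X) T) exp_series) => // [c i ik|i ik|i ik].
- by rewrite /exp_series !ev2C /= coefC; case: i ik.
- by rewrite /exp_series !ev2X coefD coef1 coefX psD.
by rewrite /exp_series !ev2Y coef_poly ik.
Qed.

Variables (m n : nat).
Hypotheses (hm : (0 < m)%N) (hn : (0 < n)%N).
Local Notation d := (d_num m n).
Local Notation h := (h_num m n).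
Let N := zeta_num m n ('X : {poly {poly rat}}) 'X%:P.
Let Dn := zeta_den m n ('X : {poly {poly rat}}) 'X%:P.

Definition top_den : K := (\prod_(0 <= j < d) (ratvar - j%:R)) *
  (\prod_(0 <= i < n) ((b_num m n i)%:R * ratvar - (a_num m n i)%:R)).

(** Each factor [1 - q ^ a * q ^ (- b s)] is [(q - 1) (b s - a)] up to higher order, and
    there are [h] factors. *)
Lemma exp_den : exists2 g : S, exp_series Dn = ps_var ^+ h * g & g 0%N = top_den.
Proof.
rewrite /Dn zeta_den_rmorph /exp_series ev2X ev2Y /zeta_den.
have jX : jet (1 + ps_var : S) 1.
  by split; rewrite psD ps1 /ps_var /= ?addr0 // add0r.
have jY : jet binom_series (- ratvar).
  split; first by rewrite /binom_series /gbinom big_ord0 /= divff ?oner_neq0.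
  by rewrite /binom_series /gbinom big_ord1 /= subr0 -[1`!%:R]/(1 : K) divr1.
rewrite -(big_mkord xpredT (fun j => 1 - (1 + ps_var : S) ^+ j * binom_series)).
have [j|g1 g1E g10] := @prod_factor K _ (index_iota 0 d)
    (fun j => 1 - (1 + ps_var : S) ^+ j * binom_series) (fun j => ratvar - j%:R).
  have [g gE g0] := jet_factor (jetM (jetX j jX) jY).
  by exists g; rewrite ?g0 ?opprD ?opprK // addrC.
have [c|g2 g2E g20] := @prod_factor K _ (index_iota 1 n.+1)
    (fun c => 1 - zeta_X m n (1 + ps_var : S) binom_series c)
    (fun c => (b_num m n (n - c))%:R * ratvar - (a_num m n (n - c))%:R).
  have [g gE g0] := jet_factor (jetM (jetX (a_num m n (n - c)) jX) (jetX (b_num m n (n - c)) jY)).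
  by exists g => //; rewrite g0 opprD mulNrn opprK addrC mulr_natl.
exists (g1 * g2).
  rewrite g1E g2E !size_iota subn0 subn1 /= /h_num exprD; ring.
rewrite psM0 g10 g20 /top_den; congr (_ * _).
rewrite big_add1 /= big_nat_rev /= add0n; apply: eq_big_nat => i /andP[_ ni].
by rewrite subnSK // subKn // ltnW.
Qed.

(** At [q = 1] every permutation contributes [1]. *)
Lemma exp_num : (exp_series N : S) 0%N = (n`!)%:R.
Proof.
rewrite -[LHS]/(ps_res (exp_series N)) /N zeta_num_rmorph /exp_series ev2X ev2Y zeta_num_rmorph /=.
have -> : ps_res (1 + ps_var : S) = 1 by rewrite /ps_res psD ps1 /ps_var addr0.
have -> : ps_res binom_series = 1.
  by rewrite /ps_res /binom_series /gbinom big_ord0 /= divff ?oner_neq0.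
rewrite /zeta_num (@eq_igusaN _ _ _ _ (fun=> 1) (fun i c => 'C(n - i, c - i)%:R) (fun=> 1)).
- rewrite igusaN_des_sum // des_sum_perm.
  rewrite (eq_bigr (fun=> 1)) => [|w _]; last by rewrite big1.
  by rewrite sumr_const; congr (_%:R); exact: card_Sn.
- by move=> c _; rewrite /zeta_x !expr1n mulr1.
- by move=> i c _; rewrite /zeta_g gcoef1.
- by move=> c _; rewrite /zeta_X !expr1n mulr1.
Qed.

Definition linp (b a : nat) : {poly rat} := b%:R%:P * 'X - a%:R%:P.

Lemma size_linp b a : (0 < b)%N -> size (linp b a) = 2%N.
Proof.
move=> b0; rewrite /linp -polyCN size_MXaddC polyC_eq0 pnatr_eq0 eqn0Ngt b0 /=.
by rewrite size_polyC pnatr_eq0 eqn0Ngt b0.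
Qed.

Lemma linp_neq0 b a : (0 < b)%N -> linp b a != 0.
Proof. by move=> b0; rewrite -size_poly_eq0 size_linp. Qed.

Definition top_denP : {poly rat} := (\prod_(0 <= j < d) linp 1 j) *
  (\prod_(0 <= i < n) linp (b_num m n i) (a_num m n i)).

Lemma tofrac_linp b a : tofrac (linp b a) = b%:R * ratvar - a%:R :> K.
Proof. by rewrite /linp !polyC_natr tofracB tofracM !rmorph_nat. Qed.

Lemma top_denE : top_den = tofrac top_denP.
Proof.
rewrite /top_den /top_denP tofracM !rmorph_prod; congr (_ * _); apply: eq_bigr => i _.
  by rewrite [RHS]tofrac_linp mul1r.
by rewrite [RHS]tofrac_linp.
Qed.

Lemma top_denP_neq0 : top_denP != 0.
Proof.
rewrite mulf_neq0 // prodf_seq_neq0; apply/allP => i.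
  by move=> _; apply/implyP => _; exact: linp_neq0.
rewrite mem_index_iota => /andP[_ ni]; apply/implyP => _; apply: linp_neq0.
exact: b_num_gt0.
Qed.

Lemma top_den_neq0 : top_den != 0.
Proof. by rewrite top_denE tofrac_eq0 top_denP_neq0. Qed.

Lemma top_zeta (W : ratfun2) : Dn != 0 -> W = tofrac N / tofrac Dn ->
  forall Z, is_top_zeta m n W Z <-> Z = (n`!)%:R / top_den.
Proof.
move=> D0 WE; have [g gE g0] := exp_den.
have g00 : g 0%N != 0 by rewrite g0 top_den_neq0.
have [c cl c0] := laurent_ex (exp_series N) h g00.
have expE p : expansion p = exp_series p by apply/funext => k; exact: expansionE.
have Zc : c 0%N = (n`!)%:R / top_den by rewrite c0 exp_num g0.
move=> Z; split => [[p [r [WE' [c' cl' <-]]]]|->].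
  rewrite !expE in cl'; rewrite -Zc; suff -> : c' = c by [].
  have [r0 _] := (is_laurentE _ _ _ _).1 cl'.
  have r0' : r != 0 by apply: contraNneq r0 => ->; rewrite rmorph0.
  rewrite -gE in cl; apply: (laurent_uniq _ cl' cl).
  move: WE'; rewrite WE => /(tofrac_div_eq _ _ D0 r0') e.
  by rewrite -!rmorphM e.
exists N, Dn; split => //; exists c => //.
by rewrite !expE gE.
Qed.

End Expansion.

(** * Degrees, poles and special values *)

Lemma deg_mul (p q : {poly rat}) : p != 0 -> q != 0 ->
  (size (p * q)).-1 = ((size p).-1 + (size q).-1)%N.
Proof.
move=> p0 q0; rewrite size_mul //; move: p0 q0; rewrite -!size_poly_gt0.
by case: (size p) => // i _; case: (size q) => // j _; rewrite addnS.
Qed.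

Lemma deg_prod (I : eqType) (r : seq I) (f : I -> {poly rat}) :
  (forall i, i \in r -> f i != 0) ->
  (size (\prod_(i <- r) f i)).-1 = (\sum_(i <- r) (size (f i)).-1)%N.
Proof.
elim: r => [|i r IH] fr; first by rewrite !big_nil size_poly1.
have fr' j : j \in r -> f j != 0 by move=> jr; apply: fr; rewrite inE jr orbT.
have p0 : \prod_(j <- r) f j != 0.
  by rewrite prodf_seq_neq0; apply/allP => j jr; exact: fr'.
by rewrite !big_cons deg_mul ?fr ?mem_head // IH.
Qed.

(** Substituting [X + x] turns [X - x] into the variable of the power series. *)
Lemma laurent_at_poly (p q1 : {poly rat}) (x : rat) (h : nat) : q1.[x] != 0 ->
  exists2 c, laurent_at (tofrac p / tofrac (('X - x%:P) ^+ h * q1)) x h c &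
    c 0%N = p.[x] / q1.[x].
Proof.
move=> q10; pose f : pseries rat := fun k => (p \Po ('X + x%:P))`_k.
pose g : pseries rat := fun k => (q1 \Po ('X + x%:P))`_k.
have c0 (r : {poly rat}) : (r \Po ('X + x%:P))`_0 = r.[x].
  by rewrite -horner_coef0 horner_comp !hornerE.
have g0 : g 0%N = q1.[x] by exact: c0.
have g00 : g 0%N != 0 by rewrite g0.
have [c cl cE] := laurent_ex f h g00.
exists c; last by rewrite cE g0 /f c0.
exists p, (('X - x%:P) ^+ h * q1); split => //.
have -> : (fun k => ((('X - x%:P) ^+ h * q1) \Po ('X + x%:P))`_k) = ps_var ^+ h * g.
  apply/funext => k; rewrite ps_var_expM comp_polyM rmorphXn /= comp_polyB comp_polyX comp_polyC.
  by rewrite addrK coefXnM ltnNge; case: leqP.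
exact: cl.
Qed.

(** * The topological zeta function *)
Section Top.
Variables (m n : nat).
Hypotheses (hm : (0 < m)%N) (hn : (0 < n)%N).
Local Notation d := (d_num m n).
Local Notation h := (h_num m n).
Local Notation b := (b_num m n).
Local Notation a := (a_num m n).
Local Notation Z := ((n`!)%:R / top_den m n : ratfun).

Lemma top_frac : Z = tofrac (n`!)%:R%:P / tofrac (top_denP m n).
Proof. by rewrite top_denE polyC_natr rmorph_nat. Qed.

Lemma size_top_den : (size (top_denP m n)).-1 = h.
Proof.
have n1 : \prod_(0 <= j < d) linp 1 j != 0.
  by rewrite prodf_seq_neq0; apply/allP => i _; exact: linp_neq0.
have n2 : \prod_(0 <= i < n) linp (b i) (a i) != 0.
  rewrite prodf_seq_neq0; apply/allP => i; rewrite mem_index_iota => /andP[_ ni] /=.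
  by apply: linp_neq0; exact: b_num_gt0.
rewrite /top_denP deg_mul //; congr addn.
  rewrite deg_prod => [|j _]; last exact: linp_neq0.
  by rewrite (eq_bigr (fun=> 1%N)) => [|j _]; rewrite ?size_linp // sum_nat_const_nat subn0 muln1.
rewrite deg_prod => [|j]; last first.
  by rewrite mem_index_iota => /andP[_ jn]; apply: linp_neq0; exact: b_num_gt0.
rewrite (eq_big_nat _ _ (F2 := fun=> 1%N)) => [|j /andP[_ jn]]; last by rewrite size_linp // b_num_gt0.
by rewrite sum_nat_const_nat subn0 muln1.
Qed.

Lemma top_degree : has_degree Z (- h%:Z).
Proof.
exists (n`!)%:R%:P, (top_denP m n); split.
- by rewrite polyC_eq0 pnatr_eq0 -lt0n fact_gt0.
- exact: top_denP_neq0.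
- exact: top_frac.
by rewrite size_top_den size_polyC pnatr_eq0 -lt0n fact_gt0 sub0r.
Qed.

(** The denominator of the topological zeta function without its factor [s]. *)
Definition top_res : {poly rat} := (\prod_(1 <= j < d) linp 1 j) *
  (\prod_(0 <= i < n) linp (b i) (a i)).

Lemma top_denP_X : top_denP m n = ('X - 0%:P) ^+ 1 * top_res.
Proof.
rewrite /top_denP (big_ltn (d_num_gt0 hm hn)) -mulrA; congr (_ * _).
by rewrite /linp polyC1 mul1r expr1.
Qed.

Lemma horner_linp c e x : (linp c e).[x] = c%:R * x - e%:R.
Proof. by rewrite /linp !hornerE. Qed.

(** All factors are negative at [s = 0]. Their absolute values are [1], ..., [d - 1]
    and [(n - i) (d + i)], [i < n], whose product is [n! (h - 1)!]. *)
Lemma top_res0 : top_res.[0] = (-1) ^+ (h - 1) * ((n`!)%:R * ((h - 1)`!)%:R).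
Proof.
have d0 := d_num_gt0 hm hn; rewrite /top_res hornerM !horner_prod.
rewrite (eq_bigr (fun j => -1 * j%:R)) => [|j _]; last by rewrite horner_linp mulr0 sub0r mulN1r.
rewrite [X in _ * X](eq_bigr (fun i => -1 * (a i)%:R)) => [|j _]; last by rewrite horner_linp mulr0 sub0r mulN1r.
rewrite !big_split /= !prodr_const_nat mulrACA -exprD subn0 -!natr_prod -natrM.
have -> : (d - 1 + n = h - 1)%N by rewrite /h_num; lia.
congr (_ * _); rewrite -natrM; congr (_%:R).
have -> : (\prod_(1 <= j < d) j = (d - 1)`!)%N.
  by rewrite fact_prod subn1 prednK.
have -> : (\prod_(0 <= i < n) a i = n`! * \prod_(0 <= i < n) (i + d))%N.
  rewrite /a_num big_split /=; congr (_ * _)%N.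
  rewrite fact_prod big_add1 /= [RHS]big_nat_rev /=; apply: eq_big_nat => i /andP[_ ni].
  by rewrite add0n subnSK.
rewrite mulnCA; congr (_ * _)%N.
have key k : ((d - 1)`! * \prod_(0 <= i < k) (i + d) = (d + k - 1)`!)%N.
  elim: k => [|k IH]; first by rewrite big_geq // muln1 addn0.
  rewrite big_nat_recr //= mulnA IH.
  have -> : (d + k.+1 - 1 = (d + k - 1).+1)%N by lia.
  rewrite factS mulnC; congr (_ * _)%N; lia.
by rewrite key.
Qed.

Lemma top_laurent : exists2 c, laurent_at Z 0 1 c & c 0%N = (-1) ^+ (h - 1) / ((h - 1)`!)%:R.
Proof.
have t0 : top_res.[0] != 0.
  by rewrite top_res0 !mulf_neq0 ?signr_eq0 ?pnatr_eq0 -?lt0n ?fact_gt0.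
have [c cl c0] := laurent_at_poly (n`!)%:R%:P 1 t0.
exists c; first by rewrite top_frac top_denP_X.
rewrite c0 hornerC top_res0 invfM -exprVn invrN1 mulrCA; congr (_ * _).
by rewrite invfM mulrA mulfV ?mul1r // pnatr_eq0 -lt0n fact_gt0.
Qed.

(** The denominator after the substitution of [1 / s] and multiplication by [s ^ h]. *)
Definition mu_inv : {poly rat} := (\prod_(0 <= j < d) (1 - j%:R%:P * 'X)) *
  (\prod_(0 <= i < n) ((b i)%:R%:P - (a i)%:R%:P * 'X)).

Lemma prod_b0 : \prod_(i < n) (b i)%:R != 0 :> rat.
Proof. by apply/prodf_neq0 => i _; rewrite pnatr_eq0 -lt0n b_num_gt0. Qed.

Lemma mu_inv0 : mu_inv.[0] = \prod_(i < n) (b i)%:R.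
Proof.
rewrite /mu_inv hornerM !horner_prod big1 ?mul1r => [|j _]; last by rewrite !hornerE.
by rewrite big_mkord; apply: eq_bigr => i _; rewrite !hornerE.
Qed.

Lemma top_at_infinity : exists2 Zinv, inverse_subst Z Zinv &
  value_at (ratvar ^- h * Zinv) 0 (mu_num m n).
Proof.
pose ratK : {rmorphism rat -> ratfun} := (@tofrac {poly rat} \o polyC : {rmorphism _ -> _}).
pose phi := ev1 ratK ratvar^-1.
have s0 : ratvar != 0 by rewrite tofrac_eq0 polyX_eq0.
have phiE c e : phi (linp c e) = (tofrac (c%:R%:P - e%:R%:P * 'X) / ratvar : ratfun).
  rewrite /linp rmorphB rmorphM ev1X !polyC_natr !rmorph_nat tofracB tofracM !rmorph_nat.
  by rewrite mulrBl mulfK.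
have phiD : phi (top_denP m n) = (tofrac mu_inv / ratvar ^+ h : ratfun).
  rewrite rmorphM !rmorph_prod /mu_inv tofracM !rmorph_prod.
  rewrite [X in X * _ = _](eq_bigr (fun j => tofrac (1 - j%:R%:P * 'X) * ratvar^-1)).
    2: by move=> j _; rewrite phiE polyC1.
  rewrite [X in _ * X = _](eq_bigr (fun i => tofrac ((b i)%:R%:P - (a i)%:R%:P * 'X) * ratvar^-1)).
    2: by move=> j _; rewrite phiE.
  rewrite !big_split /= !prodr_const_nat !subn0 mulrACA -exprD exprVn //.
have mu0 : mu_inv != 0.
  apply: contraNneq prod_b0 => e; by rewrite -mu_inv0 e horner0.
have phi0 : phi (top_denP m n) != 0.
  rewrite phiD; apply: mulf_neq0; first by rewrite tofrac_eq0.
  by rewrite invr_eq0 expf_neq0.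
exists (phi (n`!)%:R%:P / phi (top_denP m n)).
  rewrite /inverse_subst top_frac.
  have -> : (fun p => eval1 p ratvar^-1) = (phi : _ -> _).
    by apply/funext => p; rewrite (eval1E ratK).
  exact: frac_at_div.
have cancel (r x y : ratfun) : r != 0 -> r^-1 * (x / (y / r)) = x / y.
  by move=> r0; rewrite invf_div mulrCA mulKf.
have phiN : phi (n`!)%:R%:P = tofrac (n`!)%:R%:P.
  by rewrite polyC_natr !rmorph_nat.
move: (phi _) (phi _) phiN phiD => u v -> ->.
have r0 : (ratvar ^+ h : ratfun) != 0 := expf_neq0 h s0.
move: (_ ^+ h) r0 => r r0.
rewrite cancel //.
have := @frac_at_div _ _ (horner_eval (0 : rat)) (n`!)%:R%:P mu_inv.
rewrite /= /horner_eval mu_inv0 hornerC => h'; apply: h'.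
exact: prod_b0.
Qed.

Lemma mu_gt0 : 0 < mu_num m n.
Proof.
rewrite /mu_num divr_gt0 ?ltr0n ?fact_gt0 // prodr_gt0 // => i _.
by rewrite ltr0n b_num_gt0.
Qed.

Lemma fact_dvd i j : (i <= j)%N -> (i`! %| j`!)%N.
Proof. by move=> ij; rewrite -(subnKC ij) (fact_split (leq_addr _ _)) dvdn_mulr. Qed.

(** The [b_i] are distinct and at most [h]. *)
Lemma prod_b_dvd : (\prod_(i < n) b i %| h`!)%N.
Proof.
have key k : (k < n)%N -> (\prod_(n - k.+1 <= i < n) b i %| (b (n - k.+1))`!)%N.
  elim: k => [|k IH] kn.
    rewrite subn1 big_ltn ?prednK // big_geq ?prednK // muln1.
    by rewrite dvdn_fact // b_num_gt0 ?prednK //= leqnn.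
  have kn' := ltnW kn; rewrite big_ltn ?ltn_subrL //.
  have -> : (n - k.+2).+1 = (n - k.+1)%N by rewrite subnSK.
  have b0 : (0 < b (n - k.+2))%N by rewrite b_num_gt0 // ltn_subrL.
  rewrite -(prednK b0) factS prednK // dvdn_mul // (dvdn_trans (IH kn')) //.
  apply: fact_dvd; rewrite -ltnS prednK // b_num_dec // ltn_sub2l //=.
  by rewrite leq_subr.
have := key n.-1; rewrite prednK // subnn b_num0 // big_mkord; apply.
exact: leqnn.
Qed.

Lemma mu_nat : exists2 N : nat, (0 < N)%N & mu_num m n * (h`!)%:R = N%:R.
Proof.
have /dvdnP[k hk] := prod_b_dvd.
have k0 : (0 < k)%N by have := fact_gt0 h; rewrite hk muln_gt0 => /andP[].
exists (n`! * k)%N; first by rewrite muln_gt0 fact_gt0.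
rewrite /mu_num hk !natrM natr_prod mulrAC -mulrA mulfK //; exact: prod_b0.
Qed.

End Top.

(** * The reduced zeta function *)
Section Reduced.
Variables (m n : nat).
Hypotheses (hm : (0 < m)%N) (hn : (0 < n)%N).
Local Notation d := (d_num m n).
Local Notation h := (h_num m n).
Local Notation b := (b_num m n).

Lemma zeta_num1 (A : comNzRingType) (Y : A) :
  zeta_num m n 1 Y = \sum_(w : 'S_n) \prod_(j in Des w) Y ^+ b (n - j).
Proof.
pose z j := Y ^+ b (n - j).
rewrite /zeta_num (@eq_igusaN _ _ _ _ z (fun i c => 'C(n - i, c - i)%:R) z).
- by rewrite igusaN_des_sum // des_sum_perm.
- by move=> c _; rewrite /zeta_x expr1n mul1r.
- by move=> i c _; rewrite /zeta_g gcoef1.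
- by move=> c _; rewrite /zeta_X expr1n mul1r.
Qed.

Lemma zeta_den1 (A : comNzRingType) (Y : A) :
  zeta_den m n 1 Y = (1 - Y) ^+ d * \prod_(0 <= i < n) (1 - Y ^+ b i).
Proof.
rewrite /zeta_den; congr (_ * _).
  by rewrite (eq_bigr (fun=> 1 - Y)) ?prodr_const ?card_ord // => j _; rewrite expr1n mul1r.
rewrite big_add1 /= big_nat_rev /= add0n; apply: eq_big_nat => i /andP[_ ni].
by rewrite /zeta_X expr1n mul1r subnSK // subKn // ltnW.
Qed.

Definition red_num : {poly rat} := zeta_num m n 1 'X.
Definition red_den : {poly rat} := zeta_den m n 1 'X.

(** What remains of the denominator once its zero at [Y = 1] is removed. *)
Definition red_cofactor : {poly rat} := \prod_(0 <= i < n) \sum_(k < b i) 'X^k.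

Lemma red_denE : red_den = (1 - 'X) ^+ h * red_cofactor.
Proof.
rewrite /red_den zeta_den1 /red_cofactor /h_num exprD -mulrA; congr (_ * _).
have -> : (1 - 'X) ^+ n = \prod_(0 <= i < n) (1 - 'X) :> {poly rat}.
  by rewrite prodr_const_nat subn0.
rewrite -big_split; apply: eq_bigr => i _ /=.
by rewrite -opprB subrX1 -mulNr opprB.
Qed.

Lemma red_cofactor1 : red_cofactor.[1] = \prod_(i < n) (b i)%:R.
Proof.
rewrite /red_cofactor horner_prod big_mkord; apply: eq_bigr => i _.
rewrite horner_sum (eq_bigr (fun=> 1)) => [|k _]; last by rewrite hornerXn expr1n.
by rewrite sumr_const card_ord.
Qed.

Lemma red_num1 : red_num.[1] = (n`!)%:R.
Proof.
rewrite /red_num zeta_num1 horner_sum (eq_bigr (fun=> 1)) => [|w _].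
  by rewrite sumr_const; congr (_%:R); exact: card_Sn.
by rewrite horner_prod big1 // => j _; rewrite hornerXn expr1n.
Qed.

Lemma size_subX k : (0 < k)%N -> size (1 - 'X^k : {poly rat}) = k.+1.
Proof. by move=> k0; rewrite -opprB size_polyN size_XnsubC. Qed.

Lemma subX_neq0 k : (0 < k)%N -> 1 - 'X^k != 0 :> {poly rat}.
Proof. by move=> k0; rewrite -size_poly_eq0 size_subX. Qed.

Lemma red_cofactor_neq0 : red_cofactor != 0.
Proof. by apply: contraNneq (prod_b0 m n) => e; rewrite -red_cofactor1 e horner0. Qed.

Lemma red_den_neq0 : red_den != 0.
Proof. by rewrite red_denE mulf_neq0 ?red_cofactor_neq0 // expf_neq0 // (@subX_neq0 1). Qed.

Lemma size_red_den : (size red_den).-1 = (d + \sum_(0 <= i < n) b i)%N.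
Proof.
have bn0 i : i \in index_iota 0 n -> 1 - 'X^(b i) != 0 :> {poly rat}.
  by rewrite mem_index_iota => /andP[_ ni]; apply: subX_neq0; exact: b_num_gt0.
have p1 : (1 - 'X) ^+ d != 0 :> {poly rat} by rewrite expf_neq0 // (@subX_neq0 1).
have p2 : \prod_(0 <= i < n) (1 - 'X^(b i)) != 0 :> {poly rat}.
  by rewrite prodf_seq_neq0; apply/allP => i /bn0 ->; rewrite implybT.
rewrite /red_den zeta_den1 deg_mul //; congr addn.
  by rewrite size_exp (@size_subX 1) // mul1n.
rewrite deg_prod //; apply: eq_big_nat => i /andP[_ ni].
by rewrite size_subX // b_num_gt0.
Qed.

Definition des_deg (w : 'S_n) : nat := \sum_(j in Des w) b (n - j).

Lemma red_numE : red_num = \sum_(w : 'S_n) 'X^(des_deg w).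
Proof.
by rewrite /red_num zeta_num1; apply: eq_bigr => w _; rewrite /des_deg -expr_sum.
Qed.

(** The degree of a monomial grows with the set of descents, and all coefficients are
    nonnegative; so the permutation that descends everywhere gives the degree. *)
Lemma size_red_num : (size red_num).-1 = (\sum_(1 <= i < n) b i)%N.
Proof.
set E := (\sum_(1 <= i < n) b i)%N.
have EE : E = (\sum_(j < n | (0 < j)%N) b (n - j))%N.
  rewrite /E -(big_mkord (fun j => 0 < j)%N (fun j => b (n - j))) [RHS]big_ltn_cond //=.
  rewrite big_nat_rev [LHS]big_nat_cond [RHS]big_nat_cond; apply: eq_big => j.
    by rewrite andbT; case: (0 < j)%N; rewrite ?andbT.
  by rewrite subSS.
have dle w : (des_deg w <= E)%N.
  rewrite EE /des_deg [leqLHS]big_mkcond [leqRHS]big_mkcond; apply: leq_sum => j _.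
  by rewrite finset.inE; case: existsP => [[i /andP[/eqP <- _]]|_].
have coefE k : red_num`_k = (\sum_(w : 'S_n) (k == des_deg w))%:R.
  by rewrite red_numE coef_sum natr_sum; apply: eq_bigr => w _; rewrite coefXn.
have le : (size red_num <= E.+1)%N.
  apply/leq_sizeP => k Ek; rewrite coefE big1 // => w _; apply/eqP; rewrite eqb0.
  by apply: contraTneq Ek => ->; rewrite -leqNgt dle.
pose w0 : 'S_n := perm (@rev_ord_inj n).
have w0E : des_deg w0 = E.
  rewrite EE /des_deg; apply: eq_bigl => j; rewrite finset.inE.
  apply/existsP/idP => [[i /andP[/eqP <- _]] //|j0].
  have jn : (j.-1 < n)%N by rewrite (leq_ltn_trans (leq_pred _)).
  exists (Ordinal jn); rewrite /= prednK // eqxx !permE /=.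
  by have := ltn_ord j; lia.
have ge : (E < size red_num)%N.
  rewrite ltnNge; apply/negP => /leq_sizeP /(_ E (leqnn _)) /eqP.
  by rewrite coefE pnatr_eq0 (bigD1 w0) //= w0E eqxx.
by have /eqP -> : size red_num == E.+1 by rewrite eqn_leq le.
Qed.

Local Notation Z := (tofrac red_num / tofrac red_den).

Lemma red_zeta (W : ratfun2) :
  W = tofrac (zeta_num m n 'X 'X%:P) / tofrac (zeta_den m n 'X 'X%:P) ->
  forall F, is_red_zeta W F <-> F = Z.
Proof.
move=> WE F.
pose ratK : {rmorphism rat -> ratfun} := (@tofrac {poly rat} \o polyC : {rmorphism _ -> _}).
pose phi := ev2 ratK 1 ratvar.
have phiN : phi (zeta_num m n 'X 'X%:P) = tofrac red_num.
  by rewrite zeta_num_rmorph /phi ev2X ev2Y /red_num zeta_num_rmorph rmorph1.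
have phiD : phi (zeta_den m n 'X 'X%:P) = tofrac red_den.
  by rewrite zeta_den_rmorph /phi ev2X ev2Y /red_den zeta_den_rmorph rmorph1.
have phi0 : phi (zeta_den m n 'X 'X%:P) != 0 by rewrite phiD tofrac_eq0 red_den_neq0.
rewrite /is_red_zeta WE.
have -> : (fun p => eval2 p 1 ratvar) = (phi : _ -> _).
  by apply/funext => p; rewrite (eval2E ratK).
rewrite -phiN -phiD; split => [|->]; last exact: frac_at_div.
exact: frac_at_uniq.
Qed.

Lemma red_zetaE : Z = (\sum_(w : 'S_n) \prod_(j in Des w) ratvar ^+ b (n - j)) /
  ((1 - ratvar) ^+ d * \prod_(0 <= i < n) (1 - ratvar ^+ b i)).
Proof.
by rewrite /red_num /red_den zeta_num_rmorph zeta_den_rmorph !rmorph1 zeta_num1 zeta_den1.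
Qed.

Lemma red_degree : has_degree Z (- d%:Z - h%:Z).
Proof.
exists red_num, red_den; split => //.
- apply: contraTneq (fact_gt0 n) => e.
  by move: red_num1; rewrite e horner0 => /eqP; rewrite eq_sym pnatr_eq0 => /eqP ->.
- exact: red_den_neq0.
rewrite size_red_num size_red_den (big_ltn hn) /= b_num0 //.
rewrite !PoszD; ring.
Qed.

Lemma red_pole : pole_of_order Z 1 h.
Proof.
split; first by rewrite -b_num0 // b_num_gt0.
have -> : red_den = ('X - 1%:P) ^+ h * ((-1) ^+ h * red_cofactor).
  by rewrite red_denE mulrA -exprMn polyC1 mulrN1 opprB.
have q0 : ((-1) ^+ h * red_cofactor).[1] != 0.
  by rewrite hornerM horner_exp !hornerE mulf_neq0 ?signr_eq0 // red_cofactor1 prod_b0.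
have [c cl c0] := laurent_at_poly red_num h q0.
by exists c; rewrite // c0 mulf_neq0 ?invr_eq0 // red_num1 pnatr_eq0 -lt0n fact_gt0.
Qed.

Lemma red_value : value_at (Z * (1 - ratvar) ^+ h) 1 (mu_num m n).
Proof.
have -> : Z * (1 - ratvar) ^+ h = tofrac red_num / tofrac red_cofactor.
  have t0 : tofrac ((1 - 'X) ^+ h) != 0 :> ratfun.
    by rewrite tofrac_eq0 expf_neq0 // (@subX_neq0 1).
  have -> : (1 - ratvar) ^+ h = tofrac ((1 - 'X) ^+ h) by rewrite rmorphXn rmorphB rmorph1.
  rewrite red_denE tofracM; move: (tofrac (_ ^+ _)) t0 => r r0.
  by rewrite invfM mulrA mulrAC divfK.
have := @frac_at_div _ _ (horner_eval (1 : rat)) red_num red_cofactor.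
rewrite /= /horner_eval red_cofactor1 red_num1; apply.
exact: prod_b0.
Qed.

End Reduced.

(** * The topological and reduced ideal zeta functions *)
Theorem corollary3p7 (R : realType) (m n : nat) (W : ratfun2)
    (hm : (0 < m)%N) (hn : (0 < n)%N) (hW : is_uniform_zeta R m n W) :
  let d := d_num m n in
  let h := h_num m n in
  let a := a_num m n in
  let b := b_num m n in
  ((exists Z, is_top_zeta m n W Z) /\
   forall Z, is_top_zeta m n W Z ->
     [/\ Z = n`!%:R / ((\prod_(0 <= j < d) (ratvar - j%:R)) *
                       (\prod_(0 <= i < n) ((b i)%:R * ratvar - (a i)%:R))),
         has_degree Z (- h%:Z),
         pole_of_order Z 0 1 /\
         has_residue Z 0 ((-1) ^+ (h - 1) / (h - 1)`!%:R),
         (exists2 Zinv, inverse_subst Z Zinv &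
           value_at (ratvar ^- h * Zinv) 0 (mu_num m n))
       & 0 < mu_num m n /\
         exists2 N : nat, (0 < N)%N & mu_num m n * h`!%:R = N%:R]) /\
  ((exists Z, is_red_zeta W Z) /\
   forall Z, is_red_zeta W Z ->
     [/\ Z = (\sum_(w : 'S_n) \prod_(j in Des w) ratvar ^+ b (n - j)%N) /
             ((1 - ratvar) ^+ d * \prod_(0 <= i < n) (1 - ratvar ^+ b i)),
         has_degree Z (- d%:Z - h%:Z),
         pole_of_order Z 1 h
       & value_at (Z * (1 - ratvar) ^+ h) 1 (mu_num m n)]).
Proof.
move=> d h a b; have [D0 WE] := uniform_zeta_unique hm hn hW.
have topZ := top_zeta hn D0 WE; have redZ := red_zeta WE.
split; split.
- by exists (n`!%:R / top_den m n); apply/topZ.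
- move=> Z /topZ ->; split.
  + by [].
  + exact: top_degree.
  + have [c cl c0] := top_laurent hm hn; split; last by exists 0%N, c.
    split=> //; exists c => //.
    by rewrite c0 mulf_neq0 ?signr_eq0 // invr_eq0 pnatr_eq0 -lt0n fact_gt0.
  + exact: top_at_infinity.
  + by split; [exact: mu_gt0 | exact: mu_nat].
- by exists (tofrac (red_num m n) / tofrac (red_den m n)); apply/redZ.
- move=> Z /redZ ->; split.
  + exact: red_zetaE.
  + exact: red_degree.
  + exact: red_pole.
  + exact: red_value.
Qed.
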